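(* Let $T>0$, $Q=(0,T)\times(0,1)$, let $a$ satisfy (WD) or (SD), and let $\tilde c\in L^\infty(Q)$. Then there exist two positive constants $C$ and $s_0$ such that, for all $u_0\in H^1_a(0,1)$ and $f\in L^2(Q)$, the solution $u$ of $$\begin{cases}u_t-(a(x)u_x)_x+\tilde cu=f,\quad (t,x)\in Q,\\ u(t,1)=0\ \text{ and }\ \begin{cases}u(t,0)=0&\text{in case (WD)},\\ (a(x)u_x)(t,0)=0&\text{in case (SD)},\end{cases}\\ u(0,x)=u_0(x),\quad x\in(0,1),\end{cases}$$ satisfies $$\iint_Q\Big(\frac1{s\theta}\big(u_t^2+(\mathcal{M}u)^2\big)+s\theta a(x)u_x^2+s^3\theta^3\frac{x^2}{a(x)}u^2\Big)e^{2s\varphi}\,dx\,dt\le C\Big(\iint_Qf^2e^{2s\varphi}\,dx\,dt+sa(1)\int_0^T\theta\,u_x^2(t,1)e^{2s\varphi(t,1)}\,dt\Big)$$ for all $s\ge s_0$.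
   Context: **Diffusion coefficient.** $a:[0,1]\to\mathbb{R}$ satisfies one of the following. (WD): $a\in\mathcal{C}([0,1])\cap\mathcal{C}^1((0,1])$, $a>0$ in $(0,1]$, $a(0)=0$, and there is $K\in[0,1)$ with $xa'(x)\le Ka(x)$ for all $x\in(0,1]$. (SD): $a\in\mathcal{C}^1([0,1])$, $a>0$ in $(0,1]$, $a(0)=0$; there is $K\in[1,2)$ with $xa'(x)\le Ka(x)$ for all $x\in[0,1]$; and, if $K>1$, there is $\vartheta\in(1,K]$ such that $x\mapsto a(x)/x^{\vartheta}$ is nondecreasing near $0$, while if $K=1$ there is $\vartheta\in(0,1)$ such that $x\mapsto a(x)/x^\vartheta$ is nondecreasing near $0$. **Spaces and operator.** In case (WD), $H^1_a(0,1)$ is the set of $u\in L^2(0,1)$ absolutely continuous in $[0,1]$ with $\sqrt a\,u_x\in L^2(0,1)$ and $u(0)=u(1)=0$. In case (SD), $H^1_a(0,1)$ is the set of $u\in L^2(0,1)$ absolutely continuous in $(0,1]$ with $\sqrt a\,u_x\in L^2(0,1)$ and $u(1)=0$. $\mathcal{M}u=(au_x)_x$, with $D(\mathcal{M})=H^2_a(0,1)=\{u\in H^1_a(0,1):au_x\in H^1(0,1)\}$. **Weights.** $\theta(t)=\dfrac{1}{t^4(T-t)^4}$, $\psi(x)=\lambda\left(\int_0^x\frac{y}{a(y)}dy-c\right)$, $\varphi(t,x)=\theta(t)\psi(x)$, with parameters $c>5$, $\rho>\frac{4\ln2}{\|\sigma\|_\infty}$, $\frac{e^{2\rho\|\sigma\|_\infty}}{c-1}<\lambda<\frac{4}{3c}\left(e^{2\rho\|\sigma\|_\infty}-e^{\rho\|\sigma\|_\infty}\right)$,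 where $\sigma\in\mathcal{C}^2([0,1])$ satisfies $\sigma>0$ in $(0,1)$, $\sigma(0)=\sigma(1)=0$ and $\sigma_x\neq0$ in $[0,1]\setminus\omega_0$, $\omega_0$ being an open subset of the nonempty open control region $\omega\subset(0,1)$. *)

(* Defs.v *)
From mathcomp Require Import all_boot all_order all_algebra.
From mathcomp Require Import all_classical all_reals all_analysis.

Set Implicit Arguments.
Unset Strict Implicit.
Unset Printing Implicit Defensive.

Import Order.TTheory GRing.Theory Num.Theory.
Import numFieldNormedType.Exports.
Local Open Scope classical_set_scope.
Local Open Scope ring_scope.

(* f' is the derivative of f along D: at a boundary point of an interval D the
   derivative is one-sided. *)
Definition has_derivative_on (R : realType) (D : set R) (f f' : R -> R) : Prop :=
  forall x, D x ->
    (fun y => (f y - f x) / (y - x)) @ within D (x^') --> f' x.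

Definition C1_on (R : realType) (D : set R) (f f' : R -> R) : Prop :=
  has_derivative_on D f f' /\ {within D, continuous f'}.

Definition C2_on (R : realType) (D : set R) (f f' f'' : R -> R) : Prop :=
  has_derivative_on D f f' /\ C1_on D f' f''.

Definition left_derivative (R : realType) (f : R -> R) (x : R) : R :=
  lim ((fun y => (f y - f x) / (y - x)) @ x^'-).

Definition abs_continuous (R : realType) (a b : R) (f : R -> R) : Prop :=
  forall e : R, 0 < e -> exists2 d : R, 0 < d &
    forall (n : nat) (l r : 'I_n -> R),
      (forall i, [/\ a <= l i, l i <= r i & r i <= b]) ->
      (forall i j, i != j -> r i <= l j \/ r j <= l i) ->
      \sum_(i < n) (r i - l i) < d ->
      \sum_(i < n) `|f (r i) - f (l i)| < e.

Definition square_integrable d (T : measurableType d) (R : realType)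
    (mu : {measure set T -> \bar R}) (D : set T) (f : T -> R) : Prop :=
  measurable_fun D f /\ (\int[mu]_(x in D) ((f x) ^+ 2)%:E < +oo)%E.

Notation leb R := (@lebesgue_measure R).

Notation leb2 R := ((leb R \x leb R)%E).

Definition QT (R : realType) (T : R) : set (R * R) :=
  [set z | 0 < z.1 < T /\ 0 < z.2 < 1].

Definition L2_01 (R : realType) (f : R -> R) : Prop :=
  square_integrable (leb R) (`]0, 1[ : set R) f.

Definition L2_Q (R : realType) (T : R) (f : R -> R -> R) : Prop :=
  square_integrable (leb2 R) (QT T) (fun z => f z.1 z.2).

Definition Linfty_Q (R : realType) (T : R) (f : R -> R -> R) : Prop :=
  measurable_fun (QT T) (fun z => f z.1 z.2) /\
  exists M : R, {ae leb2 R, forall z, QT T z -> `|f z.1 z.2| <= M}.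

Inductive degeneracy := Weak | Strong.

Definition quotient_nondecreasing_near0 (R : realType) (a : R -> R) (th : R) :
    Prop :=
  exists2 d : R, 0 < d &
    forall x y, 0 < x -> x <= y -> y < d -> a x / x `^ th <= a y / y `^ th.

Definition weakly_degenerate (R : realType) (a : R -> R) : Prop :=
  exists (a' : R -> R) (K : R),
    [/\ {within `[0, 1], continuous a},
        C1_on `]0, 1] a a',
        (forall x, 0 < x <= 1 -> 0 < a x) /\ a 0 = 0,
        0 <= K < 1 &
        forall x, 0 < x <= 1 -> x * a' x <= K * a x].

Definition strongly_degenerate (R : realType) (a : R -> R) : Prop :=
  exists (a' : R -> R) (K : R),
    [/\ C1_on `[0, 1] a a',
        (forall x, 0 < x <= 1 -> 0 < a x) /\ a 0 = 0,
        1 <= K < 2,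
        (forall x, 0 <= x <= 1 -> x * a' x <= K * a x) &
        (1 < K -> exists2 th : R, 1 < th <= K &
           quotient_nondecreasing_near0 a th) /\
        (K = 1 -> exists2 th : R, 0 < th < 1 &
           quotient_nondecreasing_near0 a th)].

Definition degenerate (R : realType) (k : degeneracy) (a : R -> R) : Prop :=
  match k with
  | Weak => weakly_degenerate a
  | Strong => strongly_degenerate a
  end.

(* Elements of the spaces below are the absolutely continuous representatives;
   these are differentiable almost everywhere, and [derive1 u] takes a fixed default
   value at the remaining points. In the strong case the value [u 0] is
   irrelevant. *)
Definition H1a (R : realType) (k : degeneracy) (a u : R -> R) : Prop :=
  [/\ L2_01 u,
      match k with
      | Weak => abs_continuous 0 1 u
      | Strong => forall d : R, 0 < d < 1 -> abs_continuous d 1 u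
      end,
      L2_01 (fun x => Num.sqrt (a x) * derive1 u x),
      u 1 = 0 &
      match k with Weak => u 0 = 0 | Strong => True end].

Definition H1_01 (R : realType) (p : R -> R) : Prop :=
  abs_continuous 0 1 p /\ L2_01 (derive1 p).

Definition flux (R : realType) (a u : R -> R) : R -> R :=
  fun x => a x * derive1 u x.

(* [a u_x] belongs to H^1 as a class modulo null sets *)
Definition H2a (R : realType) (k : degeneracy) (a u : R -> R) : Prop :=
  H1a k a u /\
  exists2 p : R -> R, H1_01 p &
    {ae leb R, forall x, 0 < x < 1 -> p x = flux a u x}.

Definition Mop (R : realType) (a u : R -> R) : R -> R := derive1 (flux a u).

Definition boundary_conditions (R : realType) (k : degeneracy) (a u : R -> R) :
    Prop :=
  u 1 = 0 /\
  match k with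
  | Weak => u 0 = 0
  | Strong => flux a u x @[x --> 0^'+] --> (0 : R)
  end.

(* Solutions are taken in H^1(0,T;L^2(0,1)) and L^2(0,T;H^2_a(0,1)), the class
   of the solution when the initial datum is in H^1_a(0,1).
   [u t] is the value at time t of the representative continuous in time with
   values in L^2(0,1); [ut], [ux] and [Mu] are representatives, measurable on
   Q, of the L^2-valued time derivative of u, of u_x and of (a u_x)_x. The
   membership of u in H^1(0,T;L^2(0,1)) is the identity, in L^2(0,1),
   u(t2) - u(t1) = \int_t1^t2 u_t. *)
Record is_solution (R : realType) (k : degeneracy) (T : R) (a : R -> R)
    (tc : R -> R -> R) (u0 : R -> R) (f u ut ux Mu : R -> R -> R) : Prop := {
  sol_u_L2 : L2_Q T u ;
  sol_ut_L2 : L2_Q T ut ;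
  sol_ut : forall t1 t2, 0 <= t1 -> t1 <= t2 -> t2 <= T ->
    {ae leb R, forall x, 0 < x < 1 ->
      u t2 x - u t1 x = \int[leb R]_(t in `[t1, t2]) ut t x} ;
  sol_H2a : {ae leb R, forall t, 0 < t < T -> H2a k a (u t)} ;
  sol_ux : {ae leb2 R, forall z, QT T z -> ux z.1 z.2 = derive1 (u z.1) z.2} ;
  sol_ux_L2 : L2_Q T (fun t x => Num.sqrt (a x) * ux t x) ;
  sol_Mu : {ae leb2 R, forall z, QT T z -> Mu z.1 z.2 = Mop a (u z.1) z.2} ;
  sol_Mu_L2 : L2_Q T Mu ;
  sol_eq : {ae leb2 R, forall z, QT T z ->
    ut z.1 z.2 - Mu z.1 z.2 + tc z.1 z.2 * u z.1 z.2 = f z.1 z.2} ;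
  sol_boundary : {ae leb R, forall t, 0 < t < T ->
    boundary_conditions k a (u t)} ;
  sol_initial : {ae leb R, forall x, 0 < x < 1 -> u 0 x = u0 x}
}.

Definition sup_norm01 (R : realType) (f : R -> R) : R :=
  sup [set `|f x| | x in `[0, 1]].

Definition control_regions (R : realType) (omega omega0 : set R) : Prop :=
  [/\ open omega, omega !=set0, omega `<=` `]0, 1[, open omega0 &
      omega0 `<=` omega].

Definition sigma_admissible (R : realType) (omega0 : set R) (sigma : R -> R) :
    Prop :=
  exists sigma' sigma'' : R -> R,
    [/\ C2_on `[0, 1] sigma sigma' sigma'',
        forall x, 0 < x < 1 -> 0 < sigma x,
        sigma 0 = 0, sigma 1 = 0 &
        forall x, 0 <= x <= 1 -> ~ omega0 x -> sigma' x != 0].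

Definition admissible_parameters (R : realType) (sigma : R -> R)
    (c rho lam : R) : Prop :=
  let N := sup_norm01 sigma in
  [/\ 5 < c,
      4 * ln 2 / N < rho,
      expR (2 * rho * N) / (c - 1) < lam &
      lam < 4 / (3 * c) * (expR (2 * rho * N) - expR (rho * N))].

Definition theta (R : realType) (T t : R) : R := (t ^+ 4 * (T - t) ^+ 4)^-1.

Definition psi (R : realType) (a : R -> R) (c lam x : R) : R :=
  lam * (\int[leb R]_(y in `[0, x]) (y / a y) - c).

Definition phi (R : realType) (T : R) (a : R -> R) (c lam t x : R) : R :=
  theta T t * psi a c lam x.

(* Main.v *)
From HB Require Import structures.
Require Import Defs.
From mathcomp Require Import all_boot all_order all_algebra.
From mathcomp Require Import all_classical all_reals all_analysis.
From mathcomp Require Import measurable_realfun.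
From mathcomp Require Import ring lra.

(** The estimate is obtained by conjugating the equation with the weight and
    expanding a square. Write [theta = tau^4] with [tau = 1/(t (T - t))], and put
    [w = zeta u] with [zeta = exp (- eps tau^5 + s theta psi)]. For [eps = 0] this is
    the weight of the statement, but [psi] has no definite sign; the factor
    [exp (- eps tau^5)] makes [w] vanish at [t = 0] and [t = T] in all cases, so that
    no boundary term in time appears. At the very end [eps] tends to 0
    ([fatou_regularization]).

    With [mu = s theta], [nu = s theta'] and [q = nu psi + mu^2 lam^2 x^2/a] the
    equation reads [P + Q = zeta (f - c u)] up to an error of order [eps], where
    [P = - (a w_x)_x - q w] and [Q = w_t + R], [R = 2 mu lam x w_x + mu lam w]. In
    the integral of the square of [P + Q] the double product has three parts.
    The pairing of [- (a w_x)_x] with [w_t] is the derivative of an energy that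
    vanishes at both ends ([time_pairing_ge0]). The pairing of [- q w] with [w_t] is,
    after integration by parts in time, the integral of [q_t w^2 / 2], of lower order
    ([potential_density_eq0]). The product [P R] gives the boundary term at
    [x = 1] and the positive terms [mu lam (2 - K) a w_x^2] and
    [mu^3 lam^3 (2 - K) (x^2/a) w^2] ([carleman_multiplier]); this is where
    [x a' <= K a] with [K < 2] is used.

    One lower order term, [s tau^6 w^2], is not dominated by [(x^2/a) w^2] near
    [x = 0]; a Hardy-Poincare inequality absorbs it ([hardy_poincare]). The error in
    [eps] is treated by cases: where [x^2/a] is small, [psi] is negative and the
    weight absorbs all powers of [tau] ([psi_dichotomy], [weight_absorbs]). The
    bookkeeping of all constants is done pointwise, before integration
    ([carleman_pointwise]).

    The solution only has [u_t] and [(a u_x)_x] in [L^2], so each integration by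
    parts has to be justified. In space and in time they are the fundamental
    theorem of calculus for absolutely continuous functions ([abs_continuous_FTC]),
    proved by comparing the Stieltjes measure of the variation with the Lebesgue
    measure; boundary terms at the degenerate end vanish along a sequence
    ([liminf_at0]). The energy identity in time is replaced by the subgradient
    inequality between the times [t] and [t - h] ([energy_subgradient]), divided by
    [h] and passed to the limit by Fatou's lemma ([energy_pairing]). The trace of
    [u_x] at [x = 1] is not a priori measurable in time; it agrees almost everywhere
    with an integral of the flux ([flux_at1]). *)

Set Implicit Arguments.
Unset Strict Implicit.
Unset Printing Implicit Defensive.

Import Order.TTheory GRing.Theory Num.Theory.
Import numFieldNormedType.Exports.
Local Open Scope classical_set_scope.
Local Open Scope ring_scope.

Local Notation plane R := (measurableTypeR R * measurableTypeR R)%type.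

(** * Absolutely continuous functions *)

Section abs_continuous_lists.
Context {R : realType}.
Implicit Types (f : R -> R) (p q : R * R) (s c : seq (R * R)).

Definition nonoverlap p q := (p.2 <= q.1) || (q.2 <= p.1).

Definition subsegment (a b : R) p := [&& a <= p.1, p.1 <= p.2 & p.2 <= b].

(** Lists of segments, rather than families indexed by ordinals: they can be
    concatenated and refined, as [seq_ac_total_variation] requires. *)
Definition seq_ac (a b e d : R) f := forall s, all (subsegment a b) s ->
  pairwise nonoverlap s -> \sum_(p <- s) (p.2 - p.1) < d ->
  \sum_(p <- s) `|f p.2 - f p.1| < e.

Lemma abs_continuous_seq (a b : R) f : abs_continuous a b f ->
  forall e, 0 < e -> exists2 d, 0 < d & seq_ac a b e d f.
Proof.
move=> acf e e0; have [d d0 H] := acf e e0; exists d => // s sab sno sd.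
pose l (i : 'I_(size s)) := (nth (0, 0) s i).1.
pose r (i : 'I_(size s)) := (nth (0, 0) s i).2.
have /= := H _ l r; rewrite !(big_nth (0, 0)) !big_mkord; apply.
- by move=> i; have /allP /(_ _ (mem_nth (0, 0) (ltn_ord i))) /and3P[] := sab.
- have no (i j : 'I_(size s)) : (i < j)%N -> r i <= l j \/ r j <= l i.
    move=> ij; have /(pairwiseP (0, 0)) /(_ i j) := sno.
    by rewrite !inE !ltn_ord => /(_ isT isT ij)/orP.
  move=> i j; rewrite neq_ltn => /orP[] /no //.
  by case; [right|left].
- by move: sd; rewrite (big_nth (0, 0)) big_mkord.
Qed.

Definition segments (l : R) (t : seq R) := pairmap pair l t.

Lemma segments_subsegment l r t : path <%R l t -> last l t = r ->
  all (subsegment l r) (segments l t).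
Proof.
elim: t l => //= x t ih l /andP[lx pt] lr.
have xr : x <= r.
  by apply: (@itv_partition_le _ _ x r t); split => //; apply/eqP.
rewrite {1}/subsegment /= lexx (ltW lx) xr /=.
apply: sub_all (ih _ pt lr) => p /and3P[xp pp pr].
by rewrite /subsegment pp pr (le_trans (ltW lx) xp).
Qed.

Lemma segments_nonoverlap l t : path <%R l t ->
  pairwise nonoverlap (segments l t).
Proof.
elim: t l => //= x t ih l /andP[lx pt]; rewrite ih// andbT.
have /allP h := @segments_subsegment x _ t pt erefl.
by apply/allP => p /h /and3P[xp _ _]; rewrite /nonoverlap /= xp.
Qed.

Lemma segments_length l t : \sum_(p <- segments l t) (p.2 - p.1) = last l t - l.
Proof.
elim: t l => /= [l|x t ih l]; first by rewrite big_nil subrr.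
by rewrite big_cons ih /= addrC subrKA.
Qed.

Lemma segments_variation l r f t : itv_partition l r t ->
  variation l r f t = \sum_(p <- segments l t) `|f p.2 - f p.1|.
Proof.
move=> H; rewrite variation_zip //; elim: t l {H} => [l|x t ih l].
  by rewrite !big_nil.
by rewrite /= !big_cons ih.
Qed.

(** The bound [e] holds for every refinement of the segments, whatever the number
    of pieces, so increments may be replaced by total variations one segment at a
    time, taking the supremum over the subdivisions of that segment. *)
Lemma seq_ac_total_variation a b e d f c : seq_ac a b e d f ->
  forall s, all (subsegment a b) (s ++ c) -> pairwise nonoverlap (s ++ c) ->
  \sum_(p <- s ++ c) (p.2 - p.1) < d ->
  ((\sum_(p <- s) `|f p.2 - f p.1|)%:E
    + \sum_(p <- c) total_variation p.1 p.2 f <= e%:E)%E.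
Proof.
move=> acf; elim: c => [s|[l r] c ih s].
  rewrite cats0 big_nil adde0 lee_fin => ? ? ?; exact/ltW/acf.
rewrite all_cat /= => /and3P[sab lrab cab].
rewrite pairwise_cat allrel_consr /= => /and3P[/andP[slr sc] sno /andP[lrc cno]].
rewrite big_cat big_cons /= => lend.
rewrite big_cons /=.
have /and3P[/= al lr rb] : subsegment a b (l, r) := lrab.
have IHs : ((\sum_(p <- s) `|f p.2 - f p.1|)%:E
    + \sum_(p <- c) total_variation p.1 p.2 f <= e%:E)%E.
  apply: ih.
  - by rewrite all_cat sab.
  - by rewrite pairwise_cat sc sno cno.
  - rewrite big_cat /=; apply: le_lt_trans lend.
    by rewrite lerD2l lerDr subr_ge0.
move: lr => /=; rewrite le_eqVlt => /predU1P[{}lr|lr].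
  by rewrite -lr total_variationxx add0e.
set X : \bar R := (\sum_(p <- c) _)%E in IHs *.
have X0 : (0 <= X)%E.
  rewrite /X big_seq; apply: sume_ge0 => p pc.
  by apply: total_variation_ge0; have /allP /(_ _ pc) /and3P[] := cab.
have Xfin : X \is a fin_num.
  rewrite ge0_fin_numE //; apply: (@le_lt_trans _ _ e%:E); last exact: ltry.
  by apply: le_trans IHs; rewrite leeDr // lee_fin sumr_ge0.
rewrite addeCA -leeBrDr; last by rewrite fin_numD.
apply: ge_ereal_sup => _ [_ [t H <-] <-].
rewrite leeBrDr; last by rewrite fin_numD.
rewrite addeA -EFinD (segments_variation _ H) -big_cat /=.
case: H => pt /eqP lt; apply: ih.
- rewrite !all_cat sab cab !andbT.
  apply: sub_all (segments_subsegment pt lt) => p /and3P[lp pp pr].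
  by rewrite /subsegment pp (le_trans al lp) (le_trans pr rb).
- have /allP sg := segments_subsegment pt lt.
  rewrite !pairwise_cat allrel_catl sc sno cno segments_nonoverlap // !andbT /=.
  apply/andP; split; apply/allrelP => q p.
    move=> /sg /and3P[lq _ qr] pc.
    have /allP /(_ _ pc) /orP[] := lrc => /= h; apply/orP.
      by left; apply: le_trans h.
    by right; apply: le_trans h _.
  move=> /sg /and3P[lq _ qr] ps.
  have /allP /(_ _ ps) /orP[] := slr => /= h; apply/orP.
    by right; apply: le_trans lq.
  by left; apply: le_trans qr h.
- rewrite !big_cat /= segments_length lt; apply: le_lt_trans lend.
  by rewrite -addrA addrCA addrA.
Qed.

Lemma abs_continuous_near a b f : abs_continuous a b f ->
  forall e, 0 < e -> exists2 d, 0 < d & forall x y, a <= x -> x <= y -> y <= b ->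
    y - x < d -> `|f y - f x| < e.
Proof.
move=> /abs_continuous_seq acf e /acf[d d0 H]; exists d => // x y ax xy yb yxd.
by have := H [:: (x, y)]; rewrite !big_seq1 /= /subsegment /= ax xy yb; exact.
Qed.

(** On a segment shorter than the modulus for [e = 1] the variation is at most 1;
    finitely many such segments cover [[a, b]]. *)
Lemma abs_continuous_bounded_variation a b f : a <= b -> abs_continuous a b f ->
  bounded_variation a b f.
Proof.
move=> ab /abs_continuous_seq /(_ 1 ltr01)[d d0 H].
(* Steps of length d / 2 < d, because the modulus is a strict bound. *)
have d20 : 0 < d / 2 by rewrite divr_gt0.
have small x y : a <= x -> x <= y -> y <= b -> y - x < d ->
    (total_variation x y f <= 1%:E)%E.
  move=> ax xy yb yxd.
  have := seq_ac_total_variation H (c := [:: (x, y)]) (s := [::]).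
  rewrite /= !big_nil !big_seq1 add0e /=; apply => //.
  by rewrite /subsegment /= ax xy yb.
apply/bounded_variationP => //; rewrite ge0_fin_numE ?total_variation_ge0 //.
suff : forall n x, a <= x -> x <= b -> x - a <= n%:R * (d / 2) ->
    (total_variation a x f <= n%:R%:E)%E.
  move=> K; have [n _ nab] : exists2 n : nat, True & b - a <= n%:R * (d / 2).
    exists (Num.bound ((b - a) / (d / 2))) => //; rewrite -ler_pdivrMr //.
    by apply/ltW/archi_boundP; rewrite divr_ge0 ?subr_ge0 // ltW.
  by apply: le_lt_trans (K n b ab (lexx b) nab) (ltry _).
elim=> [x ax xb|n ih x ax xb].
  rewrite mul0r subr_le0 => xa.
  by have -> : x = a; [apply/le_anti; rewrite xa ax|rewrite total_variationxx].
have [xd|dx] := leP (x - d / 2) a; last first.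
  rewrite -natr1 mulrDl mul1r => xn.
  have xdx : x - d / 2 <= x by rewrite gerBl ltW.
  rewrite (total_variationD f (ltW dx) xdx) EFinD; apply: leeD.
    by apply: ih; [exact: ltW|exact: le_trans xb|rewrite addrAC lerBlDr].
  apply: small => //; first exact: ltW.
  by rewrite opprB addrC subrK ltr_pdivrMr // ltr_pMr // ltr1n.
move=> _; apply: (@le_trans _ _ 1%:E); last by rewrite lee_fin ler1n.
apply: small => //; apply: (@le_lt_trans _ _ (d / 2)).
  by rewrite lerBlDr -lerBlDl.
by rewrite ltr_pdivrMr // ltr_pMr // ltr1n.
Qed.

Lemma abs_continuousD a b f g : abs_continuous a b f -> abs_continuous a b g ->
  abs_continuous a b (f \+ g).
Proof.
move=> acf acg e e0; have e20 : 0 < e / 2 by rewrite divr_gt0.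
have [df df0 Hf] := acf _ e20; have [dg dg0 Hg] := acg _ e20.
exists (Num.min df dg); first by rewrite lt_min df0.
move=> n l r H1 H2; rewrite lt_min => /andP[lf lg].
apply: (@le_lt_trans _ _ (\sum_(i < n) `|f (r i) - f (l i)|
    + \sum_(i < n) `|g (r i) - g (l i)|)).
  rewrite -big_split /=; apply: ler_sum => i _.
  by rewrite opprD addrACA ler_normD.
by rewrite [ltRHS]splitr ltrD // ?Hf ?Hg.
Qed.

(** Domination of increments by an absolutely continuous function: the common
    source of the closure properties below. *)
Lemma abs_continuous_dominated a b f g k :
  0 <= k -> abs_continuous a b f ->
  (forall x y, a <= x -> x <= y -> y <= b ->
    `|g y - g x| <= k * `|f y - f x|) -> abs_continuous a b g.
Proof.
move=> k0 acf H e e0; have k10 : 0 < k + 1 by rewrite ltr_wpDl.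
have [d d0 Hd] := acf (e / (k + 1)) (divr_gt0 e0 k10).
exists d => // n l r H1 H2 lrd.
apply: (@le_lt_trans _ _ ((k + 1) * \sum_(i < n) `|f (r i) - f (l i)|)).
  rewrite mulr_sumr; apply: ler_sum => i _; have [? ? ?] := H1 i.
  by apply: le_trans (H _ _ _ _ _) _ => //; rewrite ler_wpM2r // lerDl.
by rewrite -ltr_pdivlMl // mulrC Hd.
Qed.

Lemma abs_continuous_id a b : abs_continuous a b (@idfun R).
Proof.
move=> e e0; exists e => // n l r H1 H2; apply: le_lt_trans.
by apply: ler_sum => i _; have [? ? ?] := H1 i; rewrite /= ger0_norm ?subr_ge0.
Qed.

Lemma lipschitz_abs_continuous a b f k : 0 <= k ->
  (forall x y, a <= x -> x <= y -> y <= b -> `|f y - f x| <= k * (y - x)) ->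
  abs_continuous a b f.
Proof.
move=> k0 H; apply: (abs_continuous_dominated k0 (abs_continuous_id a b)).
by move=> x y ax xy yb /=; rewrite [`|y - x|]ger0_norm ?subr_ge0 //; exact: H.
Qed.

Lemma abs_continuous_cst (a b k : R) : abs_continuous a b (fun=> k).
Proof.
by apply: (@lipschitz_abs_continuous _ _ _ 0) => // *; rewrite subrr normr0 mul0r.
Qed.

Lemma eq_abs_continuous a b f g : (forall x, a <= x <= b -> f x = g x) ->
  abs_continuous a b f -> abs_continuous a b g.
Proof.
move=> fg acf; apply: (abs_continuous_dominated ler01 acf) => x y ax xy yb.
by rewrite mul1r !fg // ?ax ?yb ?(le_trans ax) ?(le_trans xy).
Qed.

Lemma sub_abs_continuous a b a' b' f : a <= a' -> b' <= b ->
  abs_continuous a b f -> abs_continuous a' b' f.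
Proof.
move=> aa bb acf e e0; have [d d0 H] := acf e e0; exists d => // n l r H1.
apply: H => i; have [al lr rb] := H1 i.
by split => //; [exact: le_trans al|exact: le_trans bb].
Qed.

Lemma abs_continuous_bounded a b f : a <= b -> abs_continuous a b f ->
  exists2 M, 0 <= M & forall x, a <= x <= b -> `|f x| <= M.
Proof.
move=> ab /(abs_continuous_bounded_variation ab) bv.
have tv : total_variation a b f \is a fin_num by apply/bounded_variationP.
exists (`|f a| + fine (total_variation a b f)).
  by rewrite addr_ge0 // fine_ge0 // total_variation_ge0.
move=> x /andP[ax xb]; rewrite -(subrK (f a) (f x)) addrC.
apply: le_trans (ler_normD _ _) _; rewrite lerD2l -lee_fin fineK //.
apply: le_trans (total_variation_ge f ax) _.
by rewrite (total_variationD f ax xb) leeDl // total_variation_ge0.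
Qed.

Lemma abs_continuousM a b f g : a <= b ->
  abs_continuous a b f -> abs_continuous a b g ->
  abs_continuous a b (f \* g).
Proof.
move=> ab acf acg; have [A A0 HA] := abs_continuous_bounded ab acf.
have [B B0 HB] := abs_continuous_bounded ab acg.
move=> e e0; have e20 : 0 < e / 2 by rewrite divr_gt0.
have A1 : 0 < A + 1 by rewrite ltr_wpDl.
have B1 : 0 < B + 1 by rewrite ltr_wpDl.
have [df df0 Hf] := acf _ (divr_gt0 e20 B1).
have [dg dg0 Hg] := acg _ (divr_gt0 e20 A1).
exists (Num.min df dg); first by rewrite lt_min df0.
move=> n l r H1 H2; rewrite lt_min => /andP[lf lg].
apply: (@le_lt_trans _ _ ((B + 1) * (\sum_(i < n) `|f (r i) - f (l i)|)
    + (A + 1) * (\sum_(i < n) `|g (r i) - g (l i)|))).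
  rewrite !mulr_sumr -big_split /=; apply: ler_sum => i _.
  have [al lr rb] := H1 i.
  have -> : f (r i) * g (r i) - f (l i) * g (l i) =
    g (l i) * (f (r i) - f (l i)) + f (r i) * (g (r i) - g (l i)) by ring.
  apply: le_trans (ler_normD _ _) _; rewrite !normrM; apply: lerD.
    rewrite ler_wpM2r // (le_trans (HB _ _)) ?lerDl //.
    by rewrite al (le_trans lr).
  rewrite ler_wpM2r // (le_trans (HA _ _)) ?lerDl //.
  by rewrite rb (le_trans al).
rewrite [ltRHS]splitr ltrD //; rewrite -ltr_pdivlMl // mulrC.
  exact: Hf.
exact: Hg.
Qed.

(** The variation function of an absolutely continuous function is itself
    absolutely continuous: by [seq_ac_total_variation] a family of segments can
    be refined without control on the number of pieces. *)
Lemma total_variation_abs_continuous a b f : a <= b -> abs_continuous a b f ->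
  abs_continuous a b (fun x => fine (total_variation a x f)).
Proof.
move=> ab acf e e0; have e20 : 0 < e / 2 by rewrite divr_gt0.
have bv := abs_continuous_bounded_variation ab acf.
have tvfin x : a <= x -> x <= b -> total_variation a x f \is a fin_num.
  move=> ax xb; apply/bounded_variationP => //.
  exact: bounded_variationl bv.
have [d d0 H] := abs_continuous_seq acf e20; exists d => // n l r H1 H2 lrd.
apply: (@le_lt_trans _ _ (e / 2)); last by rewrite ltr_pdivrMr // ltr_pMr // ltr1n.
pose c := [seq (l i, r i) | i <- index_enum 'I_n].
have c_sub : all (subsegment a b) c.
  apply/allP => _ /mapP[i _ ->]; have [? ? ?] := H1 i.
  exact/and3P.
have c_no : pairwise nonoverlap c.
  rewrite pairwise_map; have : uniq (index_enum 'I_n) := index_enum_uniq 'I_n.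
  rewrite uniq_pairwise; apply: sub_pairwise => i j /= /H2[] h; apply/orP.
    by left.
  by right.
have := seq_ac_total_variation H (c := c) (s := [::]).
rewrite /= big_nil add0e !big_map /= => /(_ c_sub c_no lrd).
rewrite -lee_fin; apply: le_trans.
rewrite -sumEFin; apply: lee_sum => i _; have [al lr rb] := H1 i.
have lb := le_trans lr rb; have ar := le_trans al lr.
rewrite -fineB ?tvfin // ger0_norm; last first.
  apply: fine_ge0; rewrite sube_ge0 ?tvfin //.
  by apply: (@total_variation_nondecreasing _ _ b) => //; rewrite in_itv /= ?al ?ar.
rewrite fineK ?fin_numB ?tvfin //.
by rewrite leeBlDr ?tvfin // (total_variationD f al lr) addeC.
Qed.

End abs_continuous_lists.

(** * Densities of absolutely continuous functions *)

Section absolutely_continuous_density.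
Context {R : realType}.
Notation mu := (@lebesgue_measure R).

(** Composing with [clamp a b] extends a function given on [[a, b]] to the line by
    its end values, as a Stieltjes measure requires. *)
Definition clamp (a b x : R) := Num.max a (Num.min x b).

Lemma clamp_id a b x : a <= x <= b -> clamp a b x = x.
Proof. by move=> /andP[ax xb]; rewrite /clamp min_l // max_r. Qed.

Lemma clamp_itv a b x : a <= b -> a <= clamp a b x <= b.
Proof. by move=> ab; rewrite /clamp le_max lexx /= ge_max ab ge_min lexx orbT. Qed.

Lemma clamp_nd a b x y : x <= y -> clamp a b x <= clamp a b y.
Proof. by move=> xy; rewrite /clamp le_max2 // le_min2. Qed.

Lemma clampB a b x y : a <= b -> x <= y -> clamp a b y - clamp a b x <= y - x.
Proof.
move=> ab xy; rewrite /clamp.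
have [xb|bx] := leP x b; have [yb|by_] := leP y b; rewrite ?(max_r ab) //.
- have [ax|xa] := leP a x; have [ay|ya] := leP a y; lra.
- have [ax|xa] := leP a x; lra.
- lra.
- lra.
Qed.

Lemma clamp_continuous a b h : a <= b -> abs_continuous a b h ->
  continuous (h \o clamp a b).
Proof.
move=> ab ach x; apply/cvgrPdist_lt => e e0 /=.
have [d d0 H] := abs_continuous_near ach e0.
near=> y; have yx : `|x - y| < d by near: y; exact: cvgr_dist_lt.
have [xy|/ltW xy] := leP x y.
- rewrite distrC; apply: H.
  + by have /andP[] := clamp_itv x ab.
  + exact: clamp_nd.
  + by have /andP[] := clamp_itv y ab.
  + apply: le_lt_trans (clampB ab xy) _.
    by rewrite distrC ger0_norm ?subr_ge0 in yx.
- apply: H.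
  + by have /andP[] := clamp_itv y ab.
  + exact: clamp_nd.
  + by have /andP[] := clamp_itv x ab.
  + apply: le_lt_trans (clampB ab xy) _.
    by rewrite ger0_norm ?subr_ge0 in yx.
Unshelve. all: by end_near. Qed.

(** The open segment is contained in the cut and the half-open one covers it, so
    both have the measure of the cut; an empty cut is represented by [(a, a)]. *)
Lemma open_interval_cut (a b : R) (J : set R) : a <= b ->
  open J -> is_interval J ->
  exists p : R * R, [/\ a <= p.1, p.1 <= p.2 & p.2 <= b] /\
    [/\ J `&` `]a, b] `<=` `]p.1, p.2], `]p.1, p.2[ `<=` J `&` `]a, b] &
        (p.1 < p.2) || ((p.1 == a) && (p.2 == a)) ].
Proof.
move=> ab oJ iJ; set S := J `&` _.
have [S0|/set0P [z Sz]] := eqVneq S set0.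
  exists (a, a); split; first by split.
  rewrite /= !eqxx orbT S0; split => //.
  by move=> x /=; rewrite in_itv /= => /andP[/lt_trans h /h]; rewrite ltxx.
have lS x : S x -> a < x by move=> [_] /=; rewrite in_itv /= => /andP[].
have uS x : S x -> x <= b by move=> [_] /=; rewrite in_itv /= => /andP[].
have S_inf : has_inf S by split; [exists z|exists a => x /lS /ltW].
have S_sup : has_sup S by split; [exists z|exists b => x /uS].
have iS : is_interval S.
  move=> x y [Jx xab] [Jy yab] w xwy; split; first exact: (iJ x y).
  move: xab yab xwy; rewrite /= !in_itv /= => /andP[ax _] /andP[_ yb] /andP[xw wy].
  by rewrite (lt_le_trans ax xw) (le_trans wy yb).
have infS_lt x : S x -> inf S < x.
  move=> Sx; have [Jx _] := Sx; have ax := lS _ Sx.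
  near (x^'-) => y.
  have Jy : J y by near: y; apply: (@cvg_within _ (nbhs x)); exact: open_nbhs_nbhs.
  have ay : a < y by near: y; exact: nbhs_left_gt.
  have yx : y < x by near: y; exact: nbhs_left_lt.
  apply: le_lt_trans (yx); apply: ge_inf; first by case: S_inf.
  split => //=; rewrite in_itv /= ay; exact: le_trans (ltW yx) (uS _ Sx).
exists (inf S, sup S); split => /=; split.
- by apply: lb_le_inf; [exists z|move=> x /lS /ltW].
- apply: le_trans (ltW (infS_lt _ Sz)) _; apply: ub_le_sup => //; by case: S_sup.
- by apply: ge_sup; [exists z|move=> x /uS].
- move=> x Sx /=; rewrite in_itv /= infS_lt //=; apply: ub_le_sup => //.
  by case: S_sup.
- move=> x /=; rewrite in_itv /= => /andP[ix xs].
  have [y Sy yx] := inf_lt S_inf.1 ix.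
  have [w Sw xw] := sup_gt S_sup.1 xs.
  by apply: (iS y w) => //; rewrite (ltW yx) (ltW xw).
- apply/orP; left; apply: lt_le_trans (infS_lt _ Sz) _.
  by apply: ub_le_sup => //; case: S_sup.
Unshelve. all: by end_near. Qed.

Lemma disjoint_itv_nonoverlap (A B : set R) (p q : R * R) :
  A `&` B = set0 -> `]p.1, p.2[ `<=` A -> `]q.1, q.2[ `<=` B ->
  p.1 < p.2 -> q.1 < q.2 -> p.2 <= q.1 \/ q.2 <= p.1.
Proof.
move=> AB pA qB pp qq; apply: contrapT => /not_orP[/negP + /negP].
rewrite -!ltNge => qp pq.
pose x := (Num.max p.1 q.1 + Num.min p.2 q.2) / 2.
have h : Num.max p.1 q.1 < Num.min p.2 q.2.
  by rewrite gt_max !lt_min pp qq qp pq.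
have [h1 h2] := midf_lt h.
have : (A `&` B) x.
  move: h1 h2; rewrite gt_max lt_min => /andP[a1 a2] /andP[b1 b2].
  by split; [apply: pA|apply: qB]; rewrite /= in_itv /= ?a1 ?a2 ?b1 ?b2.
by rewrite AB.
Qed.

(** Restricted to a set of finite measure, [nu] falls under the Radon-Nikodym
    theorem. *)
Lemma dominated_measure_density (nu : {measure set (measurableTypeR R) -> \bar R})
    (D : set (measurableTypeR R)) (mD : measurable D) (nuD : (nu D < +oo)%E) :
  mfrestr mD nuD `<< mu -> exists2 g : R -> R, mu.-integrable setT (EFin \o g) &
  forall A : set (measurableTypeR R), measurable A -> A `<=` D ->
    nu A = (\int[mu]_(x in A) (g x)%:E)%E.
Proof.
move=> dom; pose m : {finite_measure set (measurableTypeR R) -> \bar R} := mfrestr mD nuD.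
pose G := Radon_Nikodym_SigmaFinite.f m mu.
have Gfin x : G x \is a fin_num by exact: Radon_Nikodym_SigmaFinite.f_fin_num.
have EGfine : EFin \o (fine \o G) = G by apply/funext => x /=; rewrite fineK.
exists (fine \o G).
  by rewrite EGfine; exact: Radon_Nikodym_SigmaFinite.f_integrable.
move=> A mA AD; rewrite -[X in (\int[_]_(x in _) X x)%E]/(EFin \o (fine \o G)).
rewrite EGfine -Radon_Nikodym_SigmaFinite.f_integral //.
by rewrite /= /mfrestr /mrestr setIidl.
Qed.

Section monotone.
Variables (a b : R) (h : R -> R).
Hypothesis ab : a <= b.
Hypothesis ach : abs_continuous a b h.
Hypothesis ndh : forall x y, a <= x -> x <= y -> y <= b -> h x <= h y.

Let hc := h \o clamp a b.

Let hc_nd : {homo hc : x y / x <= y}.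
Proof.
move=> x y xy; apply: ndh; last by have /andP[] := clamp_itv y ab.
  by have /andP[] := clamp_itv x ab.
exact: clamp_nd.
Qed.

Let hc_rc : forall x, hc @ at_right x --> hc x.
Proof. by apply: right_continuousW => x; exact: clamp_continuous. Qed.

HB.instance Definition _ := isCumulative.Build R _ R hc hc_nd hc_rc.

Let nu : {measure set (measurableTypeR R) -> \bar R} :=
  lebesgue_stieltjes_measure hc.

Let nu_ocitv x y : x <= y -> nu `]x, y]%classic = (hc y - hc x)%:E.
Proof.
move=> xy; rewrite /nu /= /lebesgue_stieltjes_measure /measure_extension /=.
rewrite measurable_mu_extE /=; last exact: is_ocitv.
by rewrite wlength_itv_bnd.
Qed.

Let mab : measurable (`]a, b] : set R).
Proof. exact: measurable_itv. Qed.

Let nuab : (nu `]a, b]%classic < +oo)%E.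
Proof. by rewrite nu_ocitv // ltry. Qed.

Let nu_dom : mfrestr mab nuab `<< mu.
Proof.
apply/null_content_dominatesP => A mA A0.
rewrite /mfrestr /mrestr.
apply/eqP; rewrite eq_le measure_ge0 andbT; apply/lee_addgt0Pr => e e0.
rewrite add0e; have [d d0 H] := ach e0.
have [U [oU AU UA]] : exists U : set R,
    [/\ open U, A `<=` U & (mu (U `\` A) < d%:E)%E].
  by apply: lebesgue_regularity_outer => //; rewrite A0.
have Ud : (mu U < d%:E)%E.
  have mU : measurable U by exact: open_measurable.
  rewrite -(setDUK AU) measureU ?A0 ?add0e//; last 2 first.
  - exact: measurableD.
  - by rewrite setDE setIC -setIA setICl setI0.
pose I := open_disjoint_itv oU.
have UI : U = \bigcup_q I q := open_disjoint_itv_bigcup oU.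
have triv : trivIset setT I by exact: open_disjoint_itv_trivIset.
have cutP q : exists p : R * R, [/\ a <= p.1, p.1 <= p.2 & p.2 <= b] /\
    [/\ I q `&` `]a, b]%classic `<=` `]p.1, p.2]%classic, `]p.1, p.2[%classic `<=` I q `&` `]a, b]%classic &
        (p.1 < p.2) || ((p.1 == a) && (p.2 == a)) ].
  apply: open_interval_cut => //; first exact: open_disjoint_itv_open.
  exact: open_disjoint_itv_is_interval.
have /choice [c cP] := cutP.
have mI q : measurable (I q).
  by apply: open_measurable; exact: open_disjoint_itv_open.
have mIab q : measurable (I q `&` `]a, b]%classic) by exact: measurableI.
have triv2 : trivIset setT (fun q => I q `&` `]a, b]%classic).
  apply/trivIsetP => i j _ _ ij; rewrite setIACA.
  by have /trivIsetP /(_ i j Logic.I Logic.I ij) := triv; rewrite setIid => ->; rewrite set0I.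
apply: (@le_trans _ _ (nu (\bigcup_q (I q `&` `]a, b]%classic)))).
  apply: le_measure; rewrite ?inE.
  - exact: measurableI.
  - by apply: bigcup_measurable => q _; exact: mIab.
  - by rewrite -setI_bigcupl -UI; exact: setSI.
rewrite measure_bigcup; [|by move=> i _; exact: mIab|exact: triv2].
apply: lime_le; first by apply: is_cvg_nneseries.
near=> n; rewrite big_mkord.
have sumh : (\sum_(i < n) nu (I i `&` `]a, b]%classic) <=
    (\sum_(i < n) `|h (c i).2 - h (c i).1|)%:E)%E.
  rewrite -sumEFin.
  apply: lee_sum => i _; have [[h1 h2 h3] [h4 h5 h6]] := cP i.
  apply: (@le_trans _ _ (nu `](c i).1, (c i).2]%classic)).
    apply: (@le_measure _ _ _ nu); rewrite ?inE; [exact: mIab| |exact: h4].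
    exact: measurable_itv.
  rewrite nu_ocitv // lee_fin /hc /= !clamp_id ?h1 ?h3 ?(le_trans h1) ?(le_trans h2) //.
  exact: ler_norm.
rewrite (eq_bigl xpredT); last by move=> i; rewrite in_setT.
apply: (le_trans sumh _); rewrite lee_fin; apply/ltW.
apply: (H n (fun i => (c i).1) (fun i => (c i).2)).
- by move=> i; have [[]] := cP i.
- move=> i j ij; have [[h1 h2 h3] [h4 h5 /orP[h6|/andP[/eqP h6 /eqP h7]]]] := cP i; last first.
    by have [[? _ _] _] := cP j; left; rewrite h7.
  have [[k1 k2 k3] [k4 k5 /orP[k6|/andP[/eqP k6 /eqP k7]]]] := cP j; last first.
    by right; rewrite k7.
  apply: disjoint_itv_nonoverlap h5 k5 h6 k6.
  by have /trivIsetP /(_ i j Logic.I Logic.I) := triv2; apply.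
- rewrite -lte_fin; apply: le_lt_trans Ud; rewrite -sumEFin.
  apply: (@le_trans _ _ (\sum_(i < n) mu (I i `&` `]a, b]%classic))%E).
    apply: lee_sum => i _; have [[h1 h2 h3] [h4 h5 h6]] := cP i.
    apply: (@le_trans _ _ (mu `](c i).1, (c i).2[%classic)).
      rewrite lebesgue_measure_itv /= lte_fin; case: ifPn => //.
      by rewrite -leNgt => h0; rewrite lee_fin subr_le0.
    apply: (@le_measure _ _ _ mu); rewrite ?inE; [exact: measurable_itv|exact: mIab|exact: h5].
  have E := @measure_bigsetU _ _ _ mu _ mIab triv2 n; rewrite /= in E; rewrite -E.
  apply: le_measure; rewrite ?inE.
  + by apply: bigsetU_measurable => i _; exact: mIab.
  + exact: open_measurable.
  + by rewrite UI => x Hx; have [i _ [Ix _]] :=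
      @bigsetU_bigcup _ (fun i => I i `&` `]a, b]%classic) n x Hx; exists i.
Unshelve. all: by end_near. Qed.

(** The Stieltjes measure of [h] is dominated by the Lebesgue measure. A null set
    lies in an open set of small measure; its components, cut to [a, b], are
    nonoverlapping segments of small total length, on which [h] increases little. *)
Lemma nondecreasing_ac_density : exists2 g : R -> R,
  mu.-integrable setT (EFin \o g) &
  forall x y, a <= x -> x <= y -> y <= b -> h y - h x = \int[mu]_(z in `[x, y]) g z.
Proof.
have [g ig gE] := @dominated_measure_density nu _ mab nuab nu_dom.
exists g => // x y ax xy yb.
rewrite -Rintegral_itv_obnd_cbnd; last exact: (@integrableS _ _ _ _ setT).
rewrite /Rintegral -gE //; last first.
  move=> z /=; rewrite !in_itv /= => /andP[xz zy].
  by rewrite (le_lt_trans ax xz) (le_trans zy yb).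
by rewrite nu_ocitv //= /hc /= !clamp_id ?ax ?yb ?(le_trans ax) ?(le_trans xy).
Qed.

End monotone.

(** Jordan decomposition: half the variation plus or minus half the function
    are monotone, and both are absolutely continuous. *)
Lemma abs_continuous_density a b f : a <= b -> abs_continuous a b f ->
  exists2 g : R -> R, mu.-integrable setT (EFin \o g) &
  forall x y, a <= x -> x <= y -> y <= b -> f y - f x = \int[mu]_(z in `[x, y]) g z.
Proof.
move=> ab acf; pose v x := fine (total_variation a x f).
have acv : abs_continuous a b v := total_variation_abs_continuous ab acf.
have bv := abs_continuous_bounded_variation ab acf.
have vB x y : a <= x -> x <= y -> y <= b -> `|f y - f x| <= v y - v x.
  move=> ax xy yb; have tvfin z : a <= z -> z <= b -> total_variation a z f \is a fin_num.
    move=> az zb; apply/bounded_variationP => //.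
    exact: bounded_variationl bv.
  have xb := le_trans xy yb; have ay := le_trans ax xy.
  rewrite -lee_fin /v EFinB !fineK ?tvfin // leeBrDr ?tvfin //.
  by rewrite (total_variationD f ax xy) addeC leeD // total_variation_ge.
have ac2 (k : R) : `|k| <= 1 -> abs_continuous a b (fun x => v x + k * f x).
  move=> k1; apply: (abs_continuousD acv).
  apply: (abs_continuous_dominated ler01 acf) => x y ax xy yb.
  by rewrite -mulrBr normrM ler_wpM2r.
have nd (k : R) : `|k| <= 1 -> forall x y, a <= x -> x <= y -> y <= b ->
    v x + k * f x <= v y + k * f y.
  move=> k1 x y ax xy yb; have := vB _ _ ax xy yb.
  have : - (k * (f y - f x)) <= `|f y - f x|.
    by apply: le_trans (ler_norm _) _; rewrite normrN normrM ler_piMl.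
  by rewrite mulrBr; lra.
have n1 : `|1 : R| <= 1 by rewrite normr1.
have nN1 : `|-1 : R| <= 1 by rewrite normrN1.
have [g1 ig1 g1E] := nondecreasing_ac_density ab (ac2 _ n1) (nd _ n1).
have [g2 ig2 g2E] := nondecreasing_ac_density ab (ac2 _ nN1) (nd _ nN1).
exists (fun x => 2^-1 * (g1 x - g2 x)).
  exact: (integrableZl measurableT 2^-1 (integrableB measurableT ig1 ig2)).
move=> x y ax xy yb.
have i1 : mu.-integrable `[x, y] (EFin \o g1) by exact: integrableS ig1.
have i2 : mu.-integrable `[x, y] (EFin \o g2) by exact: integrableS ig2.
rewrite RintegralZl //; last exact: (integrableB _ i1 i2).
rewrite RintegralB // -g1E // -g2E //.
lra.
Qed.

(** The density is the derivative almost everywhere, by Lebesgue differentiation. *)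
Theorem abs_continuous_FTC a b f : a <= b -> abs_continuous a b f ->
  exists g : R -> R, [/\ mu.-integrable setT (EFin \o g),
    forall x y, a <= x -> x <= y -> y <= b -> f y - f x = \int[mu]_(z in `[x, y]) g z &
    {ae mu, forall x, a < x < b -> is_derive x 1 f (g x)}].
Proof.
move=> ab acf; have [g ig gE] := abs_continuous_density ab acf.
exists g; split => //.
have lg : locally_integrable setT g.
  by apply: open_integrable_locally => //; exact: openT.
have /= := @FTC1 R g (BLeft a) _ lg.
have igS y : mu.-integrable [set` Interval (BLeft a) (BRight y)] (EFin \o g).
  exact: integrableS ig.
move=> /(_ igS).
apply: filterS; first exact: (ae_filter_ringOfSetsType mu).
move=> x H /andP[ax xb].
have [|dF F'] := H; first by rewrite ?bnd_simp /= ?ltW.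
apply: (@near_eq_is_derive _ _ _ (fun x => f a +
   \int[mu]_(t in [set` Interval (BLeft a) (BRight x)]) g t)).
  near=> y.
  have ay : a < y by near: y; exact: lt_nbhsr.
  have yb : y < b by near: y; exact: lt_nbhsl.
  by rewrite -gE ?(ltW ay) ?(ltW yb) // addrC subrK.
rewrite -[g x]add0r; apply: is_deriveD.
by rewrite -F' derive1E; exact: derivableP.
Unshelve. all: by end_near. Qed.

(** Conversely an indefinite integral is absolutely continuous, since the
    integral of an integrable function over a small set is small. *)
Lemma integral_abs_continuous a b f g : mu.-integrable setT (EFin \o g) ->
  (forall x y, a <= x -> x <= y -> y <= b -> f y - f x = \int[mu]_(z in `[x, y]) g z) ->
  abs_continuous a b f.
Proof.
move=> ig fE e e0; have [d [d0 H]] := integral_normr_continuous ig e0.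
exists d => // n l r H1 H2 lrd.
pose J (i : 'I_n) : set (measurableTypeR R) := `]l i, r i[%classic.
have mJ i : measurable (J i) by exact: measurable_itv.
have tJ : trivIset [set` index_enum 'I_n] J.
  apply/trivIsetP => i j _ _ ij; apply/seteqP; split => // x [].
  rewrite /J /= !in_itv /= => /andP[lx xr] /andP[ly yr].
  by have [h|h] := H2 i j ij; [have := lt_le_trans xr h|have := lt_le_trans yr h]; lra.
pose A := \big[setU/set0]_(i < n) J i.
have mA : measurable A by exact: bigsetU_measurable.
have Ad : (mu A < d%:E)%E.
  rewrite -[mu A]mul1e -integral_cst //= (ge0_integral_bigsetU mu mJ (index_enum_uniq _) tJ) //.
  rewrite -lte_fin in lrd; apply: le_lt_trans lrd; rewrite -sumEFin.
  apply: lee_sum => i _; rewrite integral_cst // mul1e.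
  have := @lebesgue_measure_itv R `]l i, r i[; rewrite /= lte_fin => ->.
  by case: ifPn => // _; rewrite lee_fin subr_ge0; have [] := H1 i.
have iabs : mu.-integrable setT (EFin \o (fun x => `|g x|)).
  exact: (integrable_norm ig).
apply: le_lt_trans (H A mA Ad).
rewrite -lee_fin -sumEFin fineK; last first.
  by apply: integrable_fin_num => //; exact: integrableS iabs.
rewrite (ge0_integral_bigsetU mu mJ (index_enum_uniq _) tJ) //; last first.
  by apply: (measurable_funS measurableT) => //; exact: measurable_int iabs.
apply: lee_sum => i _; have [al lr rb] := H1 i.
have iJ : mu.-integrable `[l i, r i] (EFin \o g) by exact: integrableS ig.
have iJ' : mu.-integrable (J i) (EFin \o (fun x => `|g x|)) by exact: integrableS iabs.
rewrite fE //; apply: le_trans (_ : (\int[mu]_(x in `[l i, r i]) `|g x|)%:E <= _)%E.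
  by rewrite lee_fin; exact: le_normr_Rintegral.
rewrite /Rintegral fineK; last first.
  by apply: integrable_fin_num => //; exact: integrableS iabs.
rewrite -(@integral_itv_bndoo _ _ _ _ true false) //.
apply: (measurable_funS measurableT) => //; exact: measurable_int iabs.
Qed.

End absolutely_continuous_density.

(** * Integrable functions and vanishing boundary terms *)

Section almost_everywhere.
Context d (T : measurableType d) (R : realType) (mu : {measure set T -> \bar R}).
Implicit Types P Q : T -> Prop.

Lemma ae_mono P Q : (forall x, P x -> Q x) -> {ae mu, forall x, P x} ->
  {ae mu, forall x, Q x}.
Proof.
by move=> PQ; apply: filterS => //; exact: (ae_filter_ringOfSetsType mu).
Qed.

Lemma ae_and P Q : {ae mu, forall x, P x} -> {ae mu, forall x, Q x} ->
  {ae mu, forall x, P x /\ Q x}.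
Proof.
by apply: filterI; exact: (ae_filter_ringOfSetsType mu).
Qed.

End almost_everywhere.

Section square_integrable.
Context d (T : measurableType d) (R : realType) (mu : {measure set T -> \bar R}).
Variables (D : set T) (mD : measurable D).
Implicit Types f g h : T -> R.
Local Notation L2 := (square_integrable mu D).
Local Notation L1 h := (mu.-integrable D (EFin \o h)).

Lemma le_L1 f g : measurable_fun D f -> (forall x, D x -> `|f x| <= g x) ->
  L1 g -> L1 f.
Proof.
move=> mf fg ig; apply: (le_integrable mD _ _ ig); first exact/measurable_EFinP.
by move=> x Dx /=; rewrite lee_fin (le_trans (fg _ Dx)) // ler_norm.
Qed.

Lemma L1D f g : L1 f -> L1 g -> L1 (fun x => f x + g x).
Proof. by move=> fi gi; exact: (integrableD mD fi gi). Qed.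

Lemma L1B f g : L1 f -> L1 g -> L1 (fun x => f x - g x).
Proof. by move=> fi gi; exact: (integrableB mD fi gi). Qed.

Lemma L1Z k f : L1 f -> L1 (fun x => k * f x).
Proof. by move=> fi; exact: (integrableZl mD k fi). Qed.

Lemma L1N f : L1 f -> L1 (fun x => - f x).
Proof.
move=> /(L1Z (-1)); rewrite (_ : EFin \o _ = EFin \o (fun x => - f x)) //.
by apply/funext => x /=; rewrite mulN1r.
Qed.

Lemma L1_measurable f : L1 f -> measurable_fun D f.
Proof. by move=> /measurable_int /measurable_EFinP. Qed.

Lemma L2_measurable f : L2 f -> measurable_fun D f.
Proof. by case. Qed.

Lemma L2P f : L2 f <-> measurable_fun D f /\ L1 (fun x => f x ^+ 2).
Proof.
split=> [[mf fi]|[mf /integrableP[_ fi]]].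
  split => //; apply/integrableP; split.
    by apply/measurable_EFinP; exact: measurable_funX.
  by under eq_integral do rewrite /= ger0_norm ?sqr_ge0 //.
split => //; apply: le_lt_trans fi; rewrite le_eqVlt; apply/orP; left; apply/eqP.
by apply: eq_integral => x _ /=; rewrite ger0_norm ?sqr_ge0.
Qed.

Lemma L2_sqr f : L2 f -> L1 (fun x => f x ^+ 2).
Proof. by move=> /L2P[]. Qed.

Lemma L2M f g : L2 f -> L2 g -> L1 (fun x => f x * g x).
Proof.
move=> /L2P[mf fi] /L2P[mg gi].
apply: le_L1 (L1D fi gi); first exact: measurable_funM.
move=> x _; rewrite normrM -(real_normK (num_real (f x))) -(real_normK (num_real (g x))).
have := sqr_ge0 (`|f x| - `|g x|); have := normr_ge0 (f x); have := normr_ge0 (g x).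
by move: `|f x| `|g x| => u v u0 v0; nra.
Qed.

Lemma L2_cst (r : R) : (mu D < +oo)%E -> L2 (fun=> r).
Proof.
move=> Dfin; split; first exact: measurable_cst.
rewrite /= integral_cst //; have [->|r0] := eqVneq (r ^+ 2) 0; first by rewrite mul0e ltry.
by rewrite lte_mul_pinfty ?lee_fin ?sqr_ge0.
Qed.

Lemma L2_L1 f : (mu D < +oo)%E -> L2 f -> L1 f.
Proof.
move=> Dfin Lf; have := L2M Lf (L2_cst 1 Dfin); congr (mu.-integrable D _).
by apply/funext => x /=; rewrite mulr1.
Qed.

Lemma L2D f g : L2 f -> L2 g -> L2 (fun x => f x + g x).
Proof.
move=> Lf Lg; have [mf fi] := (L2P f).1 Lf; have [mg gi] := (L2P g).1 Lg.
apply/L2P; split; first exact: measurable_funD.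
apply: le_L1 (L1D (L1D fi gi) (L1D (L2M Lf Lg) (L2M Lf Lg))).
  by apply: measurable_funX; exact: measurable_funD.
by move=> x _; rewrite ger0_norm ?sqr_ge0 //; lra.
Qed.

Lemma bounded_L2 k f g : measurable_fun D g -> (forall x, D x -> `|g x| <= k) ->
  L2 f -> L2 (fun x => g x * f x).
Proof.
move=> mg gk /L2P[mf fi]; apply/L2P; split; first exact: measurable_funM.
apply: le_L1 (L1Z (k ^+ 2) fi); first by apply: measurable_funX; exact: measurable_funM.
move=> x Dx; rewrite ger0_norm ?sqr_ge0 // exprMn ler_wpM2r ?sqr_ge0 //.
by rewrite -(real_normK (num_real (g x))) ler_sqr ?nnegrE ?(le_trans _ (gk _ Dx)) ?gk.
Qed.

Lemma bounded_L1 k f g : measurable_fun D g -> (forall x, D x -> `|g x| <= k) ->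
  L1 f -> L1 (fun x => g x * f x).
Proof.
move=> mg gk fi; have mf := L1_measurable fi.
apply: le_L1 (L1Z k (integrable_norm fi)); first exact: measurable_funM.
by move=> x Dx; rewrite normrM ler_wpM2r // gk.
Qed.

Lemma L2Z k f : L2 f -> L2 (fun x => k * f x).
Proof. by apply: (@bounded_L2 `|k|). Qed.

Lemma L2B f g : L2 f -> L2 g -> L2 (fun x => f x - g x).
Proof.
move=> Lf /(L2Z (-1)) /(L2D Lf); rewrite (_ : (fun x => _) = (fun x => f x - g x)) //.
by apply/funext => x; rewrite mulN1r.
Qed.

Lemma eq_L2 f g : {in D, f =1 g} -> L2 f -> L2 g.
Proof.
move=> fg [mf fi]; split; first exact: eq_measurable_fun mf.
by apply: le_lt_trans fi; rewrite le_eqVlt; apply/orP; left; apply/eqP;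
  apply: eq_integral => x xD; rewrite fg.
Qed.

End square_integrable.

Section absolutely_continuous_improper.
Context {R : realType}.
Notation mu := (@lebesgue_measure R).
Implicit Types (B f h : R -> R).

Lemma lebesgue_measure_oo_fin (x y : R) :
  (mu (`]x, y[%classic : set (measurableTypeR R)) < +oo)%E.
Proof. by rewrite lebesgue_measure_itv /=; case: ifP; rewrite ?ltry // -EFinB ltry. Qed.

Lemma integral_small_set f (D : set (measurableTypeR R)) (e : R) : measurable D -> 0 < e ->
  mu.-integrable D (EFin \o f) -> exists2 d : R, 0 < d &
  forall A, measurable A -> A `<=` D -> (mu A < d%:E)%E ->
    \int[mu]_(x in A) `|f x| < e.
Proof.
move=> mD e0 fi; have iT : mu.-integrable setT (EFin \o (f \_ D)).
  rewrite (_ : EFin \o _ = (EFin \o f) \_ D); last first.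
    by apply/funext => x; rewrite /= !patchE; case: ifP.
  exact/(integrable_mkcond _ mD).1.
have [d [d0 H]] := integral_normr_continuous iT e0.
exists d => // A mA AD /(H A mA); congr (_ < _).
by apply: eq_Rintegral => x /set_mem /AD Dx; rewrite patchE mem_set.
Qed.

(** Only an almost everywhere inequality is available; [max f g] is above [f]
    everywhere and has the integral of [g]. *)
Lemma ae_le_Rintegral d (X : measurableType d) (m : {measure set X -> \bar R})
    (D : set X) (f g : X -> R) : measurable D ->
  m.-integrable D (EFin \o f) -> m.-integrable D (EFin \o g) ->
  {ae m, forall x, D x -> f x <= g x} ->
  \int[m]_(x in D) f x <= \int[m]_(x in D) g x.
Proof.
move=> mD fi gi fg.
have mxi : m.-integrable D (EFin \o (fun x => Num.max (f x) (g x))).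
  apply: (le_L1 mD) (L1D mD (integrable_norm fi) (integrable_norm gi)).
    by apply: measurable_maxr; [exact: L1_measurable fi|exact: L1_measurable gi].
  move=> x _; have [|] := leP (f x) (g x) => _.
    by rewrite /= lerDr.
  by rewrite /= lerDl.
apply: (@le_trans _ _ (\int[m]_(x in D) Num.max (f x) (g x))).
  by apply: le_Rintegral => // x _; rewrite le_max lexx.
rewrite le_eqVlt; apply/orP; left; apply/eqP; congr fine.
apply: ae_eq_integral => //.
- by apply/measurable_EFinP; exact: L1_measurable mxi.
- by apply/measurable_EFinP; exact: L1_measurable gi.
- by apply: ae_mono fg => x H Dx; rewrite max_r ?H.
Qed.

Lemma Rintegral_itv_cc_oo f (x y : R) : mu.-integrable `[x, y] (EFin \o f) ->
  \int[mu]_(z in `[x, y]) f z = \int[mu]_(z in `]x, y[) f z.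
Proof.
move=> fi; have sub : `]x, y[ `<=` (`[x, y] : set R).
  by move=> z /=; rewrite !in_itv /= => /andP[/ltW -> /ltW ->].
rewrite /Rintegral; congr fine; apply: integral_itv_bndoo.
by apply: (measurable_funS _ sub) => //; exact: measurable_int fi.
Qed.

(** Integrating a differential inequality up to an endpoint where the
    primitive is only known along a sequence: this is the form in which all
    integrations by parts in space are used. *)
Lemma ac_improper_le (lo hi : R) B f : lo < hi ->
  mu.-integrable `]lo, hi[ (EFin \o f) ->
  (forall d, lo < d < hi -> abs_continuous d hi B) ->
  {ae mu, forall x, lo < x < hi -> exists2 l, is_derive x 1 B l & l <= f x} ->
  (forall e, 0 < e -> exists d, [/\ lo < d, d < lo + e, d < hi & B d <= e]) ->
  B hi <= \int[mu]_(x in `]lo, hi[) f x.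
Proof.
move=> lohi fi acB dB Bd; apply/ler_addgt0Pr => e e0.
have e20 : 0 < e / 2 by rewrite divr_gt0.
have [d0 d00 small] := integral_small_set (measurable_itv _) e20 fi.
have [d [lod de dhi Bde]] : exists d, [/\ lo < d, d < lo + d0, d < hi & B d <= e / 2].
  have m0 : 0 < Num.min d0 (e / 2) by rewrite lt_min d00.
  have [d [h1 h2 h3 h4]] := Bd _ m0; exists d; split => //.
    by apply: lt_le_trans h2 _; rewrite lerD2l ge_min lexx.
  by apply: le_trans h4 _; rewrite ge_min lexx orbT.
have acd : abs_continuous d hi B by apply: acB; rewrite lod.
have [g [ig gE gder]] := abs_continuous_FTC (ltW dhi) acd.
have sub1 : `]d, hi[ `<=` (`]lo, hi[ : set R).
  by move=> x /=; rewrite !in_itv /= => /andP[/(lt_trans lod) -> ->].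
have sub2 : `]lo, d] `<=` (`]lo, hi[ : set R).
  by move=> x /=; rewrite !in_itv /= => /andP[-> /le_lt_trans]; exact.
have fi1 : mu.-integrable `]d, hi[ (EFin \o f) by exact: integrableS fi.
have fi2 : mu.-integrable `]lo, d] (EFin \o f) by exact: integrableS fi.
have igS : mu.-integrable `]d, hi[ (EFin \o g) by exact: integrableS ig.
have h1 : B hi - B d <= \int[mu]_(x in `]d, hi[) f x.
  rewrite gE ?lexx ?(ltW dhi) //.
  rewrite -Rintegral_itv_bndo_bndc; last first.
    by apply: (integrableS _ _ _ ig) => //; exact: measurable_itv.
  rewrite -Rintegral_itv_obnd_cbnd //.
  apply: (ae_le_Rintegral (X := measurableTypeR R) (m := leb R) (D := `]d, hi[%classic)) => //.
  apply: ae_mono (ae_and gder dB) => x [H1 H2] /=.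
  rewrite in_itv /= => /andP[dx xhi].
  have xlohi : lo < x < hi by rewrite xhi (lt_trans lod).
  have [l dl lf] := H2 xlohi.
  have dg : is_derive x 1 B (g x) by apply: H1; rewrite dx.
  by rewrite -(@derive_val _ _ _ _ _ _ _ dg) (@derive_val _ _ _ _ _ _ _ dl).
have h2 : \int[mu]_(x in `]lo, hi[) f x =
    \int[mu]_(x in `]lo, d]) f x + \int[mu]_(x in `]d, hi[) f x.
  rewrite -Rintegral_setU //=.
  - by congr Rintegral; rewrite -itv_bndbnd_setU // bnd_simp // ltW.
  - by rewrite -itv_bndbnd_setU // bnd_simp // ltW.
  - by apply/disj_setPS => x /= []; rewrite !in_itv /= => /andP[_ h] /andP[/lt_le_trans /(_ h)];
      rewrite ltxx.
have h3 : `|\int[mu]_(x in `]lo, d]) f x| < e / 2.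
  apply: le_lt_trans (le_normr_Rintegral _ fi2) _ => //.
  apply: small => //; rewrite lebesgue_measure_itv /= lte_fin lod -EFinB lte_fin.
  by rewrite ltrBlDl.
have := ler_norm (- \int[mu]_(x in `]lo, d]) f x); rewrite normrN h2.
move: h1 h3 Bde.
move: (\int[mu]_(x in `]d, hi[) f x) (\int[mu]_(x in `]lo, d]) f x) => I1 I2.
lra.
Qed.

(** An integrable function cannot exceed [e / x] near the origin, since [1/x] is
    not integrable there. *)
Lemma integrable_liminf h : (forall x, 0 < x < 1 -> 0 <= h x) ->
  mu.-integrable `]0, 1[ (EFin \o h) ->
  forall e, 0 < e -> exists d, [/\ 0 < d, d < e, d < 1 & d * h d <= e].
Proof.
move=> h0 hi e e0; apply: contrapT => H.
have big x : 0 < x -> x < e -> x < 1 -> e < x * h x.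
  move=> x0 xe x1; rewrite ltNge; apply/negP => hx; apply: H.
  by exists x.
have e20 : 0 < e / 2 by rewrite divr_gt0.
have [d0 d00 small] := integral_small_set (measurable_itv _) e20 hi.
pose d := Num.min (d0 / 2) (Num.min (e / 2) (2^-1)).
have dpos : 0 < d by rewrite !lt_min !divr_gt0 //= invr_gt0.
have dd0 : d < d0.
  by apply: (@le_lt_trans _ _ (d0 / 2)); [rewrite ge_min lexx|lra].
have de : d < e.
  by apply: (@le_lt_trans _ _ (e / 2)); [rewrite !ge_min lexx orbT|lra].
have d1 : d < 1.
  by apply: (@le_lt_trans _ _ (2^-1)); [rewrite !ge_min lexx !orbT|lra].
have sub : `[d / 2, d] `<=` (`]0, 1[ : set R).
  move=> x /=; rewrite !in_itv /= => /andP[h1 h2]; lra.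
(* Otherwise h > e / x on [d / 2, d], where its integral is at least e / 2. *)
have := small `[d / 2, d]%classic (measurable_itv _) sub.
have mudd : mu `[d / 2, d]%classic = (d / 2)%:E.
  rewrite lebesgue_measure_itv /= lte_fin ifT; last lra.
  by congr EFin; lra.
rewrite mudd lte_fin => hd; have {}hd := hd (_ : d / 2 < d0).
suff : e / 2 <= \int[mu]_(x in `[d / 2, d]) `|h x|.
  rewrite leNgt hd //; lra.
apply: (@le_trans _ _ (\int[mu]_(x in `[d / 2, d]) (e / d))).
  rewrite Rintegral_cst // (_ : fine _ = d / 2); last by rewrite [X in fine X]mudd.
  by rewrite mulrA divfK // gt_eqF.
apply: le_Rintegral => //.
- apply/integrableP; split; first exact: measurable_cst.
  by rewrite /= integral_cst //= mudd -EFinM ltry.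
- by apply: integrable_norm => //; apply: integrableS hi => //; exact: measurable_itv.
move=> x /=; rewrite in_itv /= => /andP[x1 x2].
apply: le_trans (ler_norm _).
have x0 : 0 < x by lra.
have := big x x0 (le_lt_trans x2 de) (le_lt_trans x2 d1).
move=> /ltW; rewrite mulrC -ler_pdivrMr //; apply: le_trans.
by rewrite ler_pM2l // lef_pV2.
Qed.

(** Two-sided version, for functions of time vanishing at both ends. *)
Lemma ac_vanishing_primitive (T C : R) B f : 0 < T ->
  mu.-integrable `]0, T[ (EFin \o f) ->
  (forall d t, 0 < d -> d < t -> t < T -> abs_continuous d t B) ->
  {ae mu, forall x, 0 < x < T -> is_derive x 1 B (f x)} ->
  (forall t, 0 < t < T -> `|B t| <= C * (t * (T - t))) ->
  (forall t, 0 < t < T -> B t = \int[mu]_(x in `]0, t[) f x) /\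
  \int[mu]_(x in `]0, T[) f x = 0.
Proof.
move=> T0 fi acB dB BC.
have C0 : 0 <= C.
  have := BC (T / 2) _; have h : 0 < T / 2 < T by lra.
  move=> /(_ h) /(le_trans (normr_ge0 _)); rewrite pmulr_lge0 //.
  by rewrite mulr_gt0 //; lra.
have BCt t : 0 < t < T -> `|B t| <= C * T * t.
  move=> tT; apply: le_trans (BC _ tT) _.
  rewrite mulrCA -mulrA; nra.
have BCT t : 0 < t < T -> `|B t| <= C * T * (T - t).
  move=> tT; apply: le_trans (BC _ tT) _.
  rewrite -mulrA ler_wpM2l // ler_wpM2r; lra.
have CT0 : 0 <= C * T by rewrite mulr_ge0 // ltW.
have prim t : 0 < t < T -> B t = \int[mu]_(x in `]0, t[) f x.
  move=> /andP[t0 tT].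
  have sub : `]0, t[ `<=` (`]0, T[ : set R).
    by move=> x /=; rewrite !in_itv /= => /andP[-> /lt_trans]; exact.
  have fit : mu.-integrable `]0, t[ (EFin \o f) by exact: integrableS fi.
  have small e : 0 < e -> exists d, [/\ 0 < d, d < 0 + e, d < t & `|B d| <= e].
    move=> e0; pose d := Num.min (Num.min (e / 2) (t / 2)) (e / (C * T + 1)).
    have d0 : 0 < d.
      by rewrite !lt_min !divr_gt0 //; lra.
    have de : d <= e / 2 by rewrite !ge_min lexx.
    have dt : d <= t / 2 by rewrite !ge_min lexx orbT.
    have dC : d <= e / (C * T + 1) by rewrite !ge_min lexx !orbT.
    have dT : 0 < d < T by lra.
    exists d; split; [by []|lra|lra|].
    apply: le_trans (BCt _ dT) _.
    have : (C * T + 1) * d <= e.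
      by rewrite mulrC -ler_pdivlMr //; lra.
    by nra.
  apply/le_anti/andP; split.
    apply: (ac_improper_le t0 fit).
    - by move=> d /andP[d0 dt]; exact: acB.
    - apply: ae_mono dB => x H /andP[x0 xt]; exists (f x) => //.
      by apply: H; rewrite x0 (lt_trans xt).
    - move=> e /small[d [d1 d2 d3 d4]]; exists d; split => //.
      by apply: le_trans (ler_norm _) d4.
  rewrite -lerN2.
  have -> : - (\int[mu]_(x in `]0, t[) f x) = \int[mu]_(x in `]0, t[) (-1 * f x).
    by rewrite RintegralZl // mulN1r.
  apply: (@ac_improper_le 0 t (fun x => - B x) _ t0).
  - exact: (L1Z _ _ fit).
  - move=> d /andP[d0 dt]; apply: (abs_continuous_dominated ler01 (acB _ _ d0 dt tT)).
    by move=> x y _ _ _; rewrite -opprD normrN mul1r.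
  - apply: ae_mono dB => x H /andP[x0 xt]; exists (- f x); last by rewrite mulN1r.
    have : is_derive x 1 B (f x) by apply: H; rewrite x0 (lt_trans xt).
    by move=> ?; apply: is_deriveN.
  - move=> e /small[d [d1 d2 d3 d4]]; exists d; split => //.
    by apply: le_trans (ler_norm _) _; rewrite normrN.
split => //; apply/eqP; rewrite -normr_le0; apply/ler_addgt0Pr => e e0.
have e20 : 0 < e / 2 by rewrite divr_gt0.
have [d0 d00 small] := integral_small_set (measurable_itv _) e20 fi.
pose d := Num.min (Num.min (d0 / 2) (T / 2)) (e / 2 / (C * T + 1)).
have dpos : 0 < d by rewrite !lt_min !divr_gt0 //; lra.
have dd0 : d <= d0 / 2 by rewrite !ge_min lexx.
have dT : d <= T / 2 by rewrite !ge_min lexx orbT.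
have dC : d <= e / 2 / (C * T + 1) by rewrite !ge_min lexx !orbT.
have dC' : (C * T + 1) * d <= e / 2 by rewrite mulrC -ler_pdivlMr //; lra.
pose t := T - d; have tT : 0 < t < T by rewrite /t; lra.
have sub1 : `]0, t[ `<=` (`]0, T[ : set R).
  by move=> x /=; rewrite !in_itv /= => /andP[-> h]; lra.
have sub2 : `[t, T[ `<=` (`]0, T[ : set R).
  by move=> x /=; rewrite !in_itv /= => /andP[h ->]; lra.
have fi1 : mu.-integrable `]0, t[ (EFin \o f) by exact: integrableS fi.
have fi2 : mu.-integrable `[t, T[ (EFin \o f) by exact: integrableS fi.
have E : \int[mu]_(x in `]0, T[) f x =
    \int[mu]_(x in `]0, t[) f x + \int[mu]_(x in `[t, T[) f x.
  have U : `]0, T[%classic = `]0, t[%classic `|` `[t, T[%classic :> set R.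
    by rewrite -itv_bndbnd_setU // bnd_simp; lra.
  rewrite U Rintegral_setU //=; first by rewrite -U.
  by apply/disj_setPS => x /= []; rewrite !in_itv /=; lra.
rewrite E -prim // add0r.
apply: le_trans (ler_normD _ _) _.
have h1 := BCT _ tT.
have h2 : `|\int[mu]_(x in `[t, T[) f x| < e / 2.
  apply: le_lt_trans (le_normr_Rintegral _ fi2) _ => //.
  apply: small => //; rewrite lebesgue_measure_itv /= lte_fin ifT; last lra.
  by rewrite -EFinB lte_fin /t; lra.
have h3 : C * T * (T - t) <= e / 2 by rewrite /t; nra.
move: h1 h2 h3; move: (\int[mu]_(x in `[t, T[) f x) (B t) => I1 I2; lra.
Qed.

End absolutely_continuous_improper.

(** * The degenerate coefficient and the weight in space *)

Section scalar_derivatives.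
Context {R : realType}.
Implicit Types (f g : R -> R) (x k l m : R).

Lemma is_derive1_id x : is_derive x 1 (fun y : R => y) 1.
Proof. exact: is_derive_id. Qed.

Lemma is_derive1_cst x k : is_derive x 1 (fun=> k) 0.
Proof. exact: is_derive_cst. Qed.

Lemma is_derive1M f g x l m : is_derive x 1 f l -> is_derive x 1 g m ->
  is_derive x 1 (fun y => f y * g y) (l * g x + f x * m).
Proof.
move=> df dg; apply: is_derive_eq (is_deriveM df dg) _.
by rewrite /GRing.scale /= addrC (mulrC (g x)).
Qed.

Lemma is_derive1D f g x l m : is_derive x 1 f l -> is_derive x 1 g m ->
  is_derive x 1 (fun y => f y + g y) (l + m).
Proof. by move=> df dg; exact: is_deriveD. Qed.

Lemma is_derive1Z k f x l : is_derive x 1 f l -> is_derive x 1 (fun y => k * f y) (k * l).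
Proof.
by move=> df; apply: is_derive_eq (is_derive1M (is_derive1_cst x k) df) _; rewrite mul0r add0r.
Qed.

Lemma is_derive1N f x l : is_derive x 1 f l -> is_derive x 1 (fun y => - f y) (- l).
Proof. by move=> df; exact: is_deriveN. Qed.

Lemma is_derive1_sqr x : is_derive x 1 (fun y : R => y ^+ 2) (2 * x).
Proof.
apply: is_derive_eq (is_derive1M (is_derive1_id x) (is_derive1_id x)) _.
by rewrite mul1r mulr1 mulr2n mulrDl mul1r.
Qed.

Lemma is_derive1_exp f x l : is_derive x 1 f l ->
  is_derive x 1 (fun y => expR (f y)) (expR (f x) * l).
Proof.
move=> df; apply: is_derive_eq (is_derive1_comp (is_derive_expR (f x)) df) _.
by rewrite /GRing.scale /= mulrC.
Qed.

Lemma is_derive1V f x l : f x != 0 -> is_derive x 1 f l ->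
  is_derive x 1 (fun y => (f y)^-1) (- (f x)^-2 * l).
Proof. by move=> f0 df; exact: is_deriveV. Qed.

Lemma derivable_measurable f f' (c d : R) :
  (forall x, c < x -> x < d -> is_derive x 1 f (f' x)) ->
  measurable_fun (`]c, d[ : set R) f.
Proof.
move=> H; apply: subspace_continuous_measurable_fun => //.
apply: continuous_in_subspaceT => x; rewrite inE /= in_itv /= => /andP[cx xd].
have [df _] := H x cx xd.
exact/differentiable_continuous/derivable1_diffP.
Qed.

End scalar_derivatives.

Section one_sided_derivatives.
Context {R : realType}.
Implicit Types (D : set R) (f : R -> R) (x y c d e : R).

Lemma has_derivative_onP D f f' x e : has_derivative_on D f f' -> D x -> 0 < e ->
  exists2 d, 0 < d & forall y, D y -> `|x - y| < d ->
    `|f y - f x - f' x * (y - x)| <= e * `|y - x|.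
Proof.
move=> H Dx e0; have /cvgrPdist_lt /(_ e e0) := H x Dx.
rewrite /within /= => -[d d0 Hd]; exists d => // y Dy yd.
have [->|yx] := eqVneq y x; first by rewrite !subrr mulr0 subrr normr0 mulr0.
have yx0 : y - x != 0 by rewrite subr_eq0.
have {Hd}:= Hd y yd yx Dy => /ltW.
rewrite -(ler_pM2r (_ : 0 < `|y - x|)) ?normr_gt0 //.
by rewrite -normrM mulrBl divfK // distrC.
Qed.

Lemma has_derivative_on_is_derive D f f' x : has_derivative_on D f f' ->
  nbhs x D -> is_derive x 1 f (f' x).
Proof.
move=> H nD; have Dx : D x by exact: nbhs_singleton.
have cv : h^-1 *: ((f \o shift x) (h *: 1) - f x) @[h --> 0^'] --> f' x.
  apply/cvgrPdist_le => e e0.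
  have [d d0 Hd] := has_derivative_onP H Dx e0.
  have [r r0 Hr] := nD.
  near=> h.
  have h0 : h != 0 by near: h; exact: nbhs_dnbhs_neq.
  have hd : `|h| < d by near: h; apply: dnbhs0_lt.
  have hr : `|h| < r by near: h; apply: dnbhs0_lt.
  have Dh : D (h + x) by apply: Hr; rewrite /= opprD addrC subrK normrN.
  have := Hd _ Dh; rewrite opprD addrC subrK normrN => /(_ hd).
  rewrite /= [h%:A]mulr1 addrK => K.
  rewrite distrC -(ler_pM2r (_ : 0 < `|h|)) ?normr_gt0 // -normrM mulrBl.
  by rewrite [_ *: _]mulrC divfK.
split; first by apply/cvg_ex; exists (f' x).
by apply/cvg_lim.
Unshelve. all: by end_near. Qed.

Lemma has_derivative_on_continuous D f f' : has_derivative_on D f f' ->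
  {within D, continuous f}.
Proof.
move=> H; apply/subspace_continuousP => x Dx.
have [d1 d10 H1] := has_derivative_onP H Dx ltr01.
apply/cvgrPdist_lt => e e0.
have k0 : 0 < 2 + `|f' x| by rewrite ltr_pwDl.
change (\forall y \near x, D y -> `|f x - f y| < e); near=> y => Dy.
have yd : `|x - y| < d1 by near: y; exact: cvgr_dist_lt.
have ye : `|x - y| < e / (2 + `|f' x|).
  by near: y; apply: cvgr_dist_lt => //; exact: divr_gt0.
have := H1 _ Dy yd; rewrite mul1r => h.
have : `|f y - f x| <= (2 + `|f' x|) * `|x - y|.
  rewrite -(subrK (f' x * (y - x)) (f y - f x)).
  apply: le_trans (ler_normD _ _) _.
  rewrite normrM (distrC x y); have := normr_ge0 (y - x); nra.
rewrite ltr_pdivlMr // mulrC in ye.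
by rewrite distrC => /le_lt_trans; exact.
Unshelve. all: by end_near. Qed.

Lemma C1_lipschitz D f f' c d : c <= d -> C1_on D f f' -> `[c, d] `<=` D ->
  (forall x, c < x < d -> nbhs x D) ->
  exists2 k, 0 <= k & forall x y, c <= x -> x <= y -> y <= d ->
    `|f y - f x| <= k * (y - x).
Proof.
move=> cd [df cf'] sub int.
have cf'cd : {within `[c, d], continuous f'} by exact: continuous_subspaceW cf'.
have cfcd : {within `[c, d], continuous f}.
  exact: continuous_subspaceW (has_derivative_on_continuous df).
have [u _ Hu] := EVT_max cd cf'cd; have [v _ Hv] := EVT_min cd cf'cd.
exists (`|f' u| + `|f' v|); first by rewrite addr_ge0.
move=> x y cx; rewrite le_eqVlt => /predU1P[->|xy] yd.
  by rewrite !subrr normr0 mulr0.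
have sub2 : `[x, y] `<=` `[c, d].
  by move=> z /=; rewrite !in_itv /= => /andP[h1 h2]; rewrite (le_trans cx h1) (le_trans h2 yd).
have [z zxy ->] : exists2 z, z \in `]x, y[ & f y - f x = f' z * (y - x).
  apply: MVT => //; last exact: continuous_subspaceW cfcd.
  move=> z; rewrite in_itv /= => /andP[xz zy].
  apply: (has_derivative_on_is_derive df); apply: int.
  by rewrite (le_lt_trans cx xz) (lt_le_trans zy yd).
have yx0 : 0 <= y - x by rewrite subr_ge0 ltW.
rewrite normrM [`|y - x|]ger0_norm // ler_wpM2r //.
have zcd : z \in `[c, d] by apply/sub2; apply: subset_itv_oo_cc.
rewrite ler_norml; apply/andP; split.
  have := Hv _ zcd; have := ler_norm (- f' v); rewrite normrN.
  by have := normr_ge0 (f' u); lra.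
by have := Hu _ zcd; have := ler_norm (f' u); have := normr_ge0 (f' v); lra.
Qed.

End one_sided_derivatives.

(** What the weakly and the strongly degenerate case have in common. The structural
    assumption is [x a' <= K a] with [K < 2]; the other fields are regularity away
    from 0. *)
Record degenerate_coefficient (R : realType) (a a' : R -> R) (K : R) : Prop := {
  dc_K : K < 2 ;
  dc_gt0 : forall x : R, 0 < x -> x <= 1 -> 0 < a x ;
  dc_derive : forall x : R, 0 < x -> x < 1 -> is_derive x 1 a (a' x) ;
  dc_le : forall x : R, 0 < x -> x < 1 -> x * a' x <= K * a x ;
  dc_ac : forall d : R, 0 < d -> d < 1 -> abs_continuous d 1 a ;
  dc_lb : forall d : R, 0 < d -> d < 1 ->
    exists2 m : R, 0 < m & forall x : R, d <= x -> x <= 1 -> m <= a x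
}.

Lemma degenerateP (R : realType) k (a : R -> R) : degenerate k a ->
  exists a' K, degenerate_coefficient a a' K.
Proof.
have C1P (a' : R -> R) (K : R) : K < 2 -> C1_on `]0, 1] a a' ->
    (forall x, 0 < x <= 1 -> 0 < a x) ->
    (forall x, 0 < x <= 1 -> x * a' x <= K * a x) -> degenerate_coefficient a a' K.
  move=> K2 C1 agt0 aK.
  have nb (x : R) : 0 < x -> x < 1 -> nbhs x `]0, 1]%classic.
    move=> x0 x1; apply: (@filterS _ (nbhs x) _ `]0, 1[%classic).
      by move=> y /=; rewrite !in_itv /= => /andP[-> /ltW].
    by apply: open_nbhs_nbhs; split; [exact: interval_open|rewrite /= in_itv /= x0].
  have sub (d : R) : 0 < d -> `[d, 1] `<=` (`]0, 1] : set R).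
    by move=> d0 x /=; rewrite !in_itv /= => /andP[/(lt_le_trans d0) -> ->].
  split => //.
  - by move=> x x0 x1; apply: agt0; rewrite x0.
  - move=> x x0 x1; apply: (has_derivative_on_is_derive C1.1); exact: nb.
  - by move=> x x0 x1; apply: aK; rewrite x0 ltW.
  - move=> d d0 d1; have [|k0 k0p H] := C1_lipschitz (ltW d1) C1 (sub _ d0).
      by move=> x /andP[dx x1]; apply: nb => //; exact: lt_trans dx.
    exact: lipschitz_abs_continuous H.
  - move=> d d0 d1; have ca := has_derivative_on_continuous C1.1.
    have [c + Hc] := EVT_min (ltW d1) (continuous_subspaceW (sub _ d0) ca).
    rewrite in_itv /= => /andP[dc c1]; exists (a c).
      by apply: agt0; rewrite (lt_le_trans d0).
    by move=> x dx x1; apply: Hc; rewrite in_itv /= dx.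
case: k => -[a' [K [H1 H2 H3 H4 H5]]]; exists a', K.
  apply: C1P; [lra|exact: H2|by case: H3|exact: H5].
have sub : `]0, 1] `<=` (`[0, 1] : set R).
  by move=> x /=; rewrite !in_itv /= => /andP[/ltW -> ->].
apply: C1P; [lra| |by case: H2|].
  split; last exact: continuous_subspaceW H1.2.
  move=> x x01; have /cvgrPdist_lt h := H1.1 x (sub _ x01).
  apply/cvgrPdist_lt => e /h [d d0 Hd]; exists d => // y /= yd yx y01.
  by apply: Hd => //; exact: sub.
by move=> x /andP[x0 x1]; apply: H4; rewrite ltW.
Qed.

Section coefficient.
Context {R : realType} (a a' : R -> R) (K : R).
Hypothesis dc : degenerate_coefficient a a' K.
Notation mu := (@lebesgue_measure R).
Implicit Types (x y z d e : R) (f : R -> R).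

Lemma coef_measurable : measurable_fun (`]0, 1[ : set R) a.
Proof. by apply: (derivable_measurable (dc_derive dc)). Qed.

Lemma inv_coef_ac d : 0 < d -> d < 1 -> abs_continuous d 1 (fun x => (a x)^-1).
Proof.
move=> d0 d1; have [m m0 Hm] := dc_lb dc d0 d1.
apply: (@abs_continuous_dominated _ _ _ _ _ (m^-1 ^+ 2) _ (dc_ac dc d0 d1)).
  by rewrite sqr_ge0.
move=> x y dx xy y1; have ax := Hm x dx (le_trans xy y1).
have ay := Hm y (le_trans dx xy) y1.
have ax0 := lt_le_trans m0 ax; have ay0 := lt_le_trans m0 ay.
have -> : (a y)^-1 - (a x)^-1 = - ((a y)^-1 * (a x)^-1 * (a y - a x)).
  by field; rewrite !gt_eqF.
rewrite normrN normrM ler_wpM2r // ger0_norm; last first.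
  by rewrite mulr_ge0 // invr_ge0 ltW.
by rewrite expr2 ler_pM // ?invr_ge0 ?(ltW ax0) ?(ltW ay0) // lef_pV2.
Qed.

Lemma inv_coef_derive x : 0 < x -> x < 1 ->
  is_derive x 1 (fun x => (a x)^-1) (- (a x)^-2 * a' x).
Proof.
move=> x0 x1; have da := dc_derive dc x0 x1.
apply: is_deriveV; apply: lt0r_neq0; apply: (dc_gt0 dc) => //; exact: ltW.
Qed.

Lemma inv_coef_measurable : measurable_fun (`]0, 1[ : set R) (fun x => (a x)^-1).
Proof. exact: derivable_measurable inv_coef_derive. Qed.

Lemma id_ac d e : abs_continuous d e (fun x : R => x).
Proof. exact: abs_continuous_id. Qed.

Lemma ratio_ac d : 0 < d -> d < 1 -> abs_continuous d 1 (fun x => x / a x).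
Proof.
move=> d0 d1; apply: (abs_continuousM (ltW d1) (@id_ac _ _)).
exact: inv_coef_ac.
Qed.

Lemma ratio2_ac d : 0 < d -> d < 1 -> abs_continuous d 1 (fun x => x ^+ 2 / a x).
Proof.
move=> d0 d1; apply: (abs_continuousM (ltW d1) _ (inv_coef_ac d0 d1)).
exact: (abs_continuousM (ltW d1) (@id_ac _ _) (@id_ac _ _)).
Qed.

Lemma ratio2_derive x : 0 < x -> x < 1 ->
  is_derive x 1 (fun x => x ^+ 2 / a x) (x / a x * (2 - x * a' x / a x)).
Proof.
move=> x0 x1; have dV := inv_coef_derive x0 x1.
apply: is_derive_eq (is_derive1M (is_derive1_sqr x) dV) _.
have := dc_gt0 dc x0 (ltW x1) => ax.
by field; rewrite gt_eqF.
Qed.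

Lemma abs_continuous_within f (x y : R) : x <= y -> abs_continuous x y f ->
  {within `[x, y], continuous f}.
Proof.
move=> xy acf; apply: (@subspace_eq_continuous _ _ _ (f \o clamp x y)).
  by move=> z; rewrite inE /= in_itv /= => zxy; rewrite clamp_id.
by apply: continuous_subspaceT; exact: clamp_continuous xy acf.
Qed.

Lemma ac_integrable f (x y : R) : x < y -> abs_continuous x y f ->
  mu.-integrable `[x, y] (EFin \o f).
Proof.
move=> xy acf; have cf := abs_continuous_within (ltW xy) acf.
exact: (continuous_compact_integrable (@segment_compact _ x y) cf).
Qed.

Lemma ratio_ge0 x : 0 < x -> x <= 1 -> 0 <= x / a x.
Proof. by move=> x0 x1; rewrite divr_ge0 ?ltW ?(dc_gt0 dc). Qed.

(** Growth of [x^2/a]: since [x a' <= K a] with [K < 2], its derivative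
    controls [x/a]. *)
Lemma ratio2_growth x y : 0 < x -> x < y -> y <= 1 ->
  (2 - K) * \int[mu]_(z in `[x, y]) (z / a z) <= y ^+ 2 / a y - x ^+ 2 / a x.
Proof.
move=> x0 xy y1; have x1 := lt_le_trans xy y1.
have [g [ig gE dg]] := abs_continuous_FTC (ltW x1) (ratio2_ac x0 x1).
have iz : mu.-integrable `[x, y] (EFin \o (fun z => z / a z)).
  by apply: ac_integrable => //; exact: sub_abs_continuous (ratio_ac x0 x1).
have igS : mu.-integrable `[x, y] (EFin \o g) by exact: integrableS ig.
have sub : `]x, y[ `<=` (`[x, y] : set R).
  by move=> z /=; rewrite !in_itv /= => /andP[/ltW -> /ltW ->].
have iz' : mu.-integrable `]x, y[ (EFin \o (fun z => z / a z)).
  by apply: integrableS iz => //; exact: measurable_itv.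
have igS' : mu.-integrable `]x, y[ (EFin \o g) by exact: integrableS ig.
rewrite (gE x y) ?lexx ?(ltW xy) // !Rintegral_itv_cc_oo // -RintegralZl //.
apply: (ae_le_Rintegral (X := measurableTypeR R) (m := leb R) (D := `]x, y[%classic)) => //; first exact: (L1Z _ _ iz').
apply: ae_mono dg => z H /=; rewrite in_itv /= => /andP[xz zy].
have z1 := lt_le_trans zy y1; have z0 := lt_trans x0 xz.
have dz : is_derive z 1 (fun x => x ^+ 2 / a x) (g z) by apply: H; rewrite xz.
rewrite -(@derive_val _ _ _ _ _ _ _ dz).
rewrite (@derive_val _ _ _ _ _ _ _ (ratio2_derive z0 z1)) mulrC.
rewrite ler_wpM2l ?ratio_ge0 ?(ltW z1) // lerD2l lerN2.
by rewrite ler_pdivrMr ?(dc_gt0 dc) ?(dc_le dc) // ltW.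
Qed.

Lemma ratio2_le x y : 0 < x -> x <= y -> y <= 1 -> x ^+ 2 / a x <= y ^+ 2 / a y.
Proof.
move=> x0; rewrite le_eqVlt => /predU1P[->//|xy y1].
rewrite -subr_ge0; apply: le_trans (ratio2_growth x0 xy y1).
rewrite mulr_ge0 ?subr_ge0 ?(ltW (dc_K dc)) //.
apply: Rintegral_ge0 => z /=; rewrite in_itv /= => /andP[xz zy].
by rewrite ratio_ge0 ?(lt_le_trans x0) ?(le_trans zy).
Qed.

Lemma ratio2_bound x : 0 < x -> x <= 1 -> x ^+ 2 / a x <= (a 1)^-1.
Proof. by move=> x0 x1; have := ratio2_le x0 x1 (lexx 1); rewrite expr1n mul1r. Qed.

Lemma ratio2_ge0 x : 0 < x -> x <= 1 -> 0 <= x ^+ 2 / a x.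
Proof. by move=> x0 x1; rewrite divr_ge0 ?sqr_ge0 // ltW // (dc_gt0 dc). Qed.

Lemma K2_gt0 : 0 < 2 - K. Proof. by rewrite subr_gt0 (dc_K dc). Qed.

(** Let the lower end tend to 0 in [ratio2_growth], by monotone convergence. *)
Lemma ratio_primitive y : 0 < y -> y <= 1 ->
  mu.-integrable `[0, y] (EFin \o (fun z => z / a z)) /\
  (2 - K) * \int[mu]_(z in `[0, y]) (z / a z) <= y ^+ 2 / a y.
Proof.
move=> y0 y1; pose F (n : nat) : set R := `[y / n.+2%:R, y]%classic.
pose f (z : R) := ((z / a z)%:E : \bar R).
have yn n : 0 < y / n.+2%:R by rewrite divr_gt0.
have yny n : y / n.+2%:R < y by rewrite ltr_pdivrMr // ltr_pMr // ltr1n.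
have Fi n : mu.-integrable (F n) f.
  apply: ac_integrable => //; apply: sub_abs_continuous (ratio_ac (yn n) _) => //.
  exact: lt_le_trans y1.
have Fb n : ((2 - K)%:E * \int[mu]_(z in F n) f z <= (y ^+ 2 / a y)%:E)%E.
  have := ratio2_growth (yn n) (yny n) y1; rewrite -lee_fin EFinM fineK; last first.
    by apply: integrable_fin_num => //; exact: Fi.
  move=> h; apply: le_trans h _; rewrite lee_fin lerBlDr lerDl ratio2_ge0 //.
  exact: le_trans (ltW (yny n)) y1.
have FU : \bigcup_n F n = `]0, y]%classic :> set R.
  apply/seteqP; split => z /=; rewrite !in_itv /=.
    by move=> [n _]; rewrite /F /= in_itv /= => /andP[h ->]; rewrite (lt_le_trans (yn n)).
  move=> /andP[z0 zy]; exists (Num.trunc (y / z)).+1 => //; rewrite /F /= in_itv /= zy andbT.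
  rewrite ler_pdivrMr // mulrC -ler_pdivrMr //.
  have := truncnS_gt (y / z); move=> /ltW h; apply: le_trans h _.
  by rewrite ler_nat leqW.
have f0 z : 0 < z -> z <= y -> (0 <= f z)%E.
  by move=> z0 zy; rewrite lee_fin ratio_ge0 // (le_trans zy).
have mF n : measurable (F n) by exact: measurable_itv.
have mfF n : measurable_fun (F n) f by exact: measurable_int (Fi n).
have ge0F n z : F n z -> (0 <= f z)%E.
  by rewrite /F /= in_itv /= => /andP[h zy]; apply: f0 => //; exact: lt_le_trans (yn n) h.
have ndF : {homo F : n m / (n <= m)%N >-> (n <= m)%O}.
  move=> n m nm; apply/subsetPset => z; rewrite /F /= !in_itv /= => /andP[h ->].
  rewrite andbT; apply: le_trans h; rewrite ler_pM2l // lef_pV2 ?posrE //.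
  by rewrite ler_nat !ltnS.
have cv := ge0_nondecreasing_set_cvg_integral ndF mF mfF ge0F (mu := mu).
rewrite FU in cv.
have K2 := K2_gt0.
have le_int : (\int[mu]_(z in `]0%R, y]) f z <= ((y ^+ 2 / a y) / (2 - K))%:E)%E.
  rewrite -(cvg_lim _ cv) //; apply: lime_le; first by apply/cvg_ex; eexists; exact: cv.
  near=> n; have := Fb n; rewrite -[X in (X * _)%E]/((2 - K)%:E).
  by rewrite muleC -lee_pdivlMr // EFinM.
have mf : measurable_fun (`]0, y] : set R) f.
  by rewrite -FU; apply/measurable_fun_bigcup.
have i1 : mu.-integrable `]0, y] f.
  apply/integrableP; split => //.
  apply: le_lt_trans (ltry (y ^+ 2 / a y / (2 - K))); apply: le_trans le_int.
  rewrite le_eqVlt; apply/orP; left; apply/eqP.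
  apply: eq_integral => z; rewrite inE /= in_itv /= => /andP[z0 zy].
  by have := f0 z z0 zy; rewrite /f lee_fin /= => h; rewrite ger0_norm.
have i2 : mu.-integrable `[0, y] f.
  have mf2 : measurable_fun (`[0, y] : set R) f.
    exact/emeasurable_fun_itv_obnd_cbndP.
  apply/integrableP; split => //.
  rewrite -integral_itv_obnd_cbnd; last exact: measurableT_comp.
  by have /integrableP[] := i1.
split => //.
rewrite -Rintegral_itv_obnd_cbnd // mulrC -ler_pdivlMr // -lee_fin fineK //.
by apply: integrable_fin_num => //; exact: measurable_itv.
Unshelve. all: by end_near. Qed.

Lemma ratio_continuous x : 0 < x -> x < 1 -> {for x, continuous (fun z => z / a z)}.
Proof.
move=> x0 x1; have [da _] := is_derive1M (is_derive1_id x) (inv_coef_derive x0 x1).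
exact/differentiable_continuous/derivable1_diffP.
Qed.

Section weight.
Variables (c lam : R).
Hypothesis lam_gt0 : 0 < lam.
Local Notation psi := (psi a c lam).

Lemma psi_derive x : 0 < x -> x < 1 -> is_derive x 1 psi (lam * (x / a x)).
Proof.
move=> x0 x1; have [i1 _] := ratio_primitive ltr01 (lexx 1).
have [|dF F'] := continuous_FTC1 x1 i1 _ (ratio_continuous x0 x1).
  by rewrite ?bnd_simp /= ?ltW.
apply: is_derive1Z; apply: is_derive_eq (is_derive1D (derivableP dF) (is_derive1_cst x (- c))) _.
by rewrite addr0 -derive1E.
Qed.

Lemma psi_ac d : 0 < d -> d < 1 -> abs_continuous d 1 psi.
Proof.
move=> d0 d1; have [M M0 HM] := abs_continuous_bounded (ltW d1) (ratio_ac d0 d1).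
apply: (@lipschitz_abs_continuous _ _ _ _ (lam * M)); first by rewrite mulr_ge0 // ltW.
move=> x y dx xy y1; have x0 := lt_le_trans d0 dx; have y0 := lt_le_trans x0 xy.
have [iy _] := ratio_primitive y0 y1.
rewrite /psi -mulrBr opprB addrA subrK Rintegral_itvB // ?bnd_simp //; last exact: ltW.
rewrite normrM gtr0_norm // -mulrA ler_wpM2l ?(ltW lam_gt0) //.
have ixy : mu.-integrable `]x, y] (EFin \o (fun z => z / a z)).
  apply: integrableS iy => //.
  by move=> z /=; rewrite !in_itv /= => /andP[/ltW/(le_trans (ltW x0)) -> ->].
have mxy : mu `]x, y]%classic = (y - x)%:E.
  rewrite lebesgue_measure_itv /= lte_fin; case: ltP => // h.
  by congr EFin; apply/esym/eqP; rewrite subr_eq0; apply/eqP/le_anti/andP.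
apply: le_trans (le_normr_Rintegral _ ixy) _ => //.
rewrite (_ : M * (y - x) = \int[mu]_(z in `]x, y]) M); last first.
  by rewrite Rintegral_cst // [X in fine X]mxy.
apply: le_Rintegral => //.
- exact: integrable_norm.
- apply/integrableP; split; first exact: measurable_cst.
  by rewrite /= integral_cst //= [X in (_ * X)%E]mxy -EFinM ltry.
- move=> z /=; rewrite in_itv /= => /andP[xz zy]; apply: HM.
  by rewrite (le_trans dx (ltW xz)) (le_trans zy).
Qed.

Lemma psi_measurable : measurable_fun (`]0, 1[ : set R) psi.
Proof. exact: derivable_measurable psi_derive. Qed.

Lemma psi_bounded : exists2 M, 0 < M & forall x, 0 < x -> x <= 1 -> `|psi x| <= M.
Proof.
exists (lam * ((a 1)^-1 / (2 - K) + `|c| + 1)).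
  by rewrite mulr_gt0 // ltr_wpDl // addr_ge0 // divr_ge0 ?(ltW K2_gt0) // invr_ge0
     ltW // (dc_gt0 dc).
move=> x x0 x1; have [_ h] := ratio_primitive x0 x1.
rewrite /psi normrM gtr0_norm // ler_wpM2l ?(ltW lam_gt0) //.
have I0 : 0 <= \int[mu]_(z in `[0, x]) (z / a z).
  apply: Rintegral_ge0 => z /=; rewrite in_itv /= => /andP[].
  rewrite le_eqVlt => /predU1P[<-|z0] zx; first by rewrite mul0r.
  by rewrite ratio_ge0 // (le_trans zx).
have I1 : \int[mu]_(z in `[0, x]) (z / a z) <= (a 1)^-1 / (2 - K).
  by rewrite ler_pdivlMr ?K2_gt0 // mulrC (le_trans h) // ratio2_bound.
apply: le_trans (ler_normB _ _) _; rewrite ger0_norm //.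
by apply: le_trans (lerD I1 (lexx `|c|)) _; rewrite lerDl.
Qed.

(** By [ratio_primitive], [x^2/a] can be small only where the primitive of [x/a] is
    small, and there [psi] is negative. *)
Lemma psi_dichotomy x : 0 < x -> x <= 1 ->
  psi x <= - lam \/ (2 - K) * (c - 1) <= x ^+ 2 / a x.
Proof.
move=> x0 x1; have [_ h] := ratio_primitive x0 x1; rewrite /psi.
move: h; move: (Rintegral _ _ _) => I h.
have [Ic|cI] := leP I (c - 1); [left|right].
  by rewrite -[leRHS]mulrN1 ler_wpM2l ?(ltW lam_gt0) //; lra.
apply: le_trans h; rewrite ler_wpM2l ?(ltW K2_gt0) //; exact: ltW.
Qed.

End weight.

End coefficient.

(** * Integral inequalities in space *)

Section space.
Context {R : realType} (k : degeneracy) (a a' : R -> R) (K : R).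
Hypothesis dc : degenerate_coefficient a a' K.
Notation mu := (@lebesgue_measure R).
Implicit Types (x y d e r : R) (f g w p m z q n : R -> R).
Local Notation I01 := (`]0, 1[%classic : set (measurableTypeR R)).
Local Notation L1 h := (mu.-integrable I01 (EFin \o h)).

(** Behaviour at 0 that makes the boundary terms vanish: in the weak case [w] tends
    to 0 while the flux [p] is bounded, in the strong case the flux is
    [O(sqrt x)]. *)
Definition vanishing_at0 w p :=
  match k with
  | Weak => (forall e, 0 < e -> exists2 d, 0 < d &
              forall x, 0 < x -> x < d -> x < 1 -> `|w x| <= e) /\
            (exists M, forall x, 0 < x -> x < 1 -> `|p x| <= M)
  | Strong => exists M, forall x, 0 < x -> x < 1 -> p x ^+ 2 <= M * x
  end.

(** A function of [H^2_a] satisfying the boundary conditions, with its flux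
    [p = a w'] and [m = p']. *)
Record space_admissible w p m : Prop := {
  sa_acw : forall d, 0 < d -> d < 1 -> abs_continuous d 1 w ;
  sa_acp : forall d, 0 < d -> d < 1 -> abs_continuous d 1 p ;
  sa_dw : forall x : R, 0 < x -> x < 1 -> is_derive x 1 w (p x / a x) ;
  sa_dp : {ae mu, forall x : R, 0 < x < 1 -> is_derive x 1 p (m x)} ;
  sa_w : L2_01 w ;
  sa_p : L2_01 (fun x => p x / Num.sqrt (a x)) ;
  sa_m : L2_01 m ;
  sa_w1 : w 1 = 0 ;
  sa_0 : vanishing_at0 w p
}.

Let mI : measurable I01. Proof. exact: measurable_itv. Qed.

Lemma in01 x : I01 x -> 0 < x /\ x < 1.
Proof. by rewrite /= in_itv /= => /andP. Qed.

Lemma sqrt_coef_measurable : measurable_fun I01 (fun x => Num.sqrt (a x)).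
Proof.
apply: (@measurableT_comp _ _ _ _ _ _ (@Num.sqrt R)) (coef_measurable dc).
exact: continuous_measurable_fun (@sqrt_continuous R).
Qed.

Lemma id_measurable : measurable_fun I01 (fun x : R => x).
Proof. exact: measurable_id. Qed.

Lemma inv_sqrt_measurable : measurable_fun I01 (fun x => (Num.sqrt (a x))^-1).
Proof.
apply: (eq_measurable_fun (fun x => Num.sqrt (a x)^-1)).
  by move=> x /set_mem /in01[x0 x1]; rewrite sqrtrV // ltW // (dc_gt0 dc) // ltW.
apply: (@measurableT_comp _ _ _ _ _ _ (@Num.sqrt R)) (inv_coef_measurable dc).
exact: continuous_measurable_fun (@sqrt_continuous R).
Qed.

Lemma root_ratio_measurable : measurable_fun I01 (fun x => x / Num.sqrt (a x)).
Proof. exact: measurable_funM id_measurable inv_sqrt_measurable. Qed.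

Lemma sqrt_coefK x : 0 < x -> x <= 1 -> Num.sqrt (a x) ^+ 2 = a x.
Proof. by move=> x0 x1; rewrite sqr_sqrtr // ltW // (dc_gt0 dc). Qed.

Lemma sqrt_coef_gt0 x : 0 < x -> x <= 1 -> 0 < Num.sqrt (a x).
Proof. by move=> x0 x1; rewrite sqrtr_gt0 (dc_gt0 dc). Qed.

Lemma root_ratio_bound x : 0 < x -> x <= 1 ->
  `|x / Num.sqrt (a x)| <= 1 + (a 1)^-1.
Proof.
move=> x0 x1; have h := ratio2_bound dc x0 x1.
have i1 : 0 < (a 1)^-1 by rewrite invr_gt0 (dc_gt0 dc).
rewrite ger0_norm; last by rewrite divr_ge0 ?sqrtr_ge0 // ltW.
have : (x / Num.sqrt (a x)) ^+ 2 <= (a 1)^-1.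
  by rewrite expr_div_n sqrt_coefK.
by move: (x / _) (a 1)^-1 i1 => u v; nra.
Qed.

Lemma L2_root_ratio f : L2_01 f -> L2_01 (fun x => x / Num.sqrt (a x) * f x).
Proof.
apply: (bounded_L2 mI root_ratio_measurable) => x /in01[x0 x1].
by apply: root_ratio_bound => //; exact: ltW.
Qed.

Lemma sqr_div_sqrt p x : 0 < x -> x <= 1 ->
  (p x / Num.sqrt (a x)) ^+ 2 = p x ^+ 2 / a x.
Proof. by move=> x0 x1; rewrite expr_div_n sqrt_coefK. Qed.

Lemma eq_L1 f g : (forall x, 0 < x -> x < 1 -> f x = g x) -> L1 f -> L1 g.
Proof.
move=> fg; apply: eq_integrable => // x /set_mem /in01[x0 x1] /=.
by rewrite fg.
Qed.

(** The flux times a function of the same class is small at points where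
    [x y^2] is small. *)
Lemma flux_product_small w p z q e : vanishing_at0 w p -> vanishing_at0 z q ->
  0 < e -> exists2 e1, 0 < e1 & forall d, 0 < d -> d < e1 -> d < 1 ->
    d * z d ^+ 2 <= e1 -> `|p d * z d| <= e.
Proof.
rewrite /vanishing_at0; case: k => [[_ [M HM]] [zv _]|[M HM] _] e0;
  have M1 : 0 < `|M| + 1 by rewrite ltr_wpDl.
  have [d0 d00 Hd0] := zv _ (divr_gt0 e0 M1).
  exists d0 => // d dd0 de d1 _; rewrite normrM.
  have pd : `|p d| <= `|M| by apply: le_trans (HM _ dd0 d1) (ler_norm _).
  have zd := Hd0 _ dd0 de d1.
  rewrite ler_pdivlMr // in zd; apply: le_trans zd; rewrite mulrC ler_wpM2l //.
  by apply: le_trans pd _; rewrite lerDl.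
exists (e ^+ 2 / (`|M| + 1)); first by rewrite divr_gt0 // exprn_gt0.
move=> d d0 _ d1 h; rewrite -(@ler_pXn2r _ 2) ?nnegrE ?normr_ge0 ?(ltW e0) //.
rewrite -normrX ger0_norm ?sqr_ge0 // exprMn.
have pd : p d ^+ 2 <= `|M| * d.
  apply: le_trans (HM _ d0 d1) _; rewrite ler_wpM2r ?ler_norm //; exact: ltW.
apply: (@le_trans _ _ (`|M| * (d * z d ^+ 2))).
  by rewrite [leRHS]mulrA; apply: ler_wpM2r => //; exact: sqr_ge0.
rewrite ler_pdivlMr // in h; apply: le_trans h; rewrite mulrC ler_wpM2l //.
  by rewrite mulr_ge0 ?sqr_ge0 // ltW.
by rewrite lerDl.
Qed.

(** Each term is [d] times an integrable function of [d], or is controlled by such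
    a product through [flux_product_small]; apply [integrable_liminf] to the sum. *)
Lemma liminf_at0 w p m z q n e : space_admissible w p m ->
  space_admissible z q n -> 0 < e -> exists d, [/\ 0 < d, d < e, d < 1 &
  [/\ d * (p d ^+ 2 / a d) <= e, d * w d ^+ 2 <= e, `|p d * w d| <= e &
      `|p d * z d| <= e]].
Proof.
move=> aw az e0.
have [e1 e10 H1] := flux_product_small (sa_0 aw) (sa_0 aw) e0.
have [e2 e20 H2] := flux_product_small (sa_0 aw) (sa_0 az) e0.
pose h x := (w x ^+ 2 + z x ^+ 2) + (p x / Num.sqrt (a x)) ^+ 2.
have hi : L1 h.
  rewrite /h; apply: (L1D mI _ (L2_sqr (sa_p aw))).
  exact: (L1D mI (L2_sqr (sa_w aw)) (L2_sqr (sa_w az))).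
have h0 x : 0 < x < 1 -> 0 <= h x by move=> _; rewrite /h !addr_ge0 ?sqr_ge0.
have m0 : 0 < Num.min e (Num.min e1 e2) by rewrite !lt_min e0 e10.
have [d [d0 + d1 +]] := integrable_liminf h0 hi m0.
rewrite !lt_min !le_min => /and3P[de de1 de2] /and3P[he he1 he2].
move: he he1 he2; rewrite /h sqr_div_sqrt ?(ltW d1) // !mulrDr.
have P0 : 0 <= d * (p d ^+ 2 / a d).
  by rewrite mulr_ge0 ?divr_ge0 ?sqr_ge0 // ltW // (dc_gt0 dc) // ltW.
have W0 : 0 <= d * w d ^+ 2 by rewrite mulr_ge0 ?sqr_ge0 // ltW.
have Z0 : 0 <= d * z d ^+ 2 by rewrite mulr_ge0 ?sqr_ge0 // ltW.
move=> he he1 he2; exists d; split => //; split; [lra|lra|apply: H1|apply: H2] => //; lra.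
Qed.

(** Weighted Hardy-Poincare inequality. Integrate the derivative of [x w^2], which
    vanishes at both ends: the cross term [2 x w w'] is split with weight [r]. *)
Lemma hardy_poincare w p m r : 0 < r -> space_admissible w p m ->
  0 <= \int[mu]_(x in I01)
    (- w x ^+ 2 + (r * (p x ^+ 2 / a x) + r^-1 * (x ^+ 2 / a x * w x ^+ 2))).
Proof.
move=> r0 aw.
have := @ac_improper_le R 0 1 (fun x => - (x * (w x * w x)))
  (fun x => - w x ^+ 2 + (r * (p x ^+ 2 / a x) + r^-1 * (x ^+ 2 / a x * w x ^+ 2))) ltr01.
rewrite (sa_w1 aw) mul0r mulr0 oppr0; apply.
- apply: (L1D mI).
    by apply: (L1N mI); exact: L2_sqr (sa_w aw).
  apply: (L1D mI); apply: (L1Z mI _).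
    apply: eq_L1 (L2_sqr (sa_p aw)) => x x0 x1.
    by rewrite sqr_div_sqrt // ltW.
  apply: eq_L1 (L2_sqr (L2_root_ratio (sa_w aw))) => x x0 x1.
  by rewrite exprMn expr_div_n sqrt_coefK // ltW.
- move=> d /andP[d0 d1]; have acw := sa_acw aw d0 d1.
  apply: (@abs_continuous_dominated _ _ _ (fun x => x * (w x * w x)) _ 1) => //.
    apply: (abs_continuousM (ltW d1) (@id_ac _ _ _)).
    exact: (abs_continuousM (ltW d1) acw acw).
  by move=> x y _ _ _; rewrite mul1r -opprD normrN.
- apply: aeW => x /andP[x0 x1]; have dw := sa_dw aw x0 x1.
  eexists; first by apply: is_derive1N; apply: is_derive1M (is_derive1_id x) (is_derive1M dw dw).
  have ax := dc_gt0 dc x0 (ltW x1).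
  rewrite -subr_ge0; set E := (X in 0 <= X).
  suff -> : E = r^-1 / a x * (r * p x + x * w x) ^+ 2.
    by rewrite mulr_ge0 ?sqr_ge0 // divr_ge0 ?invr_ge0 // ltW.
  by rewrite /E /GRing.scale /=; field; rewrite !gt_eqF.
- move=> e e0; exists (Num.min (e / 2) 2^-1); split.
  + by rewrite lt_min divr_gt0 //= invr_gt0.
  + by rewrite add0r gt_min; apply/orP; left; lra.
  + by rewrite gt_min; apply/orP; right; lra.
  + rewrite (@le_trans _ _ 0) //; last exact: ltW.
    by rewrite oppr_le0 mulr_ge0 // -?expr2 ?sqr_ge0 // ltW // lt_min divr_gt0 //= invr_gt0.
Qed.

(** Subgradient inequality for the convex energy [w |-> 1/2 int a w'^2], whose
    gradient at [w] is [- m]. *)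
Lemma energy_subgradient w p m z q n :
  space_admissible w p m -> space_admissible z q n ->
  0 <= \int[mu]_(x in I01)
    (m x * (z x - w x) + 2^-1 * (q x ^+ 2 / a x - p x ^+ 2 / a x)).
Proof.
move=> aw az.
have := @ac_improper_le R 0 1 (fun x => p x * (z x - w x))
  (fun x => m x * (z x - w x) + 2^-1 * (q x ^+ 2 / a x - p x ^+ 2 / a x)) ltr01.
rewrite (sa_w1 aw) (sa_w1 az) subr0 mulr0; apply.
- apply: (L1D mI).
    by apply: (L2M mI (sa_m aw)); apply: (L2B mI (sa_w az) (sa_w aw)).
  apply: (L1Z mI _); apply: (L1B mI).
    apply: eq_L1 (L2_sqr (sa_p az)) => x x0 x1.
    by rewrite sqr_div_sqrt // ltW.
  apply: eq_L1 (L2_sqr (sa_p aw)) => x x0 x1.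
  by rewrite sqr_div_sqrt // ltW.
- move=> d /andP[d0 d1]; apply: (abs_continuousM (ltW d1) (sa_acp aw d0 d1)).
  apply: (abs_continuousD (sa_acw az d0 d1)).
  apply: (abs_continuous_dominated ler01 (sa_acw aw d0 d1)) => x y _ _ _.
  by rewrite mul1r -opprD normrN.
- apply: ae_mono (sa_dp aw) => x H /andP[x0 x1].
  have dp : is_derive x 1 p (m x) by apply: H; rewrite x0.
  have dw := sa_dw aw x0 x1; have dz := sa_dw az x0 x1.
  eexists; first by apply: is_derive1M dp (is_derive1D dz (is_derive1N dw)).
  have ax := dc_gt0 dc x0 (ltW x1).
  rewrite lerD2l; have : 0 <= 2^-1 / a x * (q x - p x) ^+ 2.
    by rewrite mulr_ge0 ?sqr_ge0 // divr_ge0 // ltW.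
  have -> : 2^-1 / a x * (q x - p x) ^+ 2 =
    2^-1 * (q x ^+ 2 / a x - p x ^+ 2 / a x) - p x * (q x / a x - p x / a x).
    by field; rewrite !gt_eqF.
  lra.
- move=> e e0; have e20 : 0 < e / 2 by rewrite divr_gt0.
  have [d [d0 de d1 [_ _ pw pz]]] := liminf_at0 aw az e20.
  exists d; split => //; first lra.
  rewrite mulrBr; have := ler_norm (p d * z d); have := ler_norm (- (p d * w d)).
  rewrite normrN; lra.
Qed.

Section multiplier.
Variables (c lam : R).
Hypothesis lam_gt0 : 0 < lam.
Local Notation psi := (psi a c lam).

(** The space part of the product of the symmetric and antisymmetric parts of
    the conjugated operator. It is the derivative of the boundary expression
    [- mu lam (x p^2/a + p w + x q w^2)] up to terms of constant sign, where
    [q] is the potential [nu psi + mu^2 lam^2 x^2/a]. *)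
Lemma carleman_multiplier w p m (mu0 nu : R) : 0 <= mu0 ->
  space_admissible w p m ->
  - (mu0 * lam * (p 1 ^+ 2 / a 1)) <= \int[mu]_(x in I01)
    ((- m x - (nu * psi x + mu0 ^+ 2 * lam ^+ 2 * (x ^+ 2 / a x)) * w x) * (2 * mu0 * lam * (x * p x / a x) + mu0 * lam * w x)
     - mu0 * lam * ((2 - K) * (p x ^+ 2 / a x)
        + (nu * lam + mu0 ^+ 2 * lam ^+ 2 * (2 - K)) * (x ^+ 2 / a x * w x ^+ 2))).
Proof.
move=> mu00 aw.
pose q x := nu * psi x + mu0 ^+ 2 * lam ^+ 2 * (x ^+ 2 / a x).
have ml0 : 0 <= mu0 * lam by rewrite mulr_ge0 // ltW.
(* The boundary expression; at 1 only the first term survives since w 1 = 0. *)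
pose B x := - (mu0 * lam) * (x * (p x * p x * (a x)^-1) + p x * w x + x * (q x * (w x * w x))).
have -> : - (mu0 * lam * (p 1 ^+ 2 / a 1)) = B 1.
  by rewrite /B (sa_w1 aw) !mulr0 !addr0 mul1r expr2 mulNr.
have [M M0 HM] := psi_bounded dc c lam_gt0.
have qb : exists2 Q, 0 <= Q & forall x, 0 < x -> x <= 1 -> `|q x| <= Q.
  exists (`|nu| * M + mu0 ^+ 2 * lam ^+ 2 * (a 1)^-1).
    apply: addr_ge0; first by rewrite mulr_ge0 // ltW.
    apply: mulr_ge0; first by rewrite mulr_ge0 ?sqr_ge0.
    by rewrite invr_ge0 ltW // (dc_gt0 dc).
  move=> x x0 x1; apply: le_trans (ler_normD _ _) _; apply: lerD.
    by rewrite normrM ler_wpM2l // HM.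
  rewrite ger0_norm; last first.
    by apply: mulr_ge0; [rewrite mulr_ge0 ?sqr_ge0|exact: ratio2_ge0 dc _ _ _].
  by apply: ler_wpM2l; [rewrite mulr_ge0 ?sqr_ge0|exact: ratio2_bound dc _ _ _].
have [Q Q0 HQ] := qb.
have mq : measurable_fun I01 q.
  apply: measurable_funD.
    apply: measurable_funM; first exact: measurable_cst.
    exact: (psi_measurable dc c lam).
  apply: measurable_funM; first exact: measurable_cst.
  apply: (eq_measurable_fun (fun x => (x / Num.sqrt (a x)) ^+ 2)).
    move=> x /set_mem /in01[x0 x1].
    by rewrite expr_div_n sqrt_coefK // ltW.
  by apply: measurable_funX; exact: root_ratio_measurable.
apply: (ac_improper_le ltr01).
- have Lqw : L2_01 (fun x => q x * w x).
    by apply: (bounded_L2 mI mq _ (sa_w aw)) => x /in01[x0 x1]; apply: HQ => //; exact: ltW.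
  have Lxp : L2_01 (fun x => x * p x / a x).
    apply: (eq_L2 _ (L2_root_ratio (sa_p aw))) => x /set_mem /in01[x0 x1].
    rewrite mulrACA -invfM -expr2 sqrt_coefK //; exact: ltW.
  apply: (L1B mI).
    apply: (L2M mI).
      apply: (L2B mI _ Lqw).
      by apply: (eq_L2 _ (L2Z mI (-1) (sa_m aw))) => x _; rewrite mulN1r.
    exact: (L2D mI (L2Z mI _ Lxp) (L2Z mI _ (sa_w aw))).
  apply: (L1Z mI); apply: (L1D mI); apply: (L1Z mI).
    apply: eq_L1 (L2_sqr (sa_p aw)) => x x0 x1.
    by rewrite sqr_div_sqrt // ltW.
  apply: eq_L1 (L2_sqr (L2_root_ratio (sa_w aw))) => x x0 x1.
  by rewrite exprMn expr_div_n sqrt_coefK // ltW.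
- move=> d /andP[d0 d1]; have acw := sa_acw aw d0 d1; have acp := sa_acp aw d0 d1.
  have acV := inv_coef_ac dc d0 d1.
  have acpsi := psi_ac dc c lam_gt0 d0 d1.
  have acr := ratio2_ac dc d0 d1.
  have ac_cst (k0 : R) : abs_continuous d 1 (fun=> k0) by exact: abs_continuous_cst.
  have acM := fun f g => @abs_continuousM R d 1 f g (ltW d1).
  have acq : abs_continuous d 1 q.
    exact: abs_continuousD (acM _ _ (ac_cst _) acpsi) (acM _ _ (ac_cst _) acr).
  apply: (acM _ _ (ac_cst _)); apply: abs_continuousD; last first.
    exact: acM _ _ (@id_ac _ _ _) (acM _ _ acq (acM _ _ acw acw)).
  apply: abs_continuousD (acM _ _ acp acw).
  exact: acM _ _ (@id_ac _ _ _) (acM _ _ (acM _ _ acp acp) acV).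
- apply: ae_mono (sa_dp aw) => x H /andP[x0 x1].
  have dp : is_derive x 1 p (m x) by apply: H; rewrite x0.
  have dw := sa_dw aw x0 x1; have dV := inv_coef_derive dc x0 x1.
  have dpsi := psi_derive dc c lam x0 x1; have dr := ratio2_derive dc x0 x1.
  have dq := is_derive1D (is_derive1Z nu dpsi) (is_derive1Z (mu0 ^+ 2 * lam ^+ 2) dr).
  have dB1 := is_derive1M (is_derive1_id x) (is_derive1M (is_derive1M dp dp) dV).
  have dB3 := is_derive1M (is_derive1_id x) (is_derive1M dq (is_derive1M dw dw)).
  have dB := is_derive1Z (- (mu0 * lam)) (is_derive1D (is_derive1D dB1 (is_derive1M dp dw)) dB3).
  eexists; first exact: dB.
  have ax := dc_gt0 dc x0 (ltW x1).
  have aK : 0 <= K * a x - x * a' x by rewrite subr_ge0 (dc_le dc).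
  rewrite -/(q x).
  have E0 v : 0 <= mu0 * lam / a x ^+ 2 * v ^+ 2 * (K * a x - x * a' x).
    apply: mulr_ge0 => //; apply: mulr_ge0; last exact: sqr_ge0.
    by apply: divr_ge0 => //; exact: sqr_ge0.
  (* The defect is a sum of squares times K a - x a', nonnegative by dc_le. *)
  rewrite -subr_ge0; set E := (X in 0 <= X).
  suff -> : E = mu0 * lam / a x ^+ 2 * p x ^+ 2 * (K * a x - x * a' x) +
    mu0 * lam / a x ^+ 2 * (mu0 * lam * x * w x) ^+ 2 * (K * a x - x * a' x).
    by rewrite addr_ge0.
  by rewrite /E; field; rewrite gt_eqF.
- move=> e e0; have ml1 : 0 < mu0 * lam * (2 + Q) + 1 by rewrite ltr_wpDl // mulr_ge0 // addr_ge0.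
  pose e1 := e / (mu0 * lam * (2 + Q) + 1).
  have e10 : 0 < e1 by rewrite divr_gt0.
  have m0 : 0 < Num.min e e1 by rewrite lt_min e0.
  have [d [d0 de d1 []]] := liminf_at0 aw aw m0.
  rewrite !le_min => /andP[_ h1] /andP[_ h2] /andP[_ h3] _.
  exists d; split => //; first by rewrite add0r (lt_le_trans de) // ge_min lexx.
  rewrite /B mulNr; apply: le_trans (ler_norm _) _; rewrite normrN normrM ger0_norm //.
  apply: (@le_trans _ _ (mu0 * lam * (e1 + e1 + Q * e1))).
    rewrite ler_wpM2l //; apply: le_trans (ler_normD _ _) _; apply: lerD.
      apply: le_trans (ler_normD _ _) _; apply: lerD h3.
      rewrite -expr2 ger0_norm // mulr_ge0 ?(ltW d0) // divr_ge0 ?sqr_ge0 //.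
      by rewrite ltW // (dc_gt0 dc) // ltW.
    rewrite mulrCA normrM; apply: ler_pM => //; first by apply: HQ => //; exact: ltW.
    by rewrite -expr2 ger0_norm // mulr_ge0 ?sqr_ge0 // ltW.
  have : e1 * (mu0 * lam * (2 + Q) + 1) = e by rewrite divfK // gt_eqF.
  nra.
Qed.

End multiplier.

Lemma ac_FTC_oo f g (c d : R) : c < d -> abs_continuous c d f ->
  mu.-integrable `]c, d[ (EFin \o g) ->
  {ae mu, forall x : R, c < x < d -> is_derive x 1 f (g x)} ->
  f d - f c = \int[mu]_(x in `]c, d[) g x.
Proof.
move=> cd acf gi dg; have [h [ih hE dh]] := abs_continuous_FTC (ltW cd) acf.
rewrite (hE c d) ?lexx ?(ltW cd) // Rintegral_itv_cc_oo //; last first.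
  by apply: integrableS ih => //; exact: measurable_itv.
have ih' : mu.-integrable `]c, d[ (EFin \o h).
  by apply: integrableS ih => //; exact: measurable_itv.
have eq_ae : {ae mu, forall x : R, c < x < d -> h x = g x}.
  apply: ae_mono (ae_and dg dh) => x [H1 H2] cxd.
  have d1 := H1 cxd; have d2 := H2 cxd.
  by rewrite -(@derive_val _ _ _ _ _ _ _ d1) (@derive_val _ _ _ _ _ _ _ d2).
apply/le_anti/andP; split; apply: (ae_le_Rintegral (X := measurableTypeR R) (m := leb R) (D := `]c, d[%classic)) => //;
  apply: ae_mono eq_ae => x H /=; rewrite in_itv /= => /H ->; exact: lexx.
Qed.

(** [(2 x - 1) p] vanishes at [1/2] and equals [p] at 1. An integral over space is
    measurable in time, which the trace is not by definition. *)
Lemma flux_at1 w p m : space_admissible w p m ->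
  p 1 = \int[mu]_(x in `]2^-1, 1[) (2 * p x + (2 * x - 1) * m x).
Proof.
move=> aw; have h0 : 0 < 2^-1 :> R by rewrite invr_gt0.
have h1 : 2^-1 < 1 :> R by lra.
have acp := sa_acp aw h0 h1.
have mII : measurable (`]2^-1, 1[%classic : set (measurableTypeR R)) by exact: measurable_itv.
have sub : `]2^-1, 1[ `<=` I01.
  by move=> x /=; rewrite !in_itv /= => /andP[/(lt_trans h0) -> ->].
have Lm : mu.-integrable `]2^-1, 1[ (EFin \o m).
  exact: (integrableS mI mII sub) (L2_L1 mI (lebesgue_measure_oo_fin 0 1) (sa_m aw)).
have gi : mu.-integrable `]2^-1, 1[ (EFin \o (fun x => 2 * p x + (2 * x - 1) * m x)).
  apply: (L1D mII).
    apply: (L1Z mII); have h1' := ac_integrable h1 acp.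
    by apply: integrableS h1' => //; exact: subset_itv_oo_cc.
  apply: (@bounded_L1 _ _ _ mu _ mII 1 m (fun x => 2 * x - 1)) => //.
    by apply: (@derivable_measurable R _ (fun=> 2 * 1 + 0)) => x _ _;
       exact: (is_derive1D (is_derive1Z _ (is_derive1_id x)) (is_derive1_cst x (- 1))).
  by move=> x /=; rewrite in_itv /= ler_norml => /andP[]; lra.
have := @ac_FTC_oo (fun x => (2 * x - 1) * p x) _ _ _ h1 _ gi _.
rewrite /= mulr1 mulfV // subrr mul0r subr0 => H.
rewrite -H; first lra.
- apply: (abs_continuousM (ltW h1)) => //.
  apply: abs_continuousD (abs_continuous_cst _ _ (- 1)).
  apply: (abs_continuousM (ltW h1) (abs_continuous_cst _ _ _)).
  exact: id_ac.
- apply: ae_mono (sa_dp aw) => x Hx /andP[x1 x2].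
  have dp : is_derive x 1 p (m x) by apply: Hx; rewrite x2 (lt_trans h0).
  apply: is_derive_eq (is_derive1M (is_derive1D (is_derive1Z 2 (is_derive1_id x)) (is_derive1_cst x (- 1))) dp) _.
  by rewrite mulr1 addr0.
Qed.

End space.

(** * Regularity of the flux and conjugation in space *)

Section regularity.
Context {R : realType} (k : degeneracy) (a a' : R -> R) (K : R).
Hypothesis dc : degenerate_coefficient a a' K.
Notation mu := (@lebesgue_measure R).
Implicit Types (x y d e r : R) (f g u w p m : R -> R).
Local Notation I01 := (`]0, 1[%classic : set (measurableTypeR R)).
Local Notation L1 h := (mu.-integrable I01 (EFin \o h)).

Let mI : measurable I01. Proof. exact: measurable_itv. Qed.

Lemma cauchy_schwarz_cst f x y : x < y ->
  square_integrable mu (`]x, y[%classic : set (measurableTypeR R)) f ->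
  (\int[mu]_(z in `]x, y[) f z) ^+ 2 <= (y - x) * \int[mu]_(z in `]x, y[) f z ^+ 2.
Proof.
move=> xy Lf; set D := (`]x, y[%classic : set (measurableTypeR R)).
have l0 : 0 < y - x by rewrite subr_gt0.
set l := y - x in l0 *.
have mD : measurable D by exact: measurable_itv.
have muD : mu D = l%:E by rewrite lebesgue_measure_itv /= lte_fin xy -EFinB.
have Dfin := lebesgue_measure_oo_fin x y.
have fi := L2_L1 mD Dfin Lf; have f2 := L2_sqr Lf; have c1 := L2_sqr (L2_cst mD 1 Dfin).
set A := \int[mu]_(z in D) f z; set B := \int[mu]_(z in D) f z ^+ 2.
(* Expand the square of l f - A, where A is the integral of f. *)
have : 0 <= \int[mu]_(z in D) ((l ^+ 2 * f z ^+ 2 - (2 * l * A) * f z) + A ^+ 2 * 1 ^+ 2).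
  apply: Rintegral_ge0 => z _.
  have -> : (l ^+ 2 * f z ^+ 2 - (2 * l * A) * f z) + A ^+ 2 * 1 ^+ 2 = (l * f z - A) ^+ 2 by ring.
  exact: sqr_ge0.
rewrite RintegralD //; [|exact: (L1B mD (L1Z mD _ f2) (L1Z mD _ fi))|exact: (L1Z mD _ c1)].
rewrite RintegralB //; [|exact: (L1Z mD _ f2)|exact: (L1Z mD _ fi)].
rewrite (RintegralZl (l ^+ 2) mD f2) (RintegralZl (2 * l * A) mD fi) (RintegralZl (A ^+ 2) mD c1) -/A -/B.
have -> : \int[mu]_(_ in D) 1 ^+ 2 = l.
  by rewrite expr1n Rintegral_cst // [X in fine X]muD mul1r.
move=> h; have : 0 <= l * (l * B - A ^+ 2).
  by move: h; congr (0 <= _); ring.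
by rewrite pmulr_rge0 // subr_ge0.
Qed.

(** The class of [a u_x] in [H^1] has an absolutely continuous representative [p].
    By continuity of [p/a] away from 0, [u] is differentiable everywhere in
    [(0, 1)] with [u' = p/a]. In the strong case the boundary condition is
    [p 0 = 0], and Cauchy-Schwarz gives [p^2 = O(x)]. *)
Lemma flux_representative u : H2a k a u -> boundary_conditions k a u ->
  exists p, [/\ space_admissible k a u p (Mop a u),
    forall x, 0 < x -> x < 1 -> p x = a x * derive1 u x &
    left_derivative u 1 = p 1 / a 1].
Proof.
move=> [[Lu acu Ldu u1 _] [p [acp Ldp] ap]] [_ bc].
exists p.
have acu' d : 0 < d -> d < 1 -> abs_continuous d 1 u.
  move=> d0 d1; case: k acu => acu; last by apply: acu; rewrite d0.
  exact: sub_abs_continuous (ltW d0) (lexx 1) acu.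
have acp' d : 0 < d -> d < 1 -> abs_continuous d 1 p.
  by move=> d0 d1; exact: sub_abs_continuous (ltW d0) (lexx 1) acp.
have acpa d : 0 < d -> d < 1 -> abs_continuous d 1 (fun x => p x / a x).
  by move=> d0 d1; apply: (abs_continuousM (ltW d1) (acp' _ d0 d1)); exact: inv_coef_ac dc _ _ _.
have du x : 0 < x -> x < 1 -> is_derive x 1 u (p x / a x).
  move=> x0 x1; pose d := x / 2; have d0 : 0 < d by rewrite divr_gt0.
  have dx : d < x by rewrite /d; lra.
  have d1 : d < 1 by lra.
  have [g [ig gE dg]] := abs_continuous_FTC (ltW d1) (acu' _ d0 d1).
  have gp : {ae mu, forall z : R, d < z < 1 -> g z = p z / a z}.
    apply: ae_mono (ae_and dg ap) => z [H1 H2] /andP[dz z1].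
    have z0 := lt_trans d0 dz.
    have dgz : is_derive z 1 u (g z) by apply: H1; rewrite dz.
    rewrite H2 ?z0 // /flux derive1E (@derive_val _ _ _ _ _ _ _ dgz) mulrC mulKf //.
    by rewrite gt_eqF // (dc_gt0 dc) // ltW.
  have ipa : mu.-integrable `[d, 1] (EFin \o (fun z => p z / a z)).
    by apply: ac_integrable => //; exact: acpa.
  have uE y : d < y -> y < 1 -> u y = u d + \int[mu]_(z in `[d, y]) (p z / a z).
    move=> dy y1; have := gE d y (lexx _) (ltW dy) (ltW y1).
    have sub : `[d, y] `<=` (`[d, 1] : set R).
      by move=> z /=; rewrite !in_itv /= => /andP[-> /le_trans]; apply; exact: ltW.
    have i1 : mu.-integrable `[d, y] (EFin \o (fun z => p z / a z)).
      by apply: integrableS ipa => //; exact: measurable_itv.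
    have i2 : mu.-integrable `[d, y] (EFin \o g) by exact: integrableS ig.
    rewrite !Rintegral_itv_cc_oo // => h.
    have sub2 : `]d, y[ `<=` (`[d, y] : set R) by exact: subset_itv_oo_cc.
    have -> : \int[mu]_(z in `]d, y[) (p z / a z) = \int[mu]_(z in `]d, y[) g z.
      have j1 : mu.-integrable `]d, y[ (EFin \o (fun z => p z / a z)).
        by apply: integrableS i1 => //; exact: measurable_itv.
      have j2 : mu.-integrable `]d, y[ (EFin \o g) by exact: integrableS ig.
      apply/le_anti/andP; split; apply: (ae_le_Rintegral (X := measurableTypeR R) (m := leb R) (D := `]d, y[%classic)) => //;
        apply: ae_mono gp => z H /=; rewrite in_itv /= => /andP[dz zy];
        by rewrite H ?dz ?(lt_trans zy).
    by rewrite -h addrC subrK.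
  have cx : {for x, continuous (fun z => p z / a z)}.
    apply: (within_continuous_continuous d1 (abs_continuous_within (ltW d1) (acpa _ d0 d1))).
    by rewrite in_itv /= dx.
  have [|dF F'] := continuous_FTC1 x1 ipa _ cx; first by rewrite ?bnd_simp /= ?ltW.
  apply: (@near_eq_is_derive _ _ _ (fun y => u d + \int[mu]_(z in [set` Interval (BLeft d) (BRight y)]) (p z / a z))).
    near=> y; rewrite -uE //; first by near: y; exact: lt_nbhsr.
    by near: y; exact: lt_nbhsl.
  apply: is_derive_eq (is_derive1D (is_derive1_cst x (u d)) (derivableP dF)) _.
  by rewrite add0r -derive1E.
have pE x : 0 < x -> x < 1 -> p x = a x * derive1 u x.
  move=> x0 x1; have dux := du x x0 x1.
  rewrite derive1E (@derive_val _ _ _ _ _ _ _ dux) mulrC divfK //.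
  by rewrite gt_eqF // (dc_gt0 dc) // ltW.
have ME x : 0 < x -> x < 1 -> Mop a u x = derive1 p x.
  move=> x0 x1; rewrite /Mop !derive1E; apply: near_eq_derive.
  near=> y; rewrite /flux pE //; first by near: y; exact: lt_nbhsr.
  by near: y; exact: lt_nbhsl.
have LM : L2_01 (Mop a u).
  by apply: (eq_L2 _ Ldp) => x /set_mem /in01[x0 x1]; rewrite ME.
split => //.
  split => //.
  - have [g [ig gE dg]] := abs_continuous_FTC ler01 acp.
    apply: ae_mono dg => x H /andP[x0 x1].
    have dp : is_derive x 1 p (g x) by apply: H; rewrite x0.
    by rewrite ME // derive1E (@derive_val _ _ _ _ _ _ _ dp).
  - apply: (eq_L2 _ Ldu) => x /set_mem /in01[x0 x1].
    have s0 := sqrt_coef_gt0 dc x0 (ltW x1).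
    rewrite pE // -{2}(sqrt_coefK dc x0 (ltW x1)).
    by field; rewrite gt_eqF.
  - have [M M0 HM] := abs_continuous_bounded ler01 acp.
    rewrite /vanishing_at0; case: k acu bc => acu bc.
      split; last by exists M => x x0 x1; apply: HM; rewrite !ltW.
      move=> e e0; have [d d0 Hd] := abs_continuous_near acu e0.
      exists d => // x x0 xd x1; have := Hd 0 x (lexx _) (ltW x0) (ltW x1).
      by rewrite bc !subr0 => /(_ xd) /ltW.
    have p0 : p 0 = 0.
      apply/eqP; rewrite -normr_le0; apply/ler_addgt0Pr => e e0; rewrite add0r.
      have e20 : 0 < e / 2 by rewrite divr_gt0.
      have [d d0 Hd] := abs_continuous_near acp e20.
      have /cvgrPdist_lt /(_ _ e20) bce := bc.
      near (at_right (0 : R)) => x.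
      have x0 : 0 < x by near: x; exact: nbhs_right_gt.
      have x1 : x < 1 by near: x; exact: nbhs_right_lt.
      have xd : x < d by near: x; exact: nbhs_right_lt.
      have h1 : `|0 - flux a u x| < e / 2 by near: x.
      have h2 := Hd 0 x (lexx _) (ltW x0) (ltW x1).
      rewrite subr0 in h2; have {}h2 := h2 xd.
      rewrite sub0r normrN /flux -pE // in h1.
      have := ler_normB (p x) (p x - p 0).
      rewrite opprB addrC subrK => h3; lra.
    exists (\int[mu]_(x in I01) Mop a u x ^+ 2) => x x0 x1.
    have sub : `]0, x[ `<=` I01.
      by move=> z /=; rewrite !in_itv /= => /andP[-> /lt_trans]; exact.
    have mx : measurable (`]0, x[%classic : set (measurableTypeR R)) by exact: measurable_itv.
    have acx : abs_continuous 0 x p by apply: sub_abs_continuous acp => //; exact: ltW.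
    have Lx : square_integrable mu (`]0, x[%classic : set (measurableTypeR R)) (Mop a u).
      apply/L2P; split; first exact: measurable_funS mI sub (L2_measurable LM).
      exact: integrableS mI mx sub (L2_sqr LM).
    have iM : mu.-integrable `]0, x[ (EFin \o Mop a u).
      exact: (L2_L1 mx (lebesgue_measure_oo_fin 0 x) Lx).
    have := @ac_FTC_oo R p (Mop a u) 0 x x0 acx iM.
    rewrite p0 subr0 => ->; last first.
      have [g [ig gE dg]] := abs_continuous_FTC ler01 acp.
      apply: ae_mono dg => z H /andP[z0 zx]; have z1 := lt_trans zx x1.
      have dp : is_derive z 1 p (g z) by apply: H; rewrite z0.
      by rewrite ME // derive1E (@derive_val _ _ _ _ _ _ _ dp).
    apply: le_trans (cauchy_schwarz_cst x0 Lx) _; rewrite subr0 mulrC ler_wpM2r ?(ltW x0) //.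
    have iM2 := L2_sqr LM.
    rewrite /Rintegral; apply: fine_le.
    - by apply: integrable_fin_num => //; exact: integrableS mI mx sub iM2.
    - exact: integrable_fin_num.
    - apply: ge0_subset_integral => //; first exact: measurable_int iM2.
      by move=> z _; rewrite lee_fin sqr_ge0.
apply/cvg_lim => //; apply/cvgrPdist_le => e e0.
have h0 : 0 < 2^-1 :> R by rewrite invr_gt0.
have h1 : 2^-1 < 1 :> R by lra.
have [d d0 Hd] := abs_continuous_near (acpa _ h0 h1) e0.
near=> y.
have y1 : y < 1 by near: y; exact: nbhs_left_lt.
have yh : 2^-1 < y by near: y; exact: nbhs_left_gt.
have yd : 1 - d < y by near: y; apply: nbhs_left_gt; rewrite ltrBlDr ltrDl.
have y0 := lt_trans h0 yh.
have [z + E] : exists2 z, z \in `]y, 1[ & u 1 - u y = (p z / a z) * (1 - y).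
  apply: (@MVT R u (fun z => p z / a z)) => //.
    by move=> z; rewrite in_itv /= => /andP[yz z1]; apply: du => //; exact: lt_trans y0 yz.
  by apply: (abs_continuous_within (ltW y1)); exact: acu'.
rewrite in_itv /= => /andP[yz z1].
have -> : (u y - u 1) / (y - 1) = p z / a z.
  rewrite (_ : u y - u 1 = p z / a z * (y - 1)); last by rewrite -opprB E; ring.
  by rewrite mulfK // subr_eq0 lt_eqF.
apply: ltW; apply: Hd => //; [exact: ltW (lt_trans yh yz)|exact: ltW|].
by lra.
Unshelve. all: by end_near. Qed.

Section conjugation.
Variables (c lam : R).
Hypothesis lam_gt0 : 0 < lam.
Local Notation psi := (psi a c lam).

Lemma expR_lipschitz M x y : `|x| <= M -> `|y| <= M ->
  `|expR y - expR x| <= expR M * `|y - x|.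
Proof.
wlog xy : x y / x <= y.
  move=> H xM yM; have [xy|/ltW yx] := leP x y; first exact: H.
  by rewrite distrC (distrC y); exact: H.
move=> _ yM; rewrite ger0_norm ?subr_ge0 ?ler_expR // ger0_norm ?subr_ge0 //.
have h : expR y * (1 + (x - y)) <= expR x.
  apply: (@le_trans _ _ (expR y * expR (x - y))).
    by rewrite ler_wpM2l ?expR_ge0 // expR_ge1Dx.
  by rewrite -expRD addrC subrK.
have h2 : expR y <= expR M by rewrite ler_expR (le_trans (ler_norm _)).
have xy0 : 0 <= y - x by rewrite subr_ge0.
apply: (@le_trans _ _ (expR y * (y - x))); last by rewrite ler_wpM2r.
by move: h; rewrite mulrDr mulr1; lra.
Qed.

Variables (u p m : R -> R) (z0 mu0 : R).
Hypothesis au : space_admissible k a u p m.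

Let ml := mu0 * lam.
Let zeta x := z0 * expR (mu0 * psi x).

Let zeta_bounded : exists2 Z, 0 <= Z & forall x, 0 < x -> x <= 1 -> `|zeta x| <= Z.
Proof.
have [M M0 HM] := psi_bounded dc c lam_gt0.
exists (`|z0| * expR (`|mu0| * M)); first by rewrite mulr_ge0 // expR_ge0.
move=> x x0 x1; rewrite normrM ler_wpM2l // ger0_norm ?expR_ge0 // ler_expR.
by apply: le_trans (ler_norm _) _; rewrite normrM ler_wpM2l // HM.
Qed.

Let zeta_ac d : 0 < d -> d < 1 -> abs_continuous d 1 zeta.
Proof.
move=> d0 d1; have [M M0 HM] := psi_bounded dc c lam_gt0.
apply: (abs_continuousM (ltW d1) (abs_continuous_cst _ _ _)).
apply: (abs_continuous_dominated _ (psi_ac dc c lam_gt0 d0 d1)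
  (k := expR (`|mu0| * M) * `|mu0|)); first by rewrite mulr_ge0 // expR_ge0.
move=> x y dx xy y1.
have bd z : d <= z -> z <= 1 -> `|mu0 * psi z| <= `|mu0| * M.
  by move=> dz z1; rewrite normrM ler_wpM2l // HM // (lt_le_trans d0).
apply: le_trans (expR_lipschitz (bd _ dx (le_trans xy y1)) (bd _ (le_trans dx xy) y1)) _.
by rewrite -mulrBr normrM mulrA.
Qed.

Let zeta_derive x : 0 < x -> x < 1 ->
  is_derive x 1 zeta (zeta x * (ml * (x / a x))).
Proof.
move=> x0 x1; apply: is_derive_eq (is_derive1Z z0 (is_derive1_exp (is_derive1Z mu0 (psi_derive dc c lam x0 x1)))) _.
by rewrite /zeta /ml; ring.
Qed.

Let zeta_measurable : measurable_fun I01 zeta.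
Proof. exact: derivable_measurable zeta_derive. Qed.

Let zetaL2 f : L2_01 f -> L2_01 (fun x => zeta x * f x).
Proof.
have [Z Z0 HZ] := zeta_bounded.
apply: (bounded_L2 mI zeta_measurable) => x /in01[x0 x1].
by apply: HZ => //; exact: ltW.
Qed.

(** As [psi' = lam x/a], the flux of [zeta u] is [zeta (p + mu0 lam x u)]. In the
    strong case [x u^2] is bounded, so the new term is again [O(sqrt x)]. *)
Lemma conjugate_admissible : space_admissible k a
  (fun x => zeta x * u x)
  (fun x => zeta x * (p x + ml * (x * u x)))
  (fun x => zeta x * (m x + 2 * ml * (x * p x / a x) + ml * u x
     + ml ^+ 2 * (x ^+ 2 / a x * u x))).
Proof.
have Lxp : L2_01 (fun x => x * p x / a x).
  apply: (eq_L2 _ (L2_root_ratio dc (sa_p au))) => x /set_mem /in01[x0 x1].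
  by rewrite mulrACA -invfM -expr2 (sqrt_coefK dc) //; exact: ltW.
have Lxxu : L2_01 (fun x => x ^+ 2 / a x * u x).
  apply: (eq_L2 _ (L2_root_ratio dc (L2_root_ratio dc (sa_w au)))) => x /set_mem /in01[x0 x1].
  by rewrite mulrA -expr2 expr_div_n (sqrt_coefK dc) // ltW.
have acM := fun f g d (d1 : d < 1) => @abs_continuousM R d 1 f g (ltW d1).
split.
- by move=> d d0 d1; apply: (acM) => //; [exact: zeta_ac|exact: sa_acw au _ _ _].
- move=> d d0 d1; apply: (acM) => //; first exact: zeta_ac.
  apply: (abs_continuousD (sa_acp au d0 d1)).
  apply: (acM) => //; first exact: abs_continuous_cst.
  by apply: (acM) => //; [exact: id_ac|exact: sa_acw au _ _ _].
- move=> x x0 x1; apply: is_derive_eq (is_derive1M (zeta_derive x0 x1) (sa_dw au x0 x1)) _.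
  have ax := dc_gt0 dc x0 (ltW x1).
  by field; rewrite gt_eqF.
- apply: ae_mono (sa_dp au) => x H /andP[x0 x1].
  have dp : is_derive x 1 p (m x) by apply: H; rewrite x0.
  apply: is_derive_eq (is_derive1M (zeta_derive x0 x1)
    (is_derive1D dp (is_derive1Z ml (is_derive1M (is_derive1_id x) (sa_dw au x0 x1))))) _.
  have ax := dc_gt0 dc x0 (ltW x1).
  by field; rewrite gt_eqF.
- exact: zetaL2 (sa_w au).
- have := zetaL2 (L2D mI (sa_p au) (L2Z mI ml (L2_root_ratio dc (sa_w au)))).
  apply: eq_L2 => x _; ring.
- apply: zetaL2; apply: (L2D mI _ (L2Z mI _ Lxxu)).
  apply: (L2D mI _ (L2Z mI _ (sa_w au))).
  exact: (L2D mI (sa_m au) (L2Z mI _ Lxp)).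
- by rewrite (sa_w1 au) mulr0.
have [Z Z0 HZ] := zeta_bounded.
have := sa_0 au; rewrite /vanishing_at0; case: k au => au'.
  move=> [uv [M HM]]; split.
    move=> e e0; have Z1 : 0 < Z + 1 by rewrite ltr_wpDl.
    have [d d0 Hd] := uv _ (divr_gt0 e0 Z1); exists d => // x x0 xd x1.
    rewrite normrM; have h1 := Hd x x0 xd x1; have h2 := HZ x x0 (ltW x1).
    rewrite ler_pdivlMr // in h1; apply: le_trans h1; rewrite mulrC ler_wpM2l //.
    by apply: le_trans h2 _; rewrite lerDl.
  have [d d0 Hd] := uv _ ltr01.
  pose d1 := Num.min (d / 2) (2^-1).
  have d10 : 0 < d1 by rewrite lt_min divr_gt0 //= invr_gt0.
  have d11 : d1 < 1 by rewrite gt_min; apply/orP; right; lra.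
  have d1d : d1 < d by rewrite gt_min; apply/orP; left; lra.
  have [U U0 HU] := abs_continuous_bounded (ltW d11) (sa_acw au' d10 d11).
  exists (Z * (M + `|ml| * (U + 1))) => x x0 x1; rewrite normrM.
  apply: ler_pM => //; first exact: HZ (ltW x1).
  apply: le_trans (ler_normD _ _) _; apply: lerD; first exact: HM.
  rewrite !normrM ler_wpM2l // gtr0_norm //.
  have ux : `|u x| <= U + 1.
    have [dx|xd] := leP d1 x.
      by apply: le_trans (HU _ _) _; rewrite ?dx ?ltW // ltrDl.
    by apply: le_trans (Hd _ x0 (lt_trans xd d1d) x1) _; rewrite lerDr.
  by apply: le_trans ux; rewrite ler_piMl // ltW.
move=> [M HM].
(* F is the derivative of x u^2, which is therefore bounded. *)
pose F x := u x ^+ 2 + 2 * (u x * (x * p x / a x)).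
have FI : L1 F.
  by apply: (L1D mI (L2_sqr (sa_w au')) (L1Z mI _ (L2M mI (sa_w au') Lxp))).
have xu x : 0 < x -> x < 1 -> x * u x ^+ 2 <= \int[mu]_(z in I01) `|F z|.
  move=> x0 x1; have sub : `]x, 1[ `<=` I01.
    by move=> z /=; rewrite !in_itv /= => /andP[/(lt_trans x0) -> ->].
  have mx : measurable (`]x, 1[%classic : set (measurableTypeR R)) by exact: measurable_itv.
  have Fx : mu.-integrable `]x, 1[ (EFin \o F) by exact: integrableS FI.
  have acw := sa_acw au' x0 x1.
  have := @ac_FTC_oo R (fun z => z * (u z * u z)) F x 1 x1 _ Fx _.
  rewrite (sa_w1 au') mulr0 mulr0 sub0r => H.
  have {}H : x * u x ^+ 2 = - \int[mu]_(z in `]x, 1[) F z.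
    rewrite -H ?opprK ?expr2 //.
      by apply: (acM) => //; [exact: id_ac|exact: acM].
    apply: aeW => z /andP[xz z1]; have z0' := lt_trans x0 xz.
    have dw := sa_dw au' z0' z1.
    apply: is_derive_eq (is_derive1M (is_derive1_id z) (is_derive1M dw dw)) _.
    have az := dc_gt0 dc z0' (ltW z1).
    by rewrite /F; field; rewrite gt_eqF.
  rewrite H; apply: le_trans (ler_norm _) _; rewrite normrN.
  apply: le_trans (le_normr_Rintegral mx Fx) _.
  rewrite /Rintegral; apply: fine_le.
  - by apply: integrable_fin_num => //; exact: integrable_norm.
  - by apply: integrable_fin_num => //; exact: integrable_norm.
  - apply: ge0_subset_integral => //.
    by have := measurable_int _ (integrable_norm FI).
set S := Rintegral _ _ _ in xu.
have S0 : 0 <= S by apply: Rintegral_ge0.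
exists (2 * Z ^+ 2 * (M + ml ^+ 2 * S)) => x x0 x1.
have h1 := HM x x0 x1; have h2 := xu x x0 x1.
have h3 : zeta x ^+ 2 <= Z ^+ 2.
  by rewrite -real_normK ?num_real // ler_sqr ?nnegrE // HZ // ltW.
rewrite exprMn; apply: (@le_trans _ _ (Z ^+ 2 * (p x + ml * (x * u x)) ^+ 2)).
  by apply: ler_wpM2r => //; exact: sqr_ge0.
have -> : 2 * Z ^+ 2 * (M + ml ^+ 2 * S) * x = Z ^+ 2 * (2 * ((M + ml ^+ 2 * S) * x)) by ring.
apply: ler_wpM2l; first exact: sqr_ge0.
have h4 : x ^+ 2 * u x ^+ 2 <= S * x.
  by rewrite expr2 -mulrA mulrC ler_wpM2r // ltW.
have h5 : ml ^+ 2 * (x ^+ 2 * u x ^+ 2) <= ml ^+ 2 * (S * x) by rewrite ler_wpM2l ?sqr_ge0.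
have := sqr_ge0 (p x - ml * (x * u x)).
have -> : (p x + ml * (x * u x)) ^+ 2 = 2 * p x ^+ 2 + 2 * (ml ^+ 2 * (x ^+ 2 * u x ^+ 2))
   - (p x - ml * (x * u x)) ^+ 2 by ring.
have -> : 2 * ((M + ml ^+ 2 * S) * x) = 2 * (M * x) + 2 * (ml ^+ 2 * (S * x)) by ring.
lra.
Qed.

End conjugation.

End regularity.

(** * Null sets and integrals on products; translations *)

Section product_almost_everywhere.
Context d1 d2 (T1 : measurableType d1) (T2 : measurableType d2) (R : realType).
Variables (m1 : {sigma_finite_measure set T1 -> \bar R})
          (m2 : {sigma_finite_measure set T2 -> \bar R}).
Local Notation m12 := (m1 \x m2)%E.

Lemma ge0_integral_eq0 d (T : measurableType d) (mu : {measure set T -> \bar R})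
  (f : T -> \bar R) : measurable_fun setT f -> (forall x, 0 <= f x)%E ->
  (\int[mu]_x f x = 0)%E <-> {ae mu, forall x, f x = 0%E}.
Proof.
move=> mf f0; have := ae_eq_integral_abs mu measurableT mf.
have -> : (\int[mu]_x `|f x| = \int[mu]_x f x)%E.
  by apply: eq_integral => x _; rewrite gee0_abs.
move=> ->; split; apply: ae_mono => x; first by apply.
by move=> -> _.
Qed.

Lemma product_measure_ysection A : measurable A ->
  m12 A = (\int[m2]_y m1 (ysection A y))%E.
Proof.
move=> mA; have := indic_fubini_tonelli1 m1 m2 mA.
rewrite integral_indic // setIT => ->; rewrite indic_fubini_tonelli //.
by apply: eq_integral => y _; rewrite indic_fubini_tonelli_GE.
Qed.

Lemma ae_xsection (P : T1 * T2 -> Prop) : {ae m12, forall z, P z} ->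
  {ae m1, forall x, {ae m2, forall y, P (x, y)}}.
Proof.
move=> [N [mN N0 PN]].
have : {ae m1, forall x, m2 (xsection N x) = 0%E}.
  apply/ge0_integral_eq0 => //; first exact: measurable_fun_xsection.
apply: ae_mono => x Nx; exists (xsection N x); split => //.
  exact: measurable_xsection.
by move=> y /= Pxy; rewrite /xsection /= inE; exact: PN.
Qed.

Lemma measurable_ae0 d (T : measurableType d) (mu : {measure set T -> \bar R})
  (A : set T) : measurable A -> {ae mu, forall x, ~ A x} -> mu A = 0%E.
Proof.
move=> mA [N [mN N0 AN]]; apply/eqP; rewrite eq_le measure_ge0 andbT -N0.
by apply: le_measure; rewrite ?inE // => x Ax; apply: AN => /=; exact: contra_not (_ : ~ ~ A x).
Qed.

(** Measurability of [A] turns an assertion about almost every line into one about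
    the product: both sides say that the complement has measure 0. *)
Lemma ae_of_xsection (A : set (T1 * T2)) : measurable A ->
  {ae m1, forall x, {ae m2, forall y, A (x, y)}} -> {ae m12, forall z, A z}.
Proof.
move=> mA H; exists (~` A); split => //; first exact: measurableC.
apply/(ge0_integral_eq0 m1) => //.
  by apply: measurable_fun_xsection; exact: measurableC.
apply: ae_mono H => x H; apply: measurable_ae0.
  by apply: measurable_xsection; exact: measurableC.
by apply: ae_mono H => y Ay; rewrite /xsection /= inE.
Qed.

Lemma ae_of_ysection (A : set (T1 * T2)) : measurable A ->
  {ae m2, forall y, {ae m1, forall x, A (x, y)}} -> {ae m12, forall z, A z}.
Proof.
move=> mA H; have mC : measurable (~` A) by exact: measurableC.
exists (~` A); split => //; rewrite product_measure_ysection //.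
apply/(ge0_integral_eq0 m2) => //; first exact: measurable_fun_ysection.
apply: ae_mono H => x H; apply: measurable_ae0; first exact: measurable_ysection.
by apply: ae_mono H => y Ay; rewrite /ysection /= inE.
Qed.

Variables (A : set T1) (B : set T2).
Hypotheses (mA : measurable A) (mB : measurable B).
Implicit Types f : T1 * T2 -> R.

Lemma measurable_rectangle : measurable (A `*` B).
Proof. exact: measurableX. Qed.

Let restrX f x y : A x ->
  (EFin ((f \_ (A `*` B)) (x, y))) = ((fun y => (f (x, y))%:E) \_ B) y.
Proof.
move=> Ax; rewrite !patchE; case: ifPn => [/set_mem[_ By]|]; first by rewrite mem_set.
by rewrite !notin_setE => nAB; rewrite ifN // notin_setE => By; apply: nAB.
Qed.

Let restrX0 f x y : ~ A x -> (f \_ (A `*` B)) (x, y) = 0.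
Proof. by move=> nAx; rewrite patchE ifN // notin_setE => -[]. Qed.

Let restrY f x y : B y ->
  (EFin ((f \_ (A `*` B)) (x, y))) = ((fun x => (f (x, y))%:E) \_ A) x.
Proof.
move=> By; rewrite !patchE; case: ifPn => [/set_mem[Ax _]|]; first by rewrite mem_set.
by rewrite !notin_setE => nAB; rewrite ifN // notin_setE => Ax; apply: nAB.
Qed.

Let restrY0 f x y : ~ B y -> (f \_ (A `*` B)) (x, y) = 0.
Proof. by move=> nBy; rewrite patchE ifN // notin_setE => -[]. Qed.

Let restr_integrable f : m12.-integrable (A `*` B) (EFin \o f) ->
  m12.-integrable setT (EFin \o (f \_ (A `*` B))).
Proof.
move=> fi; rewrite (_ : EFin \o _ = (EFin \o f) \_ (A `*` B)).
  exact/(integrable_mkcond _ measurable_rectangle).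
by apply/funext => x /=; rewrite !patchE; case: ifP.
Qed.

Lemma fubini_rectangle1 f : m12.-integrable (A `*` B) (EFin \o f) ->
  [/\ {ae m1, forall x, A x -> m2.-integrable B (EFin \o (fun y => f (x, y)))},
      m1.-integrable A (EFin \o (fun x => \int[m2]_(y in B) f (x, y))) &
      \int[m12]_(z in A `*` B) f z = \int[m1]_(x in A) \int[m2]_(y in B) f (x, y)].
Proof.
move=> /restr_integrable fi.
have sec x : A x -> (\int[m2]_y ((f \_ (A `*` B)) (x, y))%:E)%E =
    (\int[m2]_(y in B) (f (x, y))%:E)%E.
  move=> Ax; rewrite [RHS]integral_mkcond; apply: eq_integral => y _.
  exact: restrX.
have h1 := ae_integrable1 fi.
have aei : {ae m1, forall x, A x -> m2.-integrable B (EFin \o (fun y => f (x, y)))}.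
  apply: ae_mono h1 => x H Ax; apply/(integrable_mkcond _ mB).
  by apply: eq_integrable H => // y _ /=; rewrite restrX.
have h2 := integrable_fubini_F fi.
have FE : {ae m1, forall x, A x -> fubini_F m2 (EFin \o (f \_ (A `*` B))) x =
    (\int[m2]_(y in B) f (x, y))%:E}.
  apply: ae_mono aei => x H Ax; rewrite /fubini_F /= sec // /Rintegral fineK //.
  by have := integrable_fin_num mB (H Ax).
have h3 : m1.-integrable A (fubini_F m2 (EFin \o (f \_ (A `*` B)))) by exact: integrableS h2.
have fin0 : m1.-integrable A (EFin \o (fun x => \int[m2]_(y in B) f (x, y))).
  have -> : EFin \o (fun x => \int[m2]_(y in B) f (x, y)) =
     (fun x => (fine (\int[m2]_(y in B) (f (x, y))%:E)%E)%:E) by [].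
  apply: (eq_integrable mA (fun x => (fine (fubini_F m2 (EFin \o (f \_ (A `*` B))) x))%:E)).
    by move=> x /set_mem Ax; rewrite /fubini_F /= sec.
  apply/integrableP; split.
    apply/measurable_EFinP; apply: measurable_funS (measurableT) (@subsetT _ _) _.
    by apply: measurableT_comp => //; exact: measurable_int h2.
  have /integrableP[_] := h3; apply: le_lt_trans; apply: ge0_le_integral => //.
  - apply: measurableT_comp => //; apply/measurable_EFinP.
    apply: measurable_funS (measurableT) (@subsetT _ _) _.
    by apply: measurableT_comp => //; exact: measurable_int h2.
  - apply: measurableT_comp => //.
    apply: measurable_funS (measurableT) (@subsetT _ _) _; exact: measurable_int h2.
  - by move=> x _; case: (fubini_F _ _ x) => [r| |] //=; rewrite ?lee_fin ?normr0 ?leey.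
split => //.
rewrite /Rintegral -[LHS]/(fine _); congr fine.
transitivity (\int[m12]_z (EFin \o (f \_ (A `*` B))) z)%E.
  rewrite [LHS]integral_mkcond; apply: eq_integral => z _ /=.
  by rewrite !patchE; case: ifP.
rewrite -(integral12_prod_meas1 fi).
transitivity (\int[m1]_(x in A) fubini_F m2 (EFin \o (f \_ (A `*` B))) x)%E.
  rewrite [RHS]integral_mkcond; apply: eq_integral => x _.
  rewrite patchE; case: ifPn => // /negP; rewrite inE => nAx.
  by rewrite /fubini_F; apply: integral0_eq => y _ /=; rewrite restrX0.
apply: ae_eq_integral => //.
- exact: measurable_int h3.
- exact: measurable_int fin0.
Qed.

Lemma integrable_fubini_G_ (f : T1 * T2 -> \bar R) : m12.-integrable setT f ->
  m2.-integrable setT (fubini_G m1 f).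
Proof.
move=> fi; have mf := measurable_int _ fi.
apply/integrableP; split; first exact: (measurable_fubini_G fi).
have h := (integrable21ltyP m1 m2 mf).1 fi; apply: le_lt_trans h.
apply: ge0_le_integral => //.
- by apply: measurableT_comp => //; exact: (measurable_fubini_G fi).
- apply: (@measurable_fun_fubini_tonelli_G _ _ _ _ _ m1 (abse \o f)) => //=.
  exact: measurableT_comp.
- move=> y _; apply: le_abse_integral => //.
  by apply: (measurableT_comp mf); exact: measurable_pair2.
Qed.

Lemma fubini_rectangle2 f : m12.-integrable (A `*` B) (EFin \o f) ->
  [/\ {ae m2, forall y, B y -> m1.-integrable A (EFin \o (fun x => f (x, y)))},
      m2.-integrable B (EFin \o (fun y => \int[m1]_(x in A) f (x, y))) &
      \int[m12]_(z in A `*` B) f z = \int[m2]_(y in B) \int[m1]_(x in A) f (x, y)].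
Proof.
move=> /restr_integrable fi.
have sec y : B y -> (\int[m1]_x ((f \_ (A `*` B)) (x, y))%:E)%E =
    (\int[m1]_(x in A) (f (x, y))%:E)%E.
  move=> By; rewrite [RHS]integral_mkcond; apply: eq_integral => x _.
  exact: restrY.
have h1 := ae_integrable2 fi.
have aei : {ae m2, forall y, B y -> m1.-integrable A (EFin \o (fun x => f (x, y)))}.
  apply: ae_mono h1 => y H By; apply/(integrable_mkcond _ mA).
  by apply: eq_integrable H => // x _ /=; rewrite restrY.
have h2 := integrable_fubini_G_ fi.
have GE : {ae m2, forall y, B y -> fubini_G m1 (EFin \o (f \_ (A `*` B))) y =
    (\int[m1]_(x in A) f (x, y))%:E}.
  apply: ae_mono aei => y H By; rewrite /fubini_G /= sec // /Rintegral fineK //.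
  by have := integrable_fin_num mA (H By).
have h3 : m2.-integrable B (fubini_G m1 (EFin \o (f \_ (A `*` B)))) by exact: integrableS h2.
have fin0 : m2.-integrable B (EFin \o (fun y => \int[m1]_(x in A) f (x, y))).
  apply: (eq_integrable mB (fun y => (fine (fubini_G m1 (EFin \o (f \_ (A `*` B))) y))%:E)).
    by move=> y /set_mem By; rewrite /fubini_G /= sec.
  apply/integrableP; split.
    apply/measurable_EFinP; apply: measurable_funS (measurableT) (@subsetT _ _) _.
    by apply: measurableT_comp => //; exact: measurable_int h2.
  have /integrableP[_] := h3; apply: le_lt_trans; apply: ge0_le_integral => //.
  - apply: measurableT_comp => //; apply/measurable_EFinP.
    apply: measurable_funS (measurableT) (@subsetT _ _) _.
    by apply: measurableT_comp => //; exact: measurable_int h2.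
  - apply: measurableT_comp => //.
    apply: measurable_funS (measurableT) (@subsetT _ _) _; exact: measurable_int h2.
  - by move=> x _; case: (fubini_G _ _ x) => [r| |] //=; rewrite ?lee_fin ?normr0 ?leey.
split => //.
rewrite /Rintegral -[LHS]/(fine _); congr fine.
transitivity (\int[m12]_z (EFin \o (f \_ (A `*` B))) z)%E.
  rewrite [LHS]integral_mkcond; apply: eq_integral => z _ /=.
  by rewrite !patchE; case: ifP.
rewrite -(integral21_prod_meas1 fi).
transitivity (\int[m2]_(y in B) fubini_G m1 (EFin \o (f \_ (A `*` B))) y)%E.
  rewrite [RHS]integral_mkcond; apply: eq_integral => y _.
  rewrite patchE; case: ifPn => // /negP; rewrite inE => nBy.
  by rewrite /fubini_G; apply: integral0_eq => x _ /=; rewrite restrY0.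
apply: ae_eq_integral => //.
- exact: measurable_int h3.
- exact: measurable_int fin0.
Qed.

End product_almost_everywhere.

Section translation.
Context {R : realType}.
Notation mu := (@lebesgue_measure R).

Lemma lebesgue_measure_shift (h : R) (A : set (measurableTypeR R)) : measurable A ->
  mu [set t | A (t - h)] = mu A.
Proof.
move=> mA; pose sh (t : measurableTypeR R) : measurableTypeR R := t - h.
have msh : measurable_fun setT sh.
  by apply: measurable_funB => //; exact: measurable_cst.
pose nu := pushforward mu sh.
have -> : mu [set t | A (t - h)] = nu A by [].
apply/esym; apply: lebesgue_measure_unique => //= _ [[x y]] _ <- /=.
rewrite /nu /pushforward (_ : sh @^-1` _ = `]x + h, y + h]%classic); last first.
  by apply/seteqP; split => t; rewrite /sh /= !in_itv /= ltrBrDr lerBlDr.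
rewrite !lebesgue_measure_itv /= !lte_fin ltrD2r; case: ifP => // _.
by congr EFin; ring.
Qed.

(** Translations are needed to compare a function of time at [t] and [t - h]. *)
Lemma ge0_integral_shift (h : R) (f : R -> \bar R) : measurable_fun setT f ->
  (forall t, 0 <= f t)%E -> (\int[mu]_t f (t - h)%R = \int[mu]_t f t)%E.
Proof.
move=> mf f0; pose sh (t : measurableTypeR R) : measurableTypeR R := t - h.
have msh : measurable_fun setT sh.
  by apply: measurable_funB => //; exact: measurable_cst.
have := @ge0_integral_pushforward _ _ _ _ R sh msh mu setT f measurableT mf.
rewrite preimage_setT => <- //; apply: eq_measure_integral => A mA _.
exact: lebesgue_measure_shift.
Qed.

Lemma ae_shift (h : R) (P : R -> Prop) : {ae mu, forall t, P t} ->
  {ae mu, forall t, P (t - h)}.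
Proof.
move=> [N [mN N0 PN]]; exists [set t | N (t - h)]; split.
- have msh : measurable_fun setT (fun t : measurableTypeR R => (t - h : measurableTypeR R)).
    by apply: measurable_funB => //; exact: measurable_cst.
  by have := msh measurableT N mN; rewrite setTI.
- by rewrite -N0; exact: lebesgue_measure_shift.
- by move=> t /= Pt; exact: PN.
Qed.

End translation.

(** * Pairing with a time derivative *)

Section weak_limit.
Context d1 d2 (T1 : measurableType d1) (T2 : measurableType d2) (R : realType).
Variables (m1 : {sigma_finite_measure set T1 -> \bar R})
          (m2 : {sigma_finite_measure set T2 -> \bar R}).
Variables (A : set T1) (B : set T2).
Hypotheses (mA : measurable A) (mB : measurable B).
Local Notation m12 := (m1 \x m2)%E.
Local Notation D := (A `*` B).

(** A sequence bounded in [L^2] by the norm of its almost everywhere limit [V]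
    and pairing nonnegatively with [Z] has a limit with the same property: apply
    Fatou's lemma to the squares of [Z - Vn]. *)
Lemma fatou_pairing (Z V : T1 * T2 -> R) (Vn : nat -> T1 * T2 -> R) :
  square_integrable m12 D Z -> square_integrable m12 D V ->
  (forall n, square_integrable m12 D (Vn n)) ->
  (forall n, \int[m12]_(z in D) Vn n z ^+ 2 <= \int[m12]_(z in D) V z ^+ 2) ->
  (forall n, 0 <= \int[m12]_(z in D) (Z z * Vn n z)) ->
  {ae m2, forall y, {ae m1, forall x, A x -> B y ->
    Vn n (x, y) @[n --> \oo] --> V (x, y)}} ->
  0 <= \int[m12]_(z in D) (Z z * V z).
Proof.
move=> LZ LV LVn nV nZ cv; have mD : measurable D := measurable_rectangle mA mB.
pose f n z := ((Z z - Vn n z) ^+ 2)%:E : \bar R.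
pose g z := ((Z z - V z) ^+ 2)%:E : \bar R.
have mf n : measurable_fun D (f n).
  by apply/measurable_EFinP; apply: measurable_funX; apply: measurable_funB;
    [exact: L2_measurable LZ|exact: L2_measurable (LVn n)].
have mg : measurable_fun D g.
  by apply/measurable_EFinP; apply: measurable_funX; apply: measurable_funB;
    [exact: L2_measurable LZ|exact: L2_measurable LV].
have mlim : measurable_fun D (fun z => limn_einf (f^~ z)).
  apply: measurableT_comp => //; apply: measurable_fun_limn_esup => n.
  exact: measurableT_comp.
have eqg : {ae m12, forall z, D z -> limn_einf (f^~ z) = g z}.
  have mE : measurable ((~` D) `|` (D `&` [set z | limn_einf (f^~ z) = g z])).
    apply: measurableU; first exact: measurableC.
    exact: measurable_eqe.
  have : {ae m12, forall z, ((~` D) `|` (D `&` [set z | limn_einf (f^~ z) = g z])) z}.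
    apply: ae_of_ysection mE _; apply: ae_mono cv => y; apply: ae_mono => x H.
    have [[Ax By]|nD] := pselect (D (x, y)); last by left.
    right; split => //=; have {}H := H Ax By.
    suff cvf : f n (x, y) @[n --> \oo] --> g (x, y).
      by rewrite is_cvg_limn_einfE; [exact/cvg_lim|apply/cvg_ex; eexists; exact: cvf].
    apply: cvg_EFin; first by near=> n.
    rewrite [X in X @ _ --> _](_ : _ = (fun n => (Z (x, y) - Vn n (x, y)) * (Z (x, y) - Vn n (x, y)))); last first.
      by apply/funext => n /=; rewrite expr2.
    rewrite /g /= expr2; apply: cvgM; apply: cvgB => //; exact: cvg_cst.
  by apply: ae_mono => z [//|[_ H] _].
have f0 n z : D z -> (0 <= f n z)%E by move=> _; rewrite lee_fin sqr_ge0.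
have := fatou m12 mD mf f0.
have -> : (\int[m12]_(z in D) limn_einf (f^~ z) = \int[m12]_(z in D) g z)%E.
  exact: ae_eq_integral.
have sqrE (U : T1 * T2 -> R) : square_integrable m12 D U ->
    (\int[m12]_(z in D) ((Z z - U z) ^+ 2)%:E)%E =
    (\int[m12]_(z in D) Z z ^+ 2 + \int[m12]_(z in D) U z ^+ 2
      - 2 * \int[m12]_(z in D) (Z z * U z))%:E.
  move=> LU; have iZ := L2_sqr LZ; have iU := L2_sqr LU; have iZU := L2M mD LZ LU.
  rewrite -RintegralZl // -RintegralD // -RintegralB //;
    [|exact: (L1D mD iZ iU)|exact: (L1Z mD _ iZU)].
  rewrite /Rintegral fineK; last first.
    by have := integrable_fin_num mD (L1B mD (L1D mD iZ iU) (L1Z mD 2 iZU)).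
  by apply: eq_integral => z _; congr EFin; ring.
rewrite sqrE // => h.
have {}h := le_trans h (_ : (_ <= (\int[m12]_(z in D) Z z ^+ 2 + \int[m12]_(z in D) V z ^+ 2)%:E)%E).
have hb n : ((\int[m12]_(z in D) f n z)%E <= (\int[m12]_(z in D) Z z ^+ 2 + \int[m12]_(z in D) V z ^+ 2)%:E)%E.
  rewrite /f sqrE // lee_fin.
  by have := nV n; have := nZ n;
   move: (Rintegral _ _ _) (Rintegral _ _ _) (Rintegral _ _ _) (Rintegral _ _ _) => ? ? ? ?; lra.
have {}h : ((\int[m12]_(z in D) Z z ^+ 2 + \int[m12]_(z in D) V z ^+ 2
      - 2 * \int[m12]_(z in D) (Z z * V z))%:E <=
      (\int[m12]_(z in D) Z z ^+ 2 + \int[m12]_(z in D) V z ^+ 2)%:E)%E.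
  apply: h.
  rewrite limn_einf_lim; apply: lime_le; first exact: is_cvg_einfs.
  near=> n; apply: le_trans (hb n); apply: ereal_inf_lbound; exists n => //=.
move: h; rewrite lee_fin.
by move: (Rintegral _ _ _) (Rintegral _ _ _) (Rintegral _ _ _) => ? ? ?; lra.
Unshelve. all: by end_near. Qed.

End weak_limit.

Section steklov.
Context {R : realType}.
Notation mu := (@lebesgue_measure R).
Variables (T h : R) (v : R -> R).
Hypothesis h0 : 0 < h.
Local Notation DT := (`]0, T[%classic : set (measurableTypeR R)).
Hypothesis Lv : square_integrable mu DT v.

Let w t := if 0 < t < T then \int[mu]_(z in `]0, t[) v z else 0.

Let mDT : measurable DT. Proof. exact: measurable_itv. Qed.

Lemma L2_L1_itv : mu.-integrable DT (EFin \o v).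
Proof. by have := L2_L1 mDT (lebesgue_measure_oo_fin 0 T) Lv. Qed.

Let k (z : plane R) : \bar R :=
  (((z.1 - h < z.2) && (z.2 < z.1))%:R * (v \_ DT) z.2 ^+ 2)%:E.

Let mv : measurable_fun setT (v \_ DT).
Proof. by apply/(measurable_restrictT _ mDT); exact: L2_measurable Lv. Qed.

Let mk : measurable_fun setT k.
Proof.
apply/measurable_EFinP; apply: measurable_funM; last first.
  apply: measurable_funX; apply: (measurableT_comp mv); exact: measurable_snd.
have mb : measurable_fun setT (fun z : plane R =>
    (z.1 - h < z.2) && (z.2 < z.1)).
  apply: measurable_and.
    apply: measurable_fun_ltr; last exact: measurable_snd.
    by apply: measurable_funB; [exact: measurable_fst|exact: measurable_cst].
  by apply: measurable_fun_ltr; [exact: measurable_snd|exact: measurable_fst].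
exact: (measurableT_comp (f := fun b : bool => (b%:R : R))).
Qed.

Let k0 z : (0 <= k z)%E. Proof. by rewrite lee_fin mulr_ge0 ?ler0n ?sqr_ge0. Qed.

Let increment t : 0 < t < T ->
  (((w t - w (t - h)) ^+ 2)%:E <= h%:E * \int[mu]_s k (t, s))%E.
Proof.
move=> /andP[t0 tT]; pose c := Num.max 0 (t - h).
have ct : c < t by rewrite gt_max t0 ltrBlDr ltrDl.
have c0 : 0 <= c by rewrite le_max lexx.
have sub : `]c, t[ `<=` DT.
  by move=> z /=; rewrite !in_itv /= => /andP[/(le_lt_trans c0) -> /lt_trans ->].
have mct : measurable (`]c, t[%classic : set (measurableTypeR R)) by exact: measurable_itv.
have wE : w t - w (t - h) = \int[mu]_(z in `]c, t[) v z.
  rewrite /w t0 tT /c; have [th|th] /= := leP (t - h) 0.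
    by rewrite subr0.
  rewrite ifT; last by rewrite ltrBlDr (lt_trans tT) // ltrDl.
  have i1 : mu.-integrable `]0, t[ (EFin \o v).
    apply: integrableS L2_L1_itv => //.
    by move=> z /=; rewrite !in_itv /= => /andP[-> /lt_trans]; exact.
  have i2 : mu.-integrable `]0, t - h[ (EFin \o v).
    apply: integrableS i1 => //.
    move=> z /=; rewrite !in_itv /= => /andP[-> /lt_trans]; apply.
    by rewrite ltrBlDr ltrDl.
  rewrite (Rintegral_itv_bndo_bndc i2) Rintegral_itvB // bnd_simp; first exact: ltW.
  by rewrite ltrBlDr ltrDl.
have Lct : square_integrable mu (`]c, t[%classic : set (measurableTypeR R)) v.
  apply/L2P; split; first exact: measurable_funS mDT sub (L2_measurable Lv).
  exact: integrableS mDT mct sub (L2_sqr Lv).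
rewrite wE; apply: le_trans (_ : ((t - c) * \int[mu]_(z in `]c, t[) v z ^+ 2)%:E <= _)%E.
  by rewrite lee_fin cauchy_schwarz_cst.
rewrite EFinM; apply: lee_pmul => //.
- by rewrite lee_fin subr_ge0 ltW.
- by rewrite lee_fin Rintegral_ge0 // => z _; exact: sqr_ge0.
- by rewrite lee_fin lerBlDr -lerBlDl le_max lexx orbT.
rewrite /Rintegral fineK; last first.
  by apply: integrable_fin_num => //; exact: L2_sqr Lct.
rewrite integral_mkcond; apply: ge0_le_integral => //.
- move=> s _; rewrite patchE; case: ifP => // _; rewrite lee_fin sqr_ge0 //.
- by apply/(measurable_restrictT _ mct); apply/measurable_EFinP; exact: L1_measurable (L2_sqr Lct).
- by apply: (measurableT_comp mk); exact: measurable_pair1.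
move=> s _; rewrite patchE; case: ifPn => [|_]; last exact: k0.
rewrite inE /= in_itv /= => /andP[cs st]; rewrite lee_fin.
have -> : (t - h < s) && (s < t).
  by rewrite st andbT (le_lt_trans _ cs) // le_max lexx orbT.
by rewrite mul1r patchE mem_set // /= in_itv /= (le_lt_trans c0 cs) (lt_trans st).
Qed.

(** By Cauchy-Schwarz the squared increment is at most [h] times the integral of
    [v^2] over [(t - h, t)]; exchanging the integrals, each point is counted for
    times [t] forming an interval of length [h]. *)
Lemma steklov_bound : measurable_fun DT (fun t => (w t - w (t - h)) ^+ 2) ->
  (\int[mu]_(t in DT) ((w t - w (t - h)) ^+ 2)%:E <=
   (h ^+ 2 * \int[mu]_(t in DT) v t ^+ 2)%:E)%E.
Proof.
move=> mw.
have mF : measurable_fun setT (fun t => \int[mu]_s k (t, s))%E.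
  exact: (@measurable_fun_fubini_tonelli_F _ _ _ _ _ mu k).
have F0 t : (0 <= \int[mu]_s k (t, s))%E by apply: integral_ge0.
apply: (@le_trans _ _ (\int[mu]_(t in DT) (h%:E * \int[mu]_s k (t, s)))%E).
  apply: ge0_le_integral => //.
  - by move=> t _; rewrite lee_fin sqr_ge0.
  - exact/measurable_EFinP.
  - apply: emeasurable_funM; first exact: measurable_cst.
    exact: measurable_funS measurableT (@subsetT _ _) mF.
rewrite ge0_integralZl //; last 2 first.
- exact: measurable_funS measurableT (@subsetT _ _) mF.
- by rewrite lee_fin ltW.
rewrite expr2 -mulrA EFinM lee_pmul2l //.
apply: (@le_trans _ _ (\int[mu]_t \int[mu]_s k (t, s))%E).
  by apply: ge0_subset_integral.
rewrite (@fubini_tonelli _ _ _ _ _ mu mu k mk k0).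
rewrite /Rintegral EFinM fineK; last first.
  by apply: integrable_fin_num => //; exact: L2_sqr Lv.
rewrite -ge0_integralZl //; last 3 first.
- by apply/measurable_EFinP; exact: L1_measurable (L2_sqr Lv).
- by move=> s _; rewrite lee_fin sqr_ge0.
- by rewrite lee_fin ltW.
rewrite [leRHS]integral_mkcond.
rewrite le_eqVlt; apply/orP; left; apply/eqP; apply: eq_integral => s _.
have -> : (fun t => k (t, s)) =
    (fun t => ((v \_ DT) s ^+ 2)%:E * (\1_(`]s, s + h[) t)%:E)%E.
  apply/funext => t; rewrite /k /= -EFinM mulrC indicE; congr (_ * _)%:E.
  have -> // : (t \in `]s, s + h[%classic) = (t - h < s) && (s < t).
  by apply/idP/idP => [/set_mem|H]; [|apply/mem_set; move: H];
    rewrite /= in_itv /= ltrBlDr andbC.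
rewrite ge0_integralZl //; last 2 first.
- exact/measurable_EFinP/measurable_indic.
- by rewrite lee_fin sqr_ge0.
rewrite integral_indic ?setIT //= lebesgue_measure_itv /= lte_fin ltrDl h0.
rewrite -EFinB addrC addKr -EFinM patchE; case: ifP => [sD|sD]; rewrite patchE sD.
  by rewrite mulrC EFinM.
by rewrite expr0n mul0r.
Qed.

End steklov.

Section primitive_on_a_line.
Context {R : realType}.
Notation mu := (@lebesgue_measure R).
Variables (T y0 : R) (v : R -> R).
Local Notation DT := (`]0, T[%classic : set (measurableTypeR R)).
Hypothesis Lv : square_integrable mu DT v.

Let w t := y0 + \int[mu]_(z in `]0, t[) v z.

Let mDT : measurable DT. Proof. exact: measurable_itv. Qed.

Let ix : mu.-integrable DT (EFin \o v). Proof. exact: L2_L1_itv. Qed.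

Let igr : mu.-integrable setT (EFin \o (v \_ DT)).
Proof.
rewrite (_ : EFin \o _ = (EFin \o v) \_ DT); first exact/(integrable_mkcond _ mDT).
by apply/funext => z /=; rewrite !patchE; case: ifP.
Qed.

Lemma primitive_increment t1 t2 : 0 < t1 -> t1 <= t2 -> t2 < T ->
  w t2 - w t1 = \int[mu]_(z in `[t1, t2]) (v \_ DT) z.
Proof.
move=> t10 t12 t2T; rewrite /w.
have i2 : mu.-integrable `]0, t2[ (EFin \o v).
  apply: integrableS ix => //.
  by move=> z /=; rewrite !in_itv /= => /andP[-> /lt_trans]; exact.
have i1 : mu.-integrable `]0, t1[ (EFin \o v).
  apply: integrableS i2 => //.
  by move=> z /=; rewrite !in_itv /= => /andP[-> /lt_le_trans]; exact.
rewrite opprD addrACA subrr add0r.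
move: t12; rewrite le_eqVlt => /predU1P[->|t12].
  by rewrite subrr set_itv1 Rintegral_set1.
rewrite (Rintegral_itv_bndo_bndc i1) Rintegral_itvB // ?bnd_simp //; last exact: ltW.
rewrite Rintegral_itv_cc_oo; last exact: integrableS igr.
apply: eq_Rintegral => z; rewrite inE /= in_itv /= => /andP[xz zy].
by rewrite patchE mem_set //= in_itv /= (lt_trans t10 xz) (lt_trans zy t2T).
Qed.

Lemma primitive_ac d e : 0 < d -> d < e -> e < T -> abs_continuous d e w.
Proof.
move=> d0 de eT; apply: (integral_abs_continuous igr) => y z dy yz ze.
by apply: primitive_increment => //; [exact: lt_le_trans dy|exact: le_lt_trans eT].
Qed.

Lemma primitive_derive :
  {ae mu, forall t : R, 0 < t < T -> is_derive t 1 w (v t)}.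
Proof.
have fl : locally_integrable setT (v \_ DT).
  by apply: open_integrable_locally => //; exact: openT.
have := @FTC1 R (v \_ DT) (BLeft 0) _ fl.
have igS y : mu.-integrable [set` Interval (BLeft 0) (BRight y)] (EFin \o (v \_ DT)).
  exact: integrableS igr.
move=> /(_ igS); apply: ae_mono => t H /andP[t0 tT].
have [|dF F'] := H; first by rewrite ?bnd_simp /= ?ltW.
apply: (@near_eq_is_derive R R R (fun y : R => y0 + \int[mu]_(t in [set` Interval (BLeft 0) (BRight y)]) (v \_ DT) t) w t 1 (v t)).
  near=> y.
  have yp : 0 < y by near: y; exact: lt_nbhsr.
  have yT : y < T by near: y; exact: lt_nbhsl.
  rewrite /w; congr (_ + _); rewrite Rintegral_itv_cc_oo //.
  apply: eq_Rintegral => z; rewrite inE /= in_itv /= => /andP[xz zy].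
  by rewrite patchE mem_set //= in_itv /= xz (lt_trans zy yT).
apply: is_derive_eq (is_derive1D (is_derive1_cst t (y0)) (derivableP dF)) _.
by rewrite add0r -derive1E F' patchE mem_set //= in_itv /= t0.
Unshelve. all: by end_near. Qed.

Lemma primitive_bounded :
  exists2 B, 0 <= B & forall t, 0 < t < T -> `|w t| <= B.
Proof.
exists (`|y0| + \int[mu]_(z in DT) `|v z|).
  by rewrite addr_ge0 // Rintegral_ge0.
move=> t /andP[t0 tT]; apply: le_trans (ler_normD _ _) _; rewrite lerD2l.
have sub : `]0, t[ `<=` DT.
  by move=> z /=; rewrite !in_itv /= => /andP[-> /lt_trans]; exact.
have mt : measurable (`]0, t[%classic : set (measurableTypeR R)) by exact: measurable_itv.
have i1 : mu.-integrable `]0, t[ (EFin \o v) by exact: integrableS ix.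
apply: le_trans (le_normr_Rintegral _ i1) _ => //.
rewrite /Rintegral; apply: fine_le.
- by have := integrable_fin_num mt (integrable_abse i1).
- by have := integrable_fin_num mDT (integrable_abse ix).
apply: ge0_subset_integral => //.
apply/measurable_EFinP; apply: measurableT_comp => //; exact: L1_measurable ix.
Qed.

End primitive_on_a_line.

Section energy.
Context {R : realType} (T : R).
Notation mu := (@lebesgue_measure R).
Notation mu2 := (mu \x mu)%E.
Local Notation DT := (`]0, T[%classic : set (measurableTypeR R)).
Local Notation I01 := (`]0, 1[%classic : set (measurableTypeR R)).

Lemma QT_rectangle : QT T = (DT `*` I01) :> set (plane R).
Proof. by apply/seteqP; split => -[t x]; rewrite /QT /= !in_itv. Qed.

Let mDT : measurable DT. Proof. exact: measurable_itv. Qed.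
Let mI : measurable I01. Proof. exact: measurable_itv. Qed.

Lemma measurable_QT : measurable (QT T : set (plane R)).
Proof. by rewrite QT_rectangle; exact: measurableX. Qed.

Lemma measurable_xsec (g : plane R -> R) x :
  measurable_fun (QT T) g -> 0 < x < 1 -> measurable_fun DT (fun t => g (t, x)).
Proof.
move=> mg x01; apply: (measurable_comp measurable_QT _ mg); last first.
  apply: measurable_funS measurableT (@subsetT _ _) _; exact: measurable_pair2.
by move=> _ [t + <-]; rewrite /QT /= in_itv.
Qed.

Lemma measurable_tsec (g : plane R -> R) t :
  measurable_fun (QT T) g -> 0 < t < T -> measurable_fun I01 (fun x => g (t, x)).
Proof.
move=> mg tT; apply: (measurable_comp measurable_QT _ mg); last first.
  apply: measurable_funS measurableT (@subsetT _ _) _; exact: measurable_pair1.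
by move=> _ [x + <-]; rewrite /QT /= in_itv.
Qed.

Lemma L2_Q_xsec (V : R -> R -> R) : L2_Q T V ->
  {ae mu, forall x, 0 < x < 1 -> square_integrable mu DT (V^~ x)}.
Proof.
move=> LV; have := L2_sqr LV; rewrite QT_rectangle => /(fubini_rectangle2 mDT mI)[H _ _].
apply: ae_mono H => x H x01; apply/L2P; split.
  exact: measurable_xsec (L2_measurable LV) x01.
by have := H _; rewrite /= in_itv /=; exact.
Qed.

Lemma L2_Q_tsec (V : R -> R -> R) : L2_Q T V ->
  {ae mu, forall t, 0 < t < T -> L2_01 (V t)}.
Proof.
move=> LV; have := L2_sqr LV; rewrite QT_rectangle => /(fubini_rectangle1 mDT mI)[H _ _].
apply: ae_mono H => t H tT; apply/L2P; split.
  exact: measurable_tsec (L2_measurable LV) tT.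
by have := H _; rewrite /= in_itv /=; exact.
Qed.

Lemma backward_quotient_cvg (v w : R -> R) : square_integrable mu DT v ->
  (forall t, 0 < t < T -> w t = \int[mu]_(z in `]0, t[) v z) ->
  {ae mu, forall t, 0 < t < T ->
    n.+1%:R * (w t - w (t - n.+1%:R^-1)) @[n --> \oo] --> v t}.
Proof.
move=> Lv wE; apply: ae_mono (primitive_derive 0 Lv) => t dF /andP[t0 tT].
have dw : is_derive (t : R) (1 : R) w (v t).
  have t01 : 0 < t < T by rewrite t0.
  apply: (near_eq_is_derive _ (dF t01)); near=> y.
  have y0 : 0 < y by near: y; exact: lt_nbhsr.
  have yT : y < T by near: y; exact: lt_nbhsl.
  by rewrite wE ?y0 // add0r.
have [ex val] := dw; rewrite -val.
have : (fun h => h^-1 *: ((w \o shift t) (h *: 1) - w t)) @ 0^' --> 'D_1 w t by exact: ex.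
move=> /cvgr_dnbhsP /(_ (fun n => - n.+1%:R^-1)) H2.
have {}H2 : (fun n => (- n.+1%:R^-1)^-1 *: ((w \o shift t) ((- n.+1%:R^-1) *: 1) - w t)) @ \oo --> 'D_1 w t.
  apply: H2; split; first by move=> n; rewrite oppr_eq0 invr_eq0 pnatr_eq0.
  rewrite -oppr0; apply: cvgN; exact: cvg_harmonic.
apply: cvg_trans H2; apply: near_eq_cvg; near=> n.
have E : - n.+1%:R^-1 + t = t - n.+1%:R^-1 :> R by rewrite addrC.
by rewrite /= /GRing.scale /= mulr1 E invrN invrK; ring.
Unshelve. all: by end_near. Qed.

(** [W] is the time primitive of [V] extended by 0, [Z] a subgradient and [E] an
    energy, which satisfy the convexity inequality for each time step. *)
Variables (W V Z : R -> R -> R) (E : R -> R).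
Hypothesis mW : measurable_fun (QT T) (fun z : plane R => W z.1 z.2).
Hypotheses (LV : L2_Q T V) (LZ : L2_Q T Z).
Hypothesis W0 : forall t x, ~~ (0 < t < T) -> W t x = 0.
Hypothesis WV : {ae mu, forall x, 0 < x < 1 -> forall t, 0 < t < T ->
  W t x = \int[mu]_(z in `]0, t[) V z x}.
Hypothesis iE : mu.-integrable DT (EFin \o E).
Hypotheses (E_ge0 : forall t, 0 <= E t) (E0 : forall t, ~~ (0 < t < T) -> E t = 0).
Hypothesis energyW : forall h, 0 < h -> {ae mu, forall t, 0 < t < T ->
  E t - E (t - h) <= \int[mu]_(x in I01) (Z t x * (W t x - W (t - h) x))}.

Lemma measurable_shifted h :
  measurable_fun (QT T) (fun z : plane R => W (z.1 - h) z.2).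
Proof.
pose Wr := (fun z : plane R => W z.1 z.2) \_ (QT T).
have mWr : measurable_fun setT Wr by apply/(measurable_restrictT _ measurable_QT).
pose sh (z : plane R) :
  plane R := (z.1 - h, z.2).
have msh : measurable_fun setT sh.
  apply: measurable_fun_pair; last exact: measurable_snd.
  by apply: measurable_funB; [exact: measurable_fst|exact: measurable_cst].
apply: (eq_measurable_fun (Wr \o sh)); last first.
  by apply: measurable_funS measurableT (@subsetT _ _) _; exact: measurableT_comp.
move=> [t x] /set_mem [_ x01] /=; rewrite /Wr patchE; case: ifPn => // /negP.
rewrite inE /QT /= => nQ; rewrite W0 //; apply/negP => tT; apply: nQ; split => //.
Qed.

Let mshift h : measurable_fun (QT T) (fun z : plane R =>
  (W z.1 z.2 - W (z.1 - h) z.2) ^+ 2).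
Proof. by apply: measurable_funX; apply: measurable_funB mW (measurable_shifted h). Qed.

Lemma ge0_tonelli_QT (f : plane R -> R) :
  measurable_fun (QT T) f -> (forall z, 0 <= f z) ->
  (\int[mu2]_(z in QT T) (f z)%:E = \int[mu]_(x in I01) \int[mu]_(t in DT) (f (t, x))%:E)%E.
Proof.
move=> mf f0; pose fr := f \_ (QT T).
have mfr : measurable_fun setT (EFin \o fr).
  by apply/measurable_EFinP; apply/(measurable_restrictT _ measurable_QT).
have fr0 z : (0 <= (EFin \o fr) z)%E by rewrite /fr /= patchE; case: ifP; rewrite lee_fin.
transitivity (\int[mu2]_z (EFin \o fr) z)%E.
  by rewrite [LHS]integral_mkcond; apply: eq_integral => z _ /=; rewrite /fr !patchE; case: ifP.
rewrite (@fubini_tonelli2 _ _ _ _ _ mu mu _ mfr fr0) [RHS]integral_mkcond.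
apply: eq_integral => x _; rewrite patchE /fubini_G; case: ifPn => [|/negP] ; rewrite inE /= in_itv /= => x01.
  rewrite [RHS]integral_mkcond; apply: eq_integral => t _ /=; rewrite /fr !patchE.
  have -> : ((t, x) \in QT T) = (t \in DT).
    by apply/idP/idP => /set_mem; rewrite /QT /= ?in_itv /= => H; apply/mem_set;
      rewrite /= ?in_itv //=; case: H.
  by case: ifP.
apply: integral0_eq => t _ /=; rewrite /fr patchE; case: ifP => // /set_mem [_ /=].
by move=> ?; exfalso; apply: x01.
Qed.

Lemma shift_bound h : 0 < h ->
  (\int[mu2]_(z in QT T) ((W z.1 z.2 - W (z.1 - h) z.2) ^+ 2)%:E <=
   (h ^+ 2 * \int[mu2]_(z in QT T) V z.1 z.2 ^+ 2)%:E)%E.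
Proof.
move=> h0; rewrite ge0_tonelli_QT //; last by move=> z; exact: sqr_ge0.
have V2 := L2_sqr LV; have V2' := V2; rewrite QT_rectangle in V2'.
have [_ iV EV] := fubini_rectangle2 mDT mI V2'.
rewrite QT_rectangle EV.
apply: (@le_trans _ _ (\int[mu]_(x in I01) (h ^+ 2 * \int[mu]_(t in DT) V t x ^+ 2)%:E)%E).
  apply: ae_ge0_le_integral => //.
  - by move=> x _; apply: integral_ge0 => t _; rewrite lee_fin sqr_ge0.
  - pose fr := (fun z : plane R =>
      (W z.1 z.2 - W (z.1 - h) z.2) ^+ 2) \_ (QT T).
    have mfr : measurable_fun setT (EFin \o fr).
      by apply/measurable_EFinP; apply/(measurable_restrictT _ measurable_QT); exact: mshift.
    have fr0 z : (0 <= (EFin \o fr) z)%E.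
      by rewrite /fr /= patchE; case: ifP; rewrite lee_fin // sqr_ge0.
    apply: (eq_measurable_fun (fubini_G mu (EFin \o fr))); last first.
      apply: measurable_funS measurableT (@subsetT _ _) _.
      exact: measurable_fun_fubini_tonelli_G.
    move=> x /set_mem; rewrite /= in_itv /= => x01.
    rewrite /fubini_G [RHS]integral_mkcond; apply: eq_integral => t _ /=; rewrite /fr !patchE.
    have -> : ((t, x) \in QT T) = (t \in DT).
      by apply/idP/idP => /set_mem; rewrite /QT /= ?in_itv /= => H; apply/mem_set;
        rewrite /= ?in_itv //=; case: H.
    by case: ifP.
  - by move=> x _; rewrite lee_fin mulr_ge0 ?sqr_ge0 // Rintegral_ge0 // => t _; exact: sqr_ge0.
  - apply/measurable_EFinP; apply: measurable_funM; first exact: measurable_cst.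
    exact: L1_measurable iV.
  apply: ae_mono (ae_and WV (L2_Q_xsec LV)) => x [H1 H2] /=; rewrite in_itv /= => x01.
  have wE t : W t x = if 0 < t < T then \int[mu]_(z in `]0, t[) V z x else 0.
    by case: ifPn => tT; [exact: H1|exact: W0].
  have := steklov_bound h0 (H2 x01).
  under eq_integral do rewrite -!wE; apply.
  apply: (eq_measurable_fun (fun t => (W t x - W (t - h) x) ^+ 2)).
    by move=> t _; rewrite !wE.
  exact: (measurable_xsec (mshift h) x01).
rewrite le_eqVlt; apply/orP; left; apply/eqP.
rewrite -RintegralZl // /Rintegral fineK //.
by have := integrable_fin_num mI (L1Z mI (h ^+ 2) iV).
Qed.

(** Nonnegativity of [int Z W_t], obtained from the inequality for backward
    differences by letting the step tend to 0. *)
Lemma energy_pairing : 0 <= \int[mu2]_(z in QT T) (Z z.1 z.2 * V z.1 z.2).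
Proof.
pose Vn n (z : plane R) :=
  n.+1%:R * (W z.1 z.2 - W (z.1 - n.+1%:R^-1) z.2).
have h0 n : 0 < n.+1%:R^-1 :> R by rewrite invr_gt0.
have V2 := L2_sqr LV.
have Vn2 n : (\int[mu2]_(z in QT T) (Vn n z ^+ 2)%:E <= (\int[mu2]_(z in QT T) V z.1 z.2 ^+ 2)%:E)%E.
  have -> : (\int[mu2]_(z in QT T) (Vn n z ^+ 2)%:E = (n.+1%:R ^+ 2)%:E *
      \int[mu2]_(z in QT T) ((W z.1 z.2 - W (z.1 - n.+1%:R^-1) z.2) ^+ 2)%:E)%E.
    rewrite -ge0_integralZl_EFin //.
    - by apply: eq_integral => z _; rewrite /Vn exprMn EFinM.
    - exact: measurable_QT.
    - by move=> z _; rewrite lee_fin sqr_ge0.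
    - by apply/measurable_EFinP; exact: mshift.
  apply: le_trans (lee_wpmul2l _ (shift_bound (h0 n))) _.
    by rewrite lee_fin sqr_ge0.
  by rewrite -EFinM lee_fin mulrA -exprMn mulfV ?pnatr_eq0 // expr1n mul1r.
have LVn n : square_integrable mu2 (QT T) (Vn n).
  split; last by apply: le_lt_trans (Vn2 n) (ltry _).
  apply: measurable_funM; first exact: measurable_cst.
  exact: measurable_funB mW (measurable_shifted _).
have mQ := measurable_QT.
rewrite QT_rectangle.
apply: (@fatou_pairing _ _ _ _ R mu mu DT I01 mDT mI (fun z => Z z.1 z.2) (fun z => V z.1 z.2) Vn).
- by rewrite -QT_rectangle.
- by rewrite -QT_rectangle.
- by move=> n; rewrite -QT_rectangle.
- move=> n; rewrite -QT_rectangle -lee_fin; apply: le_trans (Vn2 n).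
  rewrite /Rintegral fineK //.
  by have := integrable_fin_num mQ (L2_sqr (LVn n)).
- move=> n; have ZV := L2M mQ LZ (LVn n); rewrite QT_rectangle in ZV.
  have [_ i1 ->] := fubini_rectangle1 mDT mI ZV.
  pose F t := n.+1%:R * (E t - E (t - n.+1%:R^-1)).
  have mEr : measurable_fun setT (EFin \o (E \_ DT)).
    apply/measurable_EFinP; apply/(measurable_restrictT _ mDT).
    exact: L1_measurable iE.
  have ErE : E \_ DT = E.
    apply/funext => t; rewrite patchE; case: ifPn => // /negP; rewrite inE /= in_itv /= => tT.
    by rewrite E0 //; apply/negP.
  rewrite ErE in mEr.
  have E0' t : (0 <= (EFin \o E) t)%E by rewrite lee_fin.
  (* Extended by 0, E and its translate have the same integral, so the
     integral over (0, T) of E t - E (t - h) is nonnegative. *)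
  have shE := ge0_integral_shift n.+1%:R^-1 mEr E0'.
  have EDT : (\int[mu]_t (EFin \o E) t = \int[mu]_(t in DT) (E t)%:E)%E.
    rewrite [RHS]integral_mkcond; apply: eq_integral => t _ /=.
    by rewrite -[in LHS]ErE !patchE; case: ifP.
  have mEs : measurable_fun DT (fun t => E (t - n.+1%:R^-1)).
    apply: measurable_funS measurableT (@subsetT _ _) _.
    apply: measurableT_comp; first exact/measurable_EFinP.
    by apply: measurable_funB => //; exact: measurable_cst.
  have les : (\int[mu]_(t in DT) (E (t - n.+1%:R^-1))%:E <= \int[mu]_(t in DT) (E t)%:E)%E.
    rewrite -EDT -shE; apply: ge0_subset_integral => //.
      apply: (measurableT_comp (g := fun t : measurableTypeR R => t - n.+1%:R^-1) mEr).
      by apply: measurable_funB => //; exact: measurable_cst.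
    by move=> t _; rewrite lee_fin.
  have iEs : mu.-integrable DT (EFin \o (fun t => E (t - n.+1%:R^-1))).
    apply/integrableP; split; first exact/measurable_EFinP.
    under eq_integral do rewrite /= ger0_norm //.
    apply: (le_lt_trans (les)); have /integrableP[_] := iE.
    by under eq_integral do rewrite /= ger0_norm //.
  have iF : mu.-integrable DT (EFin \o F) by exact: (L1Z mDT _ (L1B mDT iE iEs)).
  apply: (@le_trans _ _ (\int[mu]_(t in DT) F t)).
    rewrite /F RintegralZl //; last exact: (L1B mDT iE iEs).
    rewrite mulr_ge0 // RintegralB // subr_ge0 /Rintegral; apply: fine_le => //.
    + by have := integrable_fin_num mDT iEs.
    + by have := integrable_fin_num mDT iE.
  apply: ae_le_Rintegral => //.
  have aet : {ae mu, forall t, 0 < t < T -> mu.-integrable I01 (EFin \o (fun x => Z t x * (W t x - W (t - n.+1%:R^-1) x)))}.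
    have [h1 _ _] := fubini_rectangle1 mDT mI ZV.
    apply: ae_mono h1 => t H tT.
    have := H _; rewrite /= in_itv /= => /(_ tT) /(L1Z mI n.+1%:R^-1).
    apply: eq_L1 => x _ _.
    by rewrite /Vn /= mulrCA mulKf ?pnatr_eq0.
  apply: ae_mono (ae_and aet (energyW (h0 n))) => t [H1 H2] /=; rewrite in_itv /= => tT.
  have -> : \int[mu]_(y in I01) (Z t y * Vn n (t, y)) =
      n.+1%:R * \int[mu]_(x in I01) (Z t x * (W t x - W (t - n.+1%:R^-1) x)).
    rewrite -RintegralZl //; last exact: H1.
    by apply: eq_Rintegral => x _; rewrite /Vn /= mulrCA.
  by rewrite ler_wpM2l // H2.
apply: ae_mono (ae_and WV (L2_Q_xsec LV)) => x [H1 H2].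
have [x01|nx] := boolP (0 < x < 1); last first.
  by apply: aeW => t _; rewrite /= in_itv /= => x01; rewrite x01 in nx.
apply: ae_mono (backward_quotient_cvg (H2 x01) (H1 x01)) => t Ht.
by rewrite /= !in_itv /= => tT _; exact: Ht.
Qed.

End energy.

(** * Singular weights in time *)

Section more_closure.
Context {R : realType}.
Implicit Types (f : R -> R) (a b : R).

Lemma abs_continuousV a b f m : a <= b -> 0 < m ->
  (forall x, a <= x <= b -> m <= f x) -> abs_continuous a b f ->
  abs_continuous a b (fun x => (f x)^-1).
Proof.
move=> ab m0 Hm acf; apply: (abs_continuous_dominated _ acf (k := m^-1 ^+ 2)).
  exact: sqr_ge0.
move=> x y ax xy yb; have fx := Hm x _; have fy := Hm y _.
have {}fx : m <= f x by apply: fx; rewrite ax (le_trans xy).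
have {}fy : m <= f y by apply: fy; rewrite yb (le_trans ax).
have fx0 := lt_le_trans m0 fx; have fy0 := lt_le_trans m0 fy.
have -> : (f y)^-1 - (f x)^-1 = - ((f y)^-1 * (f x)^-1 * (f y - f x)).
  by field; rewrite !gt_eqF.
rewrite normrN normrM ler_wpM2r // ger0_norm; last first.
  by rewrite mulr_ge0 // invr_ge0 ltW.
by rewrite expr2 ler_pM // ?invr_ge0 ?(ltW fx0) ?(ltW fy0) // lef_pV2.
Qed.

Lemma abs_continuous_exp a b f : a <= b -> abs_continuous a b f ->
  abs_continuous a b (fun x => expR (f x)).
Proof.
move=> ab acf; have [M M0 HM] := abs_continuous_bounded ab acf.
apply: (abs_continuous_dominated _ acf (k := expR M)); first exact: expR_ge0.
move=> x y ax xy yb; apply: expR_lipschitz; apply: HM.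
  by rewrite ax (le_trans xy).
by rewrite yb (le_trans ax).
Qed.

Lemma abs_continuousX a b f n : a <= b -> abs_continuous a b f ->
  abs_continuous a b (fun x => f x ^+ n).
Proof.
move=> ab acf; elim: n => [|n ih].
  exact: (eq_abs_continuous _ (abs_continuous_cst a b 1)).
apply: (eq_abs_continuous _ (abs_continuousM ab acf ih)) => x _.
by rewrite exprS.
Qed.

Lemma abs_continuousZ a b k f : a <= b -> abs_continuous a b f ->
  abs_continuous a b (fun x => k * f x).
Proof.
by move=> ab acf; exact: (abs_continuousM ab (abs_continuous_cst a b k) acf).
Qed.

Lemma is_derive1X f x l n : is_derive (x : R) (1 : R) f l ->
  is_derive x 1 (fun y => f y ^+ n) (n%:R * f x ^+ n.-1 * l).
Proof.
move=> df; elim: n => [|n ih].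
  by apply: is_derive_eq (is_derive1_cst x 1) _; rewrite !mul0r.
have -> : (fun y => f y ^+ n.+1) = (fun y => f y * f y ^+ n).
  by apply/funext => y; rewrite exprS.
apply: is_derive_eq (is_derive1M df ih) _; case: n {ih} => [|n] /=.
  by rewrite expr0 !mul0r mulr0 addr0 !mul1r mulr1.
by rewrite exprS -[n.+2%:R]natr1; ring.
Qed.

End more_closure.

Section time_weight.
Context {R : realType} (T : R).
Hypothesis T0 : 0 < T.

(** [theta] is the fourth power of [tau], so that all weights are integer powers of
    one function with [tau' = - (T - 2 t) tau^2]. *)
Definition tau (t : R) := (t * (T - t))^-1.

Lemma tau_gt0 t : 0 < t < T -> 0 < tau t.
Proof. by move=> /andP[t0 tT]; rewrite invr_gt0 mulr_gt0 // subr_gt0. Qed.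

Lemma thetaE t : theta T t = tau t ^+ 4.
Proof. by rewrite /theta /tau -exprMn exprVn. Qed.

Lemma tau_ge t : 0 < t < T -> 4 / T ^+ 2 <= tau t.
Proof.
move=> tT; have t0 := tau_gt0 tT; move: t0; rewrite /tau => t0.
rewrite ler_pdivrMr ?exprn_gt0 //.
have p0 : 0 < t * (T - t) by rewrite -invr_gt0.
rewrite mulrC ler_pdivlMr //.
by have := sqr_ge0 (T - 2 * t); lra.
Qed.

Lemma tau_derive t : 0 < t < T ->
  is_derive t (1 : R) tau (- (T - 2 * t) * tau t ^+ 2).
Proof.
move=> tT; have t0 := tau_gt0 tT.
have p0 : t * (T - t) != 0 by rewrite gt_eqF // -invr_gt0.
have d1 : is_derive t (1 : R) (fun t => t * (T - t)) (1 * (T - t) + t * (0 + - 1)).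
  by apply: is_derive1M (is_derive1_id t) (is_derive1D (is_derive1_cst t T) (is_derive1N (is_derive1_id t))).
have d2 := @is_derive1V R (fun t : R => t * (T - t)) t _ p0 d1; rewrite /tau; apply: (is_derive_eq d2).
by rewrite exprVn; ring.
Qed.

Lemma tau_ac d e : 0 < d -> d < e -> e < T -> abs_continuous d e tau.
Proof.
move=> d0 de eT; apply: (@abs_continuousV R d e _ (d * (T - e)) (ltW de)).
- by rewrite mulr_gt0 // subr_gt0.
- move=> x /andP[dx xe]; apply: ler_pM => //; [exact: ltW| |]; rewrite ?subr_ge0 ?lerD2l ?lerN2 //.
  exact: ltW.
- apply: (abs_continuousM (ltW de)); first exact: id_ac.
  apply: abs_continuousD; first exact: abs_continuous_cst.
  apply: (abs_continuous_dominated ler01 (abs_continuous_id d e)) => x y _ _ _ /=.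
  by rewrite mul1r -opprD normrN.
Qed.

(** Powers of [tau] are negligible against [exp (- eps tau^5 + b tau^4)]. *)
Lemma flat_bound (eps b : R) (k : nat) : 0 < eps -> 0 <= b ->
  exists2 C, 0 < C & forall z, 0 < z ->
    z ^+ k * expR (- eps * z ^+ 5 + b * z ^+ 4) <= C.
Proof.
move=> e0 b0; (* Beyond M the fifth power dominates with a margin z^4. *)
pose M := (b + 1) / eps + 1.
have M0 : 0 < M by rewrite ltr_wpDl // divr_ge0 ?(ltW e0) // addr_ge0.
have bnd z : 0 < z -> - eps * z ^+ 5 + b * z ^+ 4 <= - z + (b * M ^+ 4 + M).
  move=> z0; have [Mz|zM] := leP M z; last first.
    have h1 : z ^+ 4 <= M ^+ 4 by rewrite ler_pXn2r ?nnegrE ?ltW.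
    have h2 : b * z ^+ 4 <= b * M ^+ 4 by rewrite ler_wpM2l.
    have h3 : 0 <= eps * z ^+ 5 by rewrite mulr_ge0 ?exprn_ge0 // ltW.
    by rewrite mulNr; lra.
  have z1 : 1 <= z by apply: le_trans Mz; rewrite /M lerDr divr_ge0 ?(ltW e0) // addr_ge0.
  have h1 : (b + 1) * z ^+ 4 <= eps * z ^+ 5.
    rewrite (exprS z 4) (mulrA eps) ler_wpM2r ?exprn_ge0 ?(ltW z0) //.
    rewrite mulrC -ler_pdivrMr //; apply: le_trans Mz; rewrite /M lerDl //.
  have h2 : z <= z ^+ 4 by rewrite exprS ler_peMr ?(ltW z0) ?exprn_ege1.
  have h3 : 0 <= b * M ^+ 4 by rewrite mulr_ge0 // exprn_ge0 // ltW.
  by rewrite mulNr; lra.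
have pow z : 0 < z -> z ^+ k <= k.+1%:R ^+ k * expR z.
  move=> z0; have h : z / k.+1%:R <= expR (z / k.+1%:R).
    by apply: le_trans (expR_ge1Dx _); rewrite lerDr.
  rewrite -ler_pdivrMl ?exprn_gt0 // mulrC -exprVn -exprMn.
  apply: (@le_trans _ _ (expR (z / k.+1%:R) ^+ k)).
    by apply: lerXn2r; rewrite ?nnegrE ?expR_ge0 ?divr_ge0 ?(ltW z0).
  rewrite -expRM_natl ler_expR; rewrite -[leRHS]mulr1 mulrCA ler_wpM2l ?(ltW z0) //.
  by rewrite ler_pdivrMr // mul1r ler_nat.
exists (k.+1%:R ^+ k * expR (b * M ^+ 4 + M)).
  by rewrite mulr_gt0 ?exprn_gt0 // expR_gt0.
move=> z z0; apply: (@le_trans _ _ (k.+1%:R ^+ k * expR z * expR (- z + (b * M ^+ 4 + M)))).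
  apply: ler_pM; [by rewrite exprn_ge0 ?(ltW z0)|exact: expR_ge0|exact: pow|].
  by rewrite ler_expR bnd.
by rewrite -mulrA -expRD addrA subrr add0r.
Qed.

End time_weight.

Section time_primitive.
Context {R : realType} (T : R).
Notation mu := (@lebesgue_measure R).
Local Notation DT := (`]0, T[%classic : set (measurableTypeR R)).
Local Notation I01 := (`]0, 1[%classic : set (measurableTypeR R)).
Variables (u0 : R -> R) (ut : R -> R -> R).
Hypotheses (Lu0 : L2_01 u0) (Lut : L2_Q T ut).

(** The representative of the solution that is absolutely continuous in time
    for almost every position. *)
Definition primitive t x := u0 x + \int[mu]_(z in `]0, t[) ut z x.

Let mDT : measurable DT. Proof. exact: measurable_itv. Qed.

Let utr (z : plane R) := ((fun z => ut z.1 z.2) \_ (QT T)) z.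

Let mutr : measurable_fun setT utr.
Proof. by apply/(measurable_restrictT _ (measurable_QT T)); exact: L2_measurable Lut. Qed.

(** [primitive] is a parametric integral of this function of three variables over a
    fixed domain, so Fubini gives its measurability. *)
Let phi3 (y : plane R * measurableTypeR R) : R :=
  ((y.2 : R) < (y.1.1 : R))%R%:R * utr (y.2, y.1.2).

Let mphi : measurable_fun setT phi3.
Proof.
have m1 : measurable_fun setT (fun y : plane R * measurableTypeR R => y.1.1).
  exact: (measurableT_comp measurable_fst measurable_fst).
have m2 : measurable_fun setT (fun y : plane R * measurableTypeR R => y.1.2).
  exact: (measurableT_comp measurable_snd measurable_fst).
have m3 : measurable_fun setT (fun y : plane R * measurableTypeR R => y.2).
  exact: measurable_snd.
apply: measurable_funM.
  have mb : measurable_fun setT (fun y : plane R * measurableTypeR R => ((y.2 : R) < (y.1.1 : R))%R).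
    exact: measurable_fun_ltr.
  exact: (measurableT_comp (f := fun b : bool => (b%:R : R))).
by apply: (measurableT_comp mutr); exact: measurable_fun_pair.
Qed.

Lemma primitive_measurable :
  measurable_fun (QT T) (fun z : plane R => primitive z.1 z.2).
Proof.
apply: measurable_funD.
  apply: (measurable_comp (F := I01) (measurable_itv _) _ (L2_measurable Lu0)).
    by move=> _ [[t x] [_ x01] <-]; rewrite /= in_itv.
  by apply: measurable_funS measurableT (@subsetT _ _) _; exact: measurable_snd.
have mphi' : measurable_fun setT (EFin \o phi3) by apply/measurable_EFinP.
have mP := @measurable_fun_fubini_tonelli_F _ _ _ _ _ mu _
  (measurable_funepos mphi') (fun y => funepos_ge0 _ y).
have mN := @measurable_fun_fubini_tonelli_F _ _ _ _ _ mu _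
  (measurable_funeneg mphi') (fun y => funeneg_ge0 _ y).
have mPN := emeasurable_funB mP mN.
apply: (eq_measurable_fun (fun z => fine (fubini_F mu (EFin \o phi3)^\+ z - fubini_F mu (EFin \o phi3)^\- z)%E)).
  move=> [t x] /set_mem[/= /andP[t0 tT] x01].
  rewrite /Rintegral; congr fine; rewrite [in RHS]integral_mkcond [RHS]integralE.
  have E z : (EFin \o phi3) ((t, x), z) = ((EFin \o ut^~ x) \_ (`]0, t[ : set (measurableTypeR R))) z.
    rewrite /phi3 /utr /= !patchE mem_setE in_itv /=.
    have [zt|_] := boolP ((z : R) < t)%R; last by rewrite andbF mul0r.
    rewrite mul1r andbT; case: ifPn => [/set_mem[/= /andP[-> //]]|/negP H].
    case: ifPn => // z0; exfalso; apply: H; apply/mem_set; split => //=.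
    by rewrite z0 (lt_trans zt).
  congr (_ - _)%E; apply: eq_integral => z _; rewrite /fubini_F.
    by rewrite !funeposE E.
  by rewrite !funenegE E.
apply: measurableT_comp => //.
by apply: measurable_funS measurableT (@subsetT _ _) mPN.
Qed.

End time_primitive.

(** * The pointwise estimate *)

Section pointwise_estimate.
Context {R : realType}.
Implicit Types x y A B : R.

Local Ltac nonneg := rewrite /=; repeat first
  [ assumption | by apply: ltW | exact: ler0n | exact: ler01 | apply: sqr_ge0 | apply: exprn_ge0
  | apply: mulr_ge0 | apply: addr_ge0 | rewrite invr_ge0 ].

Lemma le_of_eq x y : x = y -> x <= y.
Proof. by move=> ->. Qed.

Lemma ler_normM x y A B : `|x| <= A -> `|y| <= B -> `|x * y| <= A * B.
Proof. by move=> xA yB; rewrite normrM ler_pM. Qed.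

Lemma sqr_sum2 x y : (x + y) ^+ 2 <= 2 * x ^+ 2 + 2 * y ^+ 2.
Proof. by have := sqr_ge0 (x - y); lra. Qed.

Lemma sqr_sum3 x y z : (x + y + z) ^+ 2 <= 3 * x ^+ 2 + 3 * y ^+ 2 + 3 * z ^+ 2.
Proof.
have := sqr_ge0 (x - y); have := sqr_ge0 (x - z); have := sqr_ge0 (y - z); lra.
Qed.

(** [k2] stands for [2 - K]; [M], [r1] and [Mc] bound [psi], [x^2/a] and the zero
    order coefficient; [tau0] is a lower bound of [tau]. *)
Variables (T lam k2 M r1 Mc C1 tau0 : R).
Hypotheses (T0 : 0 < T) (lam0 : 0 < lam) (k20 : 0 < k2) (M0 : 0 <= M)
  (r10 : 0 <= r1) (C10 : 0 <= C1) (tau00 : 0 < tau0).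

(** [m0] is the coercivity constant, [B2] and [B3] bound the lower order terms, [B4]
    the passage from [P], [Q] to the derivatives of the solution, and [del] is the
    parameter of the Hardy-Poincare inequality. *)
Let m0 := Num.min 1 (Num.min (lam * k2) (lam ^+ 3 * k2)).
Let B2 := (8 / tau0 + 20 * T ^+ 2) * M + 3 * Mc ^+ 2 / tau0 ^+ 6.
Let B3 := 16 * lam ^+ 2 * T / tau0 ^+ 3 + 75 * C1.
Let b1 := 3 / tau0 ^+ 4.
Let b2 := 72 * lam ^+ 2 * r1 + 2.
Let b3 := 75 * C1 / tau0 ^+ 4 + 2 * lam ^+ 2 + 1.
Let b4 := 18 * lam ^+ 2 / tau0 ^+ 2 + 144 * T ^+ 2 * M ^+ 2.
Let b5 := 75 / tau0 ^+ 4.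
Let B4 := b1 + b2 + b3 + b4 + b5.

Let del := m0 / (2 * (B2 + 1)).

Section at_a_point.
Variables (s eps tau l psi rho w g wt mw fz v Eu : R).
Hypotheses (s1 : 1 <= s) (eps01 : 0 <= eps <= 1) (tauge : tau0 <= tau)
  (lT : `|l| <= T) (psiM : `|psi| <= M) (rhor : rho ^+ 2 <= r1)
  (vle : v ^+ 2 <= Mc ^+ 2 * w ^+ 2) (Eu0 : 0 <= Eu).
Let r := rho ^+ 2.
Hypothesis epsE : (l * tau ^+ 6 * w) ^+ 2 <= C1 * (tau ^+ 12 * r * w ^+ 2) + Eu.

Let mu := s * tau ^+ 4.
Let nu := - 4 * s * l * tau ^+ 5.
Let ka := 5 * eps * l * tau ^+ 6 + nu * psi.
Let q := nu * psi + mu ^+ 2 * lam ^+ 2 * r.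
Let qt := s * (8 * tau ^+ 5 + 20 * l ^+ 2 * tau ^+ 6) * psi
  - 8 * s ^+ 2 * lam ^+ 2 * l * tau ^+ 9 * r.
Let P := - mw - q * w.
Let Rr := 2 * mu * lam * (rho * g) + mu * lam * w.
Let Q := wt + Rr.
(** [X] and [Y] are the terms that the square of [P + Q] controls; [J] is of lower
    order in [s] but is not controlled by [Y] near [x = 0]. *)
Let X := s * tau ^+ 4 * g ^+ 2.
Let Y := s ^+ 3 * tau ^+ 12 * r * w ^+ 2.
Let J := s * tau ^+ 6 * w ^+ 2.
Let D := - 2 * (- mw * wt) + (qt * w ^+ 2 + 2 * q * (w * wt))
  - 2 * (P * Rr - mu * lam * (k2 * g ^+ 2)
         - mu * lam * ((nu * lam + mu ^+ 2 * lam ^+ 2 * k2) * (r * w ^+ 2))).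
Hypothesis eqF : P + Q = fz - v + 5 * eps * (l * tau ^+ 6 * w).

Let tau_pos : 0 < tau. Proof. exact: lt_le_trans tauge. Qed.
Let s0 : 0 < s. Proof. exact: lt_le_trans s1. Qed.
Let r0 : 0 <= r. Proof. exact: sqr_ge0. Qed.
Let X0 : 0 <= X. Proof. by nonneg. Qed.
Let Y0 : 0 <= Y. Proof. by nonneg. Qed.
Let J0 : 0 <= J. Proof. by nonneg. Qed.

Let tauX i j : tau ^+ i <= tau ^+ (i + j) / tau0 ^+ j.
Proof.
rewrite ler_pdivlMr ?exprn_gt0 // exprD ler_wpM2l ?exprn_ge0 ?(ltW tau_pos) //.
by rewrite lerXn2r ?nnegrE ?(ltW tau_pos) ?(ltW tau00).
Qed.

Let sX i j : s ^+ i <= s ^+ (i + j).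
Proof. by rewrite exprD ler_peMr ?exprn_ge0 ?(ltW s0) ?exprn_ege1. Qed.

Let l2 : l ^+ 2 <= T ^+ 2.
Proof. by rewrite -[l ^+ 2]real_normK ?num_real // lerXn2r ?nnegrE ?(ltW T0). Qed.

Let psi2 : psi ^+ 2 <= M ^+ 2.
Proof. by rewrite -[psi ^+ 2]real_normK ?num_real // lerXn2r ?nnegrE. Qed.

Let tauY : tau ^+ 12 * r * w ^+ 2 <= Y / s.
Proof.
rewrite ler_pdivlMr // (_ : Y = s ^+ 3 * (tau ^+ 12 * r * w ^+ 2)); last by rewrite /Y; ring.
rewrite mulrC; apply: ler_wpM2r; first by nonneg.
by have := sX 1 2; rewrite expr1.
Qed.

(** Each of these terms has one power of [s] less than [X] and [Y], or is [J]. *)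
Let lower_order : `|qt * w ^+ 2 + 2 * mu * lam * (nu * lam * (r * w ^+ 2))| <=
  (8 / tau0 + 20 * T ^+ 2) * M * J + 16 * lam ^+ 2 * T / tau0 ^+ 3 * (Y / s).
Proof.
have -> : qt * w ^+ 2 + 2 * mu * lam * (nu * lam * (r * w ^+ 2)) =
  (8 * tau ^+ 5 + 20 * l ^+ 2 * tau ^+ 6) * psi * (s * w ^+ 2) -
  16 * lam ^+ 2 * l * tau ^+ 9 * (s ^+ 2 * r * w ^+ 2).
  by rewrite /qt /mu /nu; ring.
apply: le_trans (ler_normB _ _) _; apply: lerD.
  have -> : (8 / tau0 + 20 * T ^+ 2) * M * J =
    (8 / tau0 + 20 * T ^+ 2) * tau ^+ 6 * M * (s * w ^+ 2) by rewrite /J; ring.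
  apply: ler_normM; last by rewrite ger0_norm; nonneg.
  apply: ler_normM => //; rewrite ger0_norm; last first.
    by nonneg.
  rewrite [leRHS]mulrDl; apply: lerD.
    have := tauX 5 1; rewrite expr1 => h.
    have := ler_wpM2l (ler0n R 8) h; rewrite [leRHS](_ : _ = 8 / tau0 * tau ^+ 6) //.
    by ring.
  by apply: ler_wpM2r; [nonneg|apply: ler_wpM2l].
have -> : 16 * lam ^+ 2 * T / tau0 ^+ 3 * (Y / s) =
    16 * lam ^+ 2 * T * (tau ^+ 12 / tau0 ^+ 3) * (s ^+ 2 * r * w ^+ 2).
  by rewrite /Y; field; rewrite !gt_eqF.
apply: ler_normM; last first.
  by rewrite ger0_norm; nonneg.
apply: ler_normM; last by rewrite ger0_norm ?exprn_ge0 ?(ltW tau_pos) // (tauX 9 3).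
apply: ler_normM => //.
by rewrite ger0_norm; nonneg.
Qed.

Let residual : (P + Q) ^+ 2 <= 3 * fz ^+ 2 + 3 * Mc ^+ 2 / tau0 ^+ 6 * J
  + 75 * C1 * (Y / s) + 75 * (eps ^+ 2 * Eu).
Proof.
rewrite eqF; apply: le_trans (sqr_sum3 _ _ _) _; rewrite sqrrN -!addrA lerD2l.
apply: lerD.
  have h : w ^+ 2 <= J / tau0 ^+ 6.
    rewrite /J; have h1 := tauX 0 6; have h2 := sX 0 1; rewrite !expr0 add0n expr1 in h1 h2.
    rewrite mulrAC -[leLHS]mul1r ler_wpM2r ?sqr_ge0 // -mulrA -[1]mul1r.
    by apply: ler_pM.
  apply: (@le_trans _ _ (3 * (Mc ^+ 2 * (J / tau0 ^+ 6)))).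
    by rewrite ler_wpM2l // (le_trans vle) // ler_wpM2l // sqr_ge0.
  by apply: le_of_eq; ring.
have e2 : eps ^+ 2 <= 1.
  by have /andP[e0 e1] := eps01; rewrite expr_le1.
have -> : 3 * (5 * eps * (l * tau ^+ 6 * w)) ^+ 2 = 75 * (eps ^+ 2 * (l * tau ^+ 6 * w) ^+ 2) by ring.
rewrite -(mulrA 75) -mulrDr ler_wpM2l //.
apply: le_trans (ler_wpM2l (sqr_ge0 eps) epsE) _; rewrite mulrDr lerD2r.
apply: (@le_trans _ _ (1 * (C1 * (tau ^+ 12 * r * w ^+ 2)))).
  by rewrite ler_wpM2r; nonneg.
by rewrite mul1r ler_wpM2l.
Qed.

(** Expansion of the square of [P + Q]: the double product is [- D] up to the
    terms with a sign. *)
Let coercive : B3 <= s * (lam ^+ 3 * k2) ->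
  P ^+ 2 + Q ^+ 2 + m0 * (X + Y) <= D + 3 * fz ^+ 2 + 75 * (eps ^+ 2 * Eu) + B2 * J.
Proof.
move=> sB.
have id : P ^+ 2 + Q ^+ 2 + 2 * (lam * k2) * X + 2 * (lam ^+ 3 * k2) * Y
   + (qt * w ^+ 2 + 2 * mu * lam * (nu * lam * (r * w ^+ 2))) = (P + Q) ^+ 2 + D.
  by rewrite /D /Q /P /X /Y /mu; ring.
have lo := lower_order; have re := residual.
rewrite ler_norml in lo; have /andP[{}lo _] := lo.
have BY : B3 * (Y / s) <= lam ^+ 3 * k2 * Y.
  rewrite mulrCA (mulrC _ Y) ler_wpM2l //.
  by rewrite ler_pdivrMr // mulrC.
have mX : m0 * X <= lam * k2 * X.
  by rewrite ler_wpM2r // /m0 !ge_min lexx orbT.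
have mY : m0 * Y <= lam ^+ 3 * k2 * Y.
  by rewrite ler_wpM2r // /m0 !ge_min lexx !orbT.
have X2 : 0 <= lam * k2 * X by nonneg.
rewrite /B3 mulrDl in BY; rewrite mulrDr /B2 mulrDl.
by move: id lo re BY mX mY X2; rewrite -!mulrA;
  move: (P ^+ 2) (Q ^+ 2) ((P + Q) ^+ 2) => ? ? ?; lra.
Qed.

Let Nn := mu^-1 * ((wt - ka * w) ^+ 2 + (mw - Rr + mu ^+ 2 * lam ^+ 2 * r * w) ^+ 2)
  + mu * (g - mu * lam * rho * w) ^+ 2 + s ^+ 3 * tau ^+ 12 * r * w ^+ 2.

Let mu0 : 0 < mu. Proof. by rewrite mulr_gt0 // exprn_gt0. Qed.

Let muV : mu^-1 <= (tau0 ^+ 4)^-1.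
Proof.
rewrite lef_pV2 ?posrE ?exprn_gt0 // /mu -[leLHS]mul1r ler_pM ?exprn_ge0 ?(ltW tau00) //.
by rewrite lerXn2r ?nnegrE ?(ltW tau_pos) ?(ltW tau00).
Qed.

Let RrB : mu^-1 * Rr ^+ 2 <= 8 * lam ^+ 2 * r1 * X + 2 * lam ^+ 2 / tau0 ^+ 2 * J.
Proof.
have h : mu^-1 * Rr ^+ 2 <= 8 * lam ^+ 2 * r * X + 2 * lam ^+ 2 * (s * tau ^+ 4 * w ^+ 2).
  apply: le_trans (ler_wpM2l _ (sqr_sum2 _ _)) _; first by rewrite invr_ge0 ltW.
  have -> // : mu^-1 * (2 * (2 * mu * lam * (rho * g)) ^+ 2 + 2 * (mu * lam * w) ^+ 2) =
    8 * lam ^+ 2 * r * X + 2 * lam ^+ 2 * (s * tau ^+ 4 * w ^+ 2).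
  by rewrite /X /r /mu; field; rewrite !gt_eqF // exprn_gt0.
apply: (le_trans h); apply: lerD.
  by rewrite ler_wpM2r // ler_wpM2l // mulr_ge0 ?sqr_ge0.
have -> : 2 * lam ^+ 2 / tau0 ^+ 2 * J = 2 * lam ^+ 2 * (s * (tau ^+ 6 / tau0 ^+ 2) * w ^+ 2).
  by rewrite /J; ring.
apply: ler_wpM2l; first by nonneg.
apply: ler_wpM2r; first by nonneg.
by apply: ler_wpM2l; [nonneg|exact: (tauX 4 2)].
Qed.

Let nuB : mu^-1 * (nu * psi * w) ^+ 2 <= 16 * T ^+ 2 * M ^+ 2 * J.
Proof.
have -> : mu^-1 * (nu * psi * w) ^+ 2 = 16 * l ^+ 2 * psi ^+ 2 * J.
  by rewrite /nu /J /mu; field; rewrite !gt_eqF.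
apply: ler_wpM2r => //; apply: ler_pM => //; [by nonneg|by nonneg|].
by apply: ler_wpM2l.
Qed.

Let epsB : mu^-1 * (5 * eps * (l * tau ^+ 6 * w)) ^+ 2 <=
  25 * C1 / tau0 ^+ 4 * Y + 25 / tau0 ^+ 4 * (eps ^+ 2 * Eu).
Proof.
have e2 : eps ^+ 2 <= 1.
  by have /andP[e0 e1] := eps01; rewrite expr_le1.
have -> : (5 * eps * (l * tau ^+ 6 * w)) ^+ 2 = 25 * (eps ^+ 2 * (l * tau ^+ 6 * w) ^+ 2) by ring.
have h : eps ^+ 2 * (l * tau ^+ 6 * w) ^+ 2 <= C1 * Y + eps ^+ 2 * Eu.
  apply: le_trans (ler_wpM2l (sqr_ge0 eps) epsE) _; rewrite mulrDr lerD2r.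
  apply: (@le_trans _ _ (1 * (C1 * (tau ^+ 12 * r * w ^+ 2)))).
    by rewrite ler_wpM2r; nonneg.
  rewrite mul1r ler_wpM2l // (le_trans tauY) // ler_pdivrMr // ler_peMr //.
have h0 : 0 <= C1 * Y + eps ^+ 2 * Eu by rewrite addr_ge0 // mulr_ge0 // sqr_ge0.
apply: (@le_trans _ _ ((tau0 ^+ 4)^-1 * (25 * (C1 * Y + eps ^+ 2 * Eu)))).
  by apply: ler_pM => //; [nonneg|nonneg|apply: ler_wpM2l].
by apply: le_of_eq; field; rewrite gt_eqF.
Qed.

Let upper : Nn <= B4 * (P ^+ 2 + Q ^+ 2 + X + Y + J + eps ^+ 2 * Eu).
Proof.
have e1 : wt - ka * w = Q + (- Rr - nu * psi * w) + (- (5 * eps * (l * tau ^+ 6 * w))).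
  by rewrite /Q /ka; ring.
have e2 : mw - Rr + mu ^+ 2 * lam ^+ 2 * r * w = - P + (- Rr) + (- (nu * psi * w)).
  by rewrite /P /q; ring.
have h1 : (wt - ka * w) ^+ 2 <= 3 * Q ^+ 2 + 6 * Rr ^+ 2 + 6 * (nu * psi * w) ^+ 2
    + 3 * (5 * eps * (l * tau ^+ 6 * w)) ^+ 2.
  rewrite e1; apply: le_trans (sqr_sum3 _ _ _) _.
  by have := sqr_sum2 (- Rr) (- (nu * psi * w)); rewrite !sqrrN;
    move: (_ ^+ 2) (_ ^+ 2) (_ ^+ 2) (_ ^+ 2) (_ ^+ 2) => ? ? ? ? ?; lra.
have h2 : (mw - Rr + mu ^+ 2 * lam ^+ 2 * r * w) ^+ 2 <=
    3 * P ^+ 2 + 3 * Rr ^+ 2 + 3 * (nu * psi * w) ^+ 2.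
  by rewrite e2; apply: le_trans (sqr_sum3 _ _ _) _; rewrite !sqrrN.
have h3 : mu * (g - mu * lam * rho * w) ^+ 2 <= 2 * X + 2 * lam ^+ 2 * Y.
  apply: le_trans (ler_wpM2l (ltW mu0) (sqr_sum2 _ _)) _.
  by apply: le_of_eq; rewrite /X /Y /mu /r; ring.
have h4 : mu^-1 * ((wt - ka * w) ^+ 2 + (mw - Rr + mu ^+ 2 * lam ^+ 2 * r * w) ^+ 2)
   <= mu^-1 * (3 * Q ^+ 2 + 3 * P ^+ 2) + 9 * (mu^-1 * Rr ^+ 2)
     + 9 * (mu^-1 * (nu * psi * w) ^+ 2)
     + 3 * (mu^-1 * (5 * eps * (l * tau ^+ 6 * w)) ^+ 2).
  have mV : 0 <= mu^-1 by rewrite invr_ge0 ltW.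
  move: (mu^-1) mV h1 h2 => m mV.
  move: (_ ^+ 2) ((mw - _ + _) ^+ 2) (P ^+ 2) (Q ^+ 2) (Rr ^+ 2) ((nu * _ * w) ^+ 2)
    ((5 * _ * _) ^+ 2) => x1 x2 x3 x4 x5 x6 x7 h1 h2.
  by have := ler_wpM2l mV (lerD h1 h2); lra.
have h5 : mu^-1 * (3 * Q ^+ 2 + 3 * P ^+ 2) <= 3 / tau0 ^+ 4 * (P ^+ 2 + Q ^+ 2).
  have -> : 3 / tau0 ^+ 4 * (P ^+ 2 + Q ^+ 2) = (tau0 ^+ 4)^-1 * (3 * Q ^+ 2 + 3 * P ^+ 2) by ring.
  by rewrite ler_wpM2r // addr_ge0 // mulr_ge0 // sqr_ge0.
have := RrB; have := nuB; have := epsB.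
have P0 := sqr_ge0 P; have Q0 := sqr_ge0 Q.
have E0 : 0 <= eps ^+ 2 * Eu by rewrite mulr_ge0 // sqr_ge0.
have n1 : 0 <= b1 by nonneg.
have n2 : 0 <= b2 by nonneg.
have n3 : 0 <= b3 by nonneg.
have n4 : 0 <= b4 by rewrite /b4; nonneg.
have n5 : 0 <= b5 by nonneg.
have PQ0 : 0 <= P ^+ 2 + Q ^+ 2 by nonneg.
have k1 : b1 * (P ^+ 2 + Q ^+ 2) <= B4 * (P ^+ 2 + Q ^+ 2) by apply: ler_wpM2r => //; rewrite /B4; lra.
have k2' : b2 * X <= B4 * X by apply: ler_wpM2r => //; rewrite /B4; lra.
have k3 : b3 * Y <= B4 * Y by apply: ler_wpM2r => //; rewrite /B4; lra.
have k4 : b4 * J <= B4 * J by apply: ler_wpM2r => //; rewrite /B4; lra.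
have k5 : b5 * (eps ^+ 2 * Eu) <= B4 * (eps ^+ 2 * Eu) by apply: ler_wpM2r => //; rewrite /B4; lra.
move=> E1 E2 E3; rewrite /Nn -/Y.
have E4 : 9 * (8 * lam ^+ 2 * r1 * X + 2 * lam ^+ 2 / tau0 ^+ 2 * J) + 9 * (16 * T ^+ 2 * M ^+ 2 * J)
  + 3 * (25 * C1 / tau0 ^+ 4 * Y + 25 / tau0 ^+ 4 * (eps ^+ 2 * Eu)) + (2 * X + 2 * lam ^+ 2 * Y) + Y
  = b2 * X + b3 * Y + b4 * J + b5 * (eps ^+ 2 * Eu) by rewrite /b2 /b3 /b4 /b5; ring.
rewrite -/b1 in h5.
move: h3 h4 h5 k1 k2' k3 k4 k5 E1 E2 E3 E4.
rewrite !(mulrDr B4).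
move: (mu * (g - _) ^+ 2) (mu^-1 * _) (mu^-1 * _) (mu^-1 * _) (mu^-1 * _) (mu^-1 * _) => x1 x2 x3 x4 x5 x6.
move: (b1 * _) (b2 * _) (b3 * _) (b4 * _) (b5 * _) (B4 * _) (B4 * _) (B4 * _) (B4 * _) (B4 * _) (B4 * _).
move=> *; lra.
Qed.

Let H := s * tau ^+ 6 * (- w ^+ 2 +
  (del / tau ^+ 2 * g ^+ 2 + (del / tau ^+ 2)^-1 * (r * w ^+ 2))).

Let m00 : 0 < m0. Proof. by rewrite /m0 !lt_min ltr01 !mulr_gt0 ?exprn_gt0. Qed.
Let B20 : 0 <= B2. Proof. by nonneg. Qed.
Let B40 : 0 <= B4. Proof. by rewrite /B4 /b1 /b2 /b3 /b4 /b5; nonneg. Qed.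
Let del0 : 0 < del. Proof. by rewrite divr_gt0 // mulr_gt0 // ltr_wpDl. Qed.

Lemma carleman_at_a_point : B3 <= s * (lam ^+ 3 * k2) -> (del ^+ 2 * tau0 ^+ 4)^-1 <= s ->
  Nn <= B4 * (300 / m0 + 1) * (fz ^+ 2 + eps ^+ 2 * Eu) + 4 * B4 / m0 * D
    - B4 * (4 * B2 / m0 + 1) * H.
Proof.
move=> sB sd; have co := coercive sB.
(* H has a nonnegative integral; it trades J for X and Y. *)
have JE : J <= - H + del * (X + Y).
  have -> : J = - H + (del * X + del^-1 * (s ^+ 2 * tau ^+ 4)^-1 * Y).
    by rewrite /H /J /X /Y; field; rewrite !gt_eqF.
  rewrite lerD2l mulrDr lerD2l ler_wpM2r // -invfM -[leRHS]invrK lef_pV2 ?posrE ?invr_gt0 //; last first.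
    by apply: mulr_gt0 => //; apply: mulr_gt0; apply: exprn_gt0.
  have s0' : 0 < (del ^+ 2 * tau0 ^+ 4)^-1 by rewrite invr_gt0 mulr_gt0 ?exprn_gt0.
  have h : (del * tau0 ^+ 4)^-1 <= s * del.
    rewrite -ler_pdivrMr //; apply: le_trans sd; apply: le_of_eq; field.
    by rewrite !gt_eqF.
  have h2 : del^-1 <= s * (del * tau0 ^+ 4).
    apply: le_trans (_ : (del * tau0 ^+ 4)^-1 * tau0 ^+ 4 <= _).
      by apply: le_of_eq; field; rewrite !gt_eqF.
    by rewrite (mulrA s); apply: ler_wpM2r => //; nonneg.
  apply: (le_trans h2); rewrite (_ : s * _ = del * (s * tau0 ^+ 4)); last by ring.
  apply: ler_wpM2l; first exact: ltW.
  apply: ler_pM; [by nonneg|by nonneg|by have := sX 1 1; rewrite expr1|].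
  by rewrite lerXn2r ?nnegrE ?(ltW tau_pos) ?(ltW tau00).
have d1 : del <= 1.
  rewrite ler_pdivrMr ?mul1r; last by rewrite mulr_gt0 // ltr_wpDl.
  by have : m0 <= 1 by [rewrite /m0 ge_min lexx]; have := B20; lra.
have dB : B2 * del <= m0 / 2.
  rewrite /del -mulrCA ler_wpM2l ?(ltW m00) // invfM mulrCA ler_piMr ?invr_ge0 //.
  by rewrite ler_pdivrMr ?mul1r ?ltr_wpDl // lerDl.
have XY0 : 0 <= X + Y by rewrite addr_ge0.
have S1 : P ^+ 2 + Q ^+ 2 + m0 / 2 * (X + Y) <= D + 3 * fz ^+ 2 + 75 * (eps ^+ 2 * Eu) - B2 * H.
  have h1 := ler_wpM2l B20 JE; have h2 := ler_wpM2r XY0 dB.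
  by move: co h1 h2; move: (P ^+ 2) (Q ^+ 2) => *; lra.
have P0 := sqr_ge0 P; have Q0 := sqr_ge0 Q; have f0 := sqr_ge0 fz.
have E0 : 0 <= eps ^+ 2 * Eu by rewrite mulr_ge0 // sqr_ge0.
have m1 : m0 <= 1 by rewrite /m0 ge_min lexx.
have S2 : m0 / 2 * (P ^+ 2 + Q ^+ 2 + (X + Y)) <= D + 3 * fz ^+ 2 + 75 * (eps ^+ 2 * Eu) - B2 * H.
  apply: le_trans S1; rewrite [leLHS]mulrDr lerD2r; apply: ler_piMl; first by nonneg.
  by lra.
have S3 : P ^+ 2 + Q ^+ 2 + (X + Y) <= 2 / m0 * (D + 3 * fz ^+ 2 + 75 * (eps ^+ 2 * Eu) - B2 * H).
  have i0 : 0 <= 2 / m0 by rewrite divr_ge0 // ltW.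
  have e : 2 / m0 * (m0 / 2) = 1 by field; rewrite gt_eqF.
  by have := ler_wpM2l i0 S2; rewrite (mulrA (2 / m0)) e mul1r.
have J2 : J <= - H + (P ^+ 2 + Q ^+ 2 + (X + Y)).
  have h : del * (X + Y) <= X + Y by rewrite ler_piMl.
  by move: JE h P0 Q0; move: (P ^+ 2) (Q ^+ 2) => *; lra.
apply: (le_trans upper).
have -> : B4 * (300 / m0 + 1) * (fz ^+ 2 + eps ^+ 2 * Eu) + 4 * B4 / m0 * D
    - B4 * (4 * B2 / m0 + 1) * H =
  B4 * (300 / m0 * (fz ^+ 2 + eps ^+ 2 * Eu) + 4 / m0 * D - 4 / m0 * B2 * H - H + (fz ^+ 2 + eps ^+ 2 * Eu)).
  by ring.
apply: ler_wpM2l => //.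
have f1 : 12 * (fz ^+ 2 / m0) <= 300 * (fz ^+ 2 / m0).
  by rewrite ler_wpM2r ?ler_nat // divr_ge0 // ltW.
have S4 : 2 * (P ^+ 2 + Q ^+ 2 + (X + Y)) <= 4 / m0 * D + 12 * (fz ^+ 2 / m0) + 300 / m0 * (eps ^+ 2 * Eu) - 4 / m0 * B2 * H.
  by apply: le_trans (ler_wpM2l (ler0n R 2) S3) _; apply: le_of_eq; ring.
have -> : 300 / m0 * (fz ^+ 2 + eps ^+ 2 * Eu) = 300 * (fz ^+ 2 / m0) + 300 / m0 * (eps ^+ 2 * Eu) by ring.
by move: S4 f1 J2 f0;
  move: (P ^+ 2) (Q ^+ 2) (_ * (eps ^+ 2 * Eu)) (_ * H) (_ * D) => *; lra.
Qed.

End at_a_point.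

(** The estimate before integration: the left-hand side is bounded by the data, by
    quantities of known sign after integration (the energy term, the time
    derivative of the potential, the multiplier defect) and by the Hardy term. All
    constants are independent of [s] and [eps]. *)
Lemma carleman_pointwise : exists A C kap del sm : R,
  [/\ 0 <= A, 0 < C, 0 <= kap, 0 < del & 1 <= sm] /\
  forall s eps tau l psi rho w g wt mw fz v Eu : R,
  sm <= s -> 0 <= eps <= 1 -> tau0 <= tau -> `|l| <= T -> `|psi| <= M -> rho ^+ 2 <= r1 ->
  v ^+ 2 <= Mc ^+ 2 * w ^+ 2 -> 0 <= Eu ->
  (l * tau ^+ 6 * w) ^+ 2 <= C1 * (tau ^+ 12 * rho ^+ 2 * w ^+ 2) + Eu ->
  let mu := s * tau ^+ 4 in
  let nu := - 4 * s * l * tau ^+ 5 in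
  let ka := 5 * eps * l * tau ^+ 6 + nu * psi in
  let q := nu * psi + mu ^+ 2 * lam ^+ 2 * rho ^+ 2 in
  let qt := s * (8 * tau ^+ 5 + 20 * l ^+ 2 * tau ^+ 6) * psi
    - 8 * s ^+ 2 * lam ^+ 2 * l * tau ^+ 9 * rho ^+ 2 in
  let P := - mw - q * w in
  let Rr := 2 * mu * lam * (rho * g) + mu * lam * w in
  P + (wt + Rr) = fz - v + 5 * eps * (l * tau ^+ 6 * w) ->
  mu^-1 * ((wt - ka * w) ^+ 2 + (mw - Rr + mu ^+ 2 * lam ^+ 2 * rho ^+ 2 * w) ^+ 2)
    + mu * (g - mu * lam * rho * w) ^+ 2 + s ^+ 3 * tau ^+ 12 * rho ^+ 2 * w ^+ 2 <=
  C * (fz ^+ 2 + eps ^+ 2 * Eu)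
  + A * (- 2 * (- mw * wt) + (qt * w ^+ 2 + 2 * q * (w * wt))
    - 2 * (P * Rr - mu * lam * (k2 * g ^+ 2)
         - mu * lam * ((nu * lam + mu ^+ 2 * lam ^+ 2 * k2) * (rho ^+ 2 * w ^+ 2))))
  - kap * (s * tau ^+ 6 * (- w ^+ 2 +
     (del / tau ^+ 2 * g ^+ 2 + (del / tau ^+ 2)^-1 * (rho ^+ 2 * w ^+ 2)))).
Proof.
have m00 : 0 < m0 by rewrite /m0 !lt_min ltr01 !mulr_gt0 ?exprn_gt0.
have B20 : 0 <= B2 by nonneg.
have B40 : 0 < B4.
  have b10 : 0 <= b1 by nonneg.
  have b30 : 0 <= b3 by nonneg.
  have b40 : 0 <= b4 by rewrite /b4; nonneg.
  have b50 : 0 <= b5 by nonneg.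
  have b20 : 2 <= b2 by rewrite /b2 lerDr; nonneg.
  by rewrite /B4; lra.
exists (4 * B4 / m0), (B4 * (300 / m0 + 1)), (B4 * (4 * B2 / m0 + 1)), del,
  (Num.max 1 (Num.max (B3 / (lam ^+ 3 * k2)) (del ^+ 2 * tau0 ^+ 4)^-1)).
split.
  have mV : 0 < m0^-1 by rewrite invr_gt0.
  have B2m : 0 <= B2 / m0 by rewrite mulr_ge0 // ltW.
  have c0 : 0 <= 300 / m0 by rewrite mulr_ge0 ?(ltW mV).
  split.
  - by apply: mulr_ge0 (ltW mV); rewrite mulr_ge0 ?(ltW B40).
  - by apply: mulr_gt0 B40 _; lra.
  - by apply: mulr_ge0 (ltW B40) _; rewrite -mulrA; lra.
  - by apply: divr_gt0 m00 _; apply: mulr_gt0 => //; lra.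
  - by rewrite le_max lexx.
move=> s eps tau l psi rho w g wt mw fz v Eu; rewrite !ge_max => /and3P[s1 sB sd].
move=> eps01 tauge lT psiM rhor vle Eu0 epsE mu nu ka q qt P Rr eqF.
apply: (carleman_at_a_point s1 eps01 tauge lT psiM rhor vle Eu0 epsE eqF) => //.
by move: sB; rewrite ler_pdivrMr // mulr_gt0 ?exprn_gt0.
Qed.

End pointwise_estimate.

(** * Conjugation in time *)

Section flat_weight.
Context {R : realType}.
Variables (T eps s M : R) (psi : R -> R).
Hypotheses (T0 : 0 < T) (eps0 : 0 < eps) (s_ge0 : 0 <= s) (M0 : 0 <= M)
  (psiM : forall x, 0 < x -> x <= 1 -> `|psi x| <= M).
Notation mu := (@lebesgue_measure R).
Local Notation DT := (`]0, T[%classic : set (measurableTypeR R)).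
Local Notation I01 := (`]0, 1[%classic : set (measurableTypeR R)).
Local Notation QTm := (QT T : set (plane R)).

(** The factor [exp (- eps tau^5)] makes the conjugated functions vanish at both
    ends of [(0, T)] whatever the sign of [psi]. *)
Definition weight (t x : R) : R :=
  expR (- eps * tau T t ^+ 5) * expR (s * tau T t ^+ 4 * psi x).

Definition weight_rate (t x : R) : R :=
  5 * eps * (T - 2 * t) * tau T t ^+ 6 + (- 4 * s * (T - 2 * t) * tau T t ^+ 5) * psi x.

Lemma weight_gt0 t x : 0 < weight t x.
Proof. by rewrite mulr_gt0 ?expR_gt0. Qed.

Lemma weight_bound k : exists2 C : R, 0 < C & forall t x, 0 < t < T -> 0 < x -> x <= 1 ->
  tau T t ^+ k * weight t x <= C.
Proof.
have [|C C0 HC] := @flat_bound R eps (s * M) k eps0; first exact: mulr_ge0.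
exists C => // t x tT x0 x1; apply: le_trans (HC _ (tau_gt0 tT)).
rewrite ler_wpM2l ?exprn_ge0 ?(ltW (tau_gt0 tT)) // /weight -expRD ler_expR lerD2l.
rewrite mulrAC ler_wpM2r ?exprn_ge0 ?(ltW (tau_gt0 tT)) // ler_wpM2l //.
by apply: le_trans (ler_norm _) (psiM _ _).
Qed.

Lemma weight_derive t x : 0 < t < T ->
  is_derive (t : R) (1 : R) (weight^~ x) (weight t x * weight_rate t x).
Proof.
move=> tT; have dt := tau_derive tT.
have d1 := is_derive1_exp (is_derive1Z (- eps) (is_derive1X 5 dt)).
have d2 := is_derive1_exp (is_derive1M (is_derive1Z s (is_derive1X 4 dt)) (is_derive1_cst t (psi x))).
apply: is_derive_eq (is_derive1M d1 d2) _.
by rewrite /weight /weight_rate /=; ring.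
Qed.

Lemma weight_ac x d e : 0 < d -> d < e -> e < T -> abs_continuous d e (weight^~ x).
Proof.
move=> d0 de eT; have ac := tau_ac d0 de eT; have le := ltW de.
apply: (abs_continuousM le); apply: (abs_continuous_exp le).
  exact: (abs_continuousZ _ le (abs_continuousX 5 le ac)).
apply: (eq_abs_continuous _ (abs_continuousZ (s * psi x) le (abs_continuousX 4 le ac))).
by move=> t _ /=; ring.
Qed.

Lemma measurable_time (f : R -> R) : measurable_fun DT f ->
  measurable_fun QTm (fun z : plane R => f z.1).
Proof.
have mD : measurable DT by exact: measurable_itv.
move=> mf; apply: (measurable_comp mD _ mf).
  by move=> _ [[t x] [tT _] <-]; rewrite /= in_itv.
by apply: measurable_funS measurableT (@subsetT _ _) _; exact: measurable_fst.
Qed.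

Lemma measurable_space (f : R -> R) : measurable_fun I01 f ->
  measurable_fun QTm (fun z : plane R => f z.2).
Proof.
have mI : measurable I01 by exact: measurable_itv.
move=> mf; apply: (measurable_comp mI _ mf).
  by move=> _ [[t x] [_ x01] <-]; rewrite /= in_itv.
by apply: measurable_funS measurableT (@subsetT _ _) _; exact: measurable_snd.
Qed.

Lemma tau_measurable : measurable_fun DT (tau T).
Proof.
by apply: derivable_measurable => t t0 tT; apply: tau_derive; rewrite t0.
Qed.

Hypothesis mpsi : measurable_fun I01 psi.

Lemma weight_measurable :
  measurable_fun QTm (fun z : plane R => weight z.1 z.2).
Proof.
apply: measurable_funM.
  apply: (@measurable_time (fun t => expR (- eps * tau T t ^+ 5))).
  apply: measurableT_comp; first exact: measurable_expR.
  apply: measurable_funM; first exact: measurable_cst.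
  by apply: measurable_funX; exact: tau_measurable.
apply: measurableT_comp; first exact: measurable_expR.
apply: measurable_funM; last exact: measurable_space.
apply: (@measurable_time (fun t => s * tau T t ^+ 4)).
apply: measurable_funM; first exact: measurable_cst.
by apply: measurable_funX; exact: tau_measurable.
Qed.

(** Products of a function of [L^2(Q)] with the weight, a power of [tau] and a
    bounded function stay in [L^2(Q)]. *)
Lemma weight_L2 n (B : R) (g : R * R -> R) (f : R -> R -> R) :
  measurable_fun QTm (g : plane R -> R) ->
  (forall z, QT T z -> `|g z| <= B) -> L2_Q T f ->
  L2_Q T (fun t x => weight t x * (tau T t ^+ n * g (t, x) * f t x)).
Proof.
move=> mg gB Lf; have [C C0 HC] := weight_bound n.
have mQ := measurable_QT T.
have := @bounded_L2 _ _ _ _ _ mQ (C * B) (fun z => f z.1 z.2)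
  (fun z => weight z.1 z.2 * tau T z.1 ^+ n * g z) _ _ Lf.
rewrite /L2_Q => H; apply: eq_L2 (H _ _).
- by move=> [t x] _ /=; ring.
- apply: measurable_funM => //; apply: measurable_funM; first exact: weight_measurable.
  by apply: (@measurable_time (fun t => tau T t ^+ n)); apply: measurable_funX; exact: tau_measurable.
move=> [t x] Qz; have := Qz => -[/= tT /andP[x0 x1]].
rewrite normrM ler_pM // ?gB // ger0_norm; last first.
  by rewrite mulr_ge0 ?exprn_ge0 ?(ltW (tau_gt0 tT)) ?(ltW (weight_gt0 _ _)).
by rewrite mulrC HC // ltW.
Qed.

Section conjugation.
Variables (U V : R -> R) (x B : R).
Hypotheses (x0 : 0 < x) (x1 : x < 1).
Hypotheses (acU : forall d e, 0 < d -> d < e -> e < T -> abs_continuous d e U)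
  (dU : {ae mu, forall t : R, 0 < t < T -> is_derive t 1 U (V t)})
  (UB : forall t, 0 < t < T -> `|U t| <= B).

Let W t := weight t x * U t.
Let Wt t := weight t x * (V t + weight_rate t x * U t).

Let acW d e : 0 < d -> d < e -> e < T -> abs_continuous d e W.
Proof.
move=> d0 de eT; apply: (abs_continuousM (ltW de)); first exact: weight_ac.
exact: acU.
Qed.

Let dW : {ae mu, forall t : R, 0 < t < T -> is_derive t 1 W (Wt t)}.
Proof.
apply: ae_mono dU => t H tT.
apply: is_derive_eq (is_derive1M (weight_derive x tT) (H tT)) _.
by rewrite /Wt; ring.
Qed.

Let tauK t : 0 < t < T -> tau T t * (t * (T - t)) = 1.
Proof.
by move=> tT; rewrite mulVf // gt_eqF // -invr_gt0; exact: (tau_gt0 tT).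
Qed.

Let tT0 t : 0 < t < T -> 0 <= t * (T - t).
Proof. by move=> /andP[t0 tT]; rewrite mulr_ge0 ?subr_ge0 ?ltW. Qed.

(** [weight * U] vanishes at both ends of [(0, T)] to any order because [U] is
    bounded. *)
Lemma conjugate_primitive : mu.-integrable DT (EFin \o Wt) ->
  forall t, 0 < t < T -> W t = \int[mu]_(z in `]0, t[) Wt z.
Proof.
move=> iW; have [C C0 HC] := weight_bound 1.
have [||//] := @ac_vanishing_primitive R T (C * B) W Wt T0 iW _ dW.
  by move=> d e d0 de eT; exact: acW.
move=> t tT; rewrite /W normrM (ger0_norm (ltW (weight_gt0 _ _))).
rewrite [leRHS]mulrAC; apply: ler_pM; [exact: ltW (weight_gt0 _ _)|exact: normr_ge0| |exact: UB].
rewrite -[leLHS]mulr1 -(tauK tT) mulrA ler_wpM2r ?tT0 //.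
by rewrite mulrC -[tau T t]expr1 HC // ltW.
Qed.

(** [q W^2] vanishes at both ends, hence its derivative has integral 0; [b] and [r]
    stand for [s^2 lam^2] and [x^2/a]. *)
Lemma conjugate_square (b r : R) :
  let q t := - 4 * s * (T - 2 * t) * tau T t ^+ 5 * psi x + b * tau T t ^+ 8 * r in
  let qt t := s * (8 * tau T t ^+ 5 + 20 * (T - 2 * t) ^+ 2 * tau T t ^+ 6) * psi x
    - 8 * b * (T - 2 * t) * tau T t ^+ 9 * r in
  mu.-integrable DT (EFin \o (fun t => qt t * W t ^+ 2 + 2 * q t * (W t * Wt t))) ->
  \int[mu]_(t in DT) (qt t * W t ^+ 2 + 2 * q t * (W t * Wt t)) = 0.
Proof.
move=> q qt iq.
have [C1 C10 HC1] := weight_bound 6; have [C2 C20 HC2] := weight_bound 9.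
have [C3 C30 HC3] := weight_bound 0.
pose C := (4 * s * T * `|psi x| * C1 + `|b| * `|r| * C2) * C3 * B ^+ 2.
have dl t : is_derive (t : R) (1 : R) (fun t => T - 2 * t) (- 2).
  apply: is_derive_eq (is_derive1D (is_derive1_cst t T) (is_derive1N (is_derive1Z 2 (is_derive1_id t)))) _; ring.
have [|||//] := @ac_vanishing_primitive R T C (fun t => q t * W t ^+ 2)
  (fun t => qt t * W t ^+ 2 + 2 * q t * (W t * Wt t)) T0 iq.
- move=> d e d0 de eT; have le := ltW de; have ac := tau_ac d0 de eT.
  apply: (abs_continuousM le); last first.
    by apply: (abs_continuousX 2 le); exact: acW.
  apply: abs_continuousD.
    have acl : abs_continuous d e (fun t => T - 2 * t).
      apply: abs_continuousD; first exact: abs_continuous_cst.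
      apply: (eq_abs_continuous _ (abs_continuousZ (- 2) le (abs_continuous_id d e))).
      by move=> t _ /=; rewrite mulNr.
    apply: (eq_abs_continuous _ (abs_continuousZ (- 4 * s * psi x) le
       (abs_continuousM le acl (abs_continuousX 5 le ac)))).
    by move=> t _ /=; ring.
  apply: (eq_abs_continuous _ (abs_continuousZ (b * r) le (abs_continuousX 8 le ac))).
  by move=> t _; ring.
- apply: ae_mono dW => t H tT; have dt := tau_derive tT.
  have d1 := is_derive1M (is_derive1M (is_derive1Z (- 4 * s) (dl t)) (is_derive1X 5 dt)) (is_derive1_cst t (psi x)).
  have d2 := is_derive1M (is_derive1Z b (is_derive1X 8 dt)) (is_derive1_cst t r).
  apply: is_derive_eq (is_derive1M (is_derive1D d1 d2) (is_derive1X 2 (H tT))) _.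
  by rewrite /q /qt /=; ring.
move=> t tT; rewrite /W normrM normrX normrM (ger0_norm (ltW (weight_gt0 _ _))).
set z := weight t x; have z0 : 0 < z by exact: weight_gt0.
have t0 := tau_gt0 tT.
have lT : `|T - 2 * t| <= T.
  by rewrite ler_norml; move: tT => /andP[? ?]; apply/andP; split; lra.
have h1 : `|q t| <= 4 * s * T * tau T t ^+ 5 * `|psi x| + `|b| * tau T t ^+ 8 * `|r|.
  apply: le_trans (ler_normD _ _) _; apply: lerD; last first.
    by rewrite 2!normrM (@ger0_norm _ (tau T t ^+ 8)) // exprn_ge0 // ltW.
  rewrite 4!normrM (@ger0_norm _ (tau T t ^+ 5)) ?exprn_ge0 ?(ltW t0) // (ger0_norm s_ge0).
  rewrite normrN (@ger0_norm _ 4) //; apply: ler_wpM2r => //.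
  apply: ler_wpM2r; first by rewrite exprn_ge0 // ltW.
  by apply: ler_wpM2l; rewrite ?mulr_ge0.
have h2 : `|U t| ^+ 2 <= B ^+ 2 by rewrite lerXn2r ?nnegrE // ?UB // (le_trans _ (UB tT)).
have h3 : tau T t ^+ 6 * z <= C1 by rewrite HC1 // ltW.
have h4 : tau T t ^+ 9 * z <= C2 by rewrite HC2 // ltW.
have h5 : z <= C3 by have := HC3 t x tT x0 (ltW x1); rewrite expr0 mul1r.
have h6 : `|q t| * z * tau T t <= 4 * s * T * `|psi x| * C1 + `|b| * `|r| * C2.
  rewrite -mulrA; apply: le_trans (ler_wpM2r _ h1) _; first by rewrite mulr_ge0 // ltW.
  have -> : (4 * s * T * tau T t ^+ 5 * `|psi x| + `|b| * tau T t ^+ 8 * `|r|) * (z * tau T t) =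
     4 * s * T * `|psi x| * (tau T t ^+ 6 * z) + `|b| * `|r| * (tau T t ^+ 9 * z) by ring.
  by apply: lerD; apply: ler_wpM2l => //; rewrite ?mulr_ge0 // ltW.
have -> : `|q t| * (z * `|U t|) ^+ 2 =
   `|q t| * z * tau T t * z * `|U t| ^+ 2 * (t * (T - t)).
  rewrite -[LHS]mulr1 -(tauK tT); ring.
rewrite ler_wpM2r ?tT0 // /C; apply: ler_pM; [|by rewrite exprn_ge0| |exact: h2].
  by rewrite mulr_ge0 ?(ltW z0) // mulr_ge0 ?(ltW t0) // mulr_ge0 // ltW.
apply: ler_pM => //; [|exact: ltW].
by rewrite mulr_ge0 ?(ltW t0) // mulr_ge0 // ltW.
Qed.

End conjugation.

End flat_weight.

(** * Square integrable functions flat at both ends of the time interval *)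

Section bounded_multipliers.
Context {R : realType}.
Variable T : R.
Notation mu := (@lebesgue_measure R).
Notation mu2 := (mu \x mu)%E.
Local Notation DT := (`]0, T[%classic : set (measurableTypeR R)).
Local Notation I01 := (`]0, 1[%classic : set (measurableTypeR R)).
Local Notation Q := (plane R).

Definition multiplier (g : Q -> R) : Prop :=
  measurable_fun (QT T) g /\ exists B : R, forall z, QT T z -> `|g z| <= B.

Lemma multiplier_cst (r : R) : multiplier (fun=> r).
Proof. by split; [exact: measurable_cst|exists `|r|]. Qed.

Lemma multiplierM g h : multiplier g -> multiplier h -> multiplier (fun z => g z * h z).
Proof.
move=> [mg [B gB]] [mh [C hC]]; split; first exact: measurable_funM.
by exists (B * C) => z Qz; rewrite normrM ler_pM ?gB ?hC.
Qed.

Lemma multiplierX g n : multiplier g -> multiplier (fun z => g z ^+ n).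
Proof.
move=> [mg [B gB]]; split; first exact: measurable_funX.
by exists (B ^+ n) => z Qz; rewrite normrX lerXn2r ?nnegrE ?gB // (le_trans _ (gB _ Qz)).
Qed.

Lemma multiplier_clock : multiplier (fun z => T - 2 * z.1).
Proof.
split.
  apply: measurable_funB; first exact: measurable_cst.
  apply: measurable_funM; first exact: measurable_cst.
  by apply: measurable_funS measurableT (@subsetT _ _) _; exact: measurable_fst.
exists T => -[t x] [/= /andP[t0 tT] _]; rewrite ler_norml; apply/andP; split; lra.
Qed.

(** Functions that remain in [L^2(Q)] after multiplication by any power of the
    singular factor [tau]. *)
Definition flat (Y : R -> R -> R) : Prop :=
  forall n g, multiplier g -> L2_Q T (fun t x => tau T t ^+ n * g (t, x) * Y t x).

Lemma flat_L2 Y : flat Y -> L2_Q T Y.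
Proof.
move=> fY; have := fY 0 _ (multiplier_cst 1); apply: eq_L2 => -[t x] _ /=.
by rewrite expr0 !mul1r.
Qed.

Lemma eq_flat Y Z : (forall t x, 0 < t < T -> 0 < x < 1 -> Y t x = Z t x) -> flat Y -> flat Z.
Proof.
move=> YZ fY n g mg; have := fY n g mg; apply: eq_L2 => -[t x].
by move=> /set_mem[/= tT x01]; rewrite YZ.
Qed.

Lemma flatD Y Z : flat Y -> flat Z -> flat (fun t x => Y t x + Z t x).
Proof.
move=> fY fZ n g mg; have := L2D (measurable_QT T) (fY n g mg) (fZ n g mg).
by apply: eq_L2 => -[t x] _ /=; ring.
Qed.

Lemma flatM n g Y : multiplier g -> flat Y -> flat (fun t x => tau T t ^+ n * g (t, x) * Y t x).
Proof.
move=> mg fY m h mh; have := fY (m + n)%N _ (multiplierM mg mh).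
by apply: eq_L2 => -[t x] _ /=; rewrite exprD; ring.
Qed.

Lemma flatN Y : flat Y -> flat (fun t x => - Y t x).
Proof.
move=> fY; apply: (eq_flat _ (flatM 0 (multiplier_cst (- 1)) fY)) => t x _ _.
by rewrite expr0; ring.
Qed.

Lemma flat_integrable n g Y Z : multiplier g -> flat Y -> flat Z ->
  mu2.-integrable (QT T) (EFin \o (fun z => tau T z.1 ^+ n * g z * Y z.1 z.2 * Z z.1 z.2)).
Proof.
move=> mg fY fZ; have := L2M (measurable_QT T) (fY n g mg) (flat_L2 fZ).
by apply: eq_integrable; [exact: measurable_QT|move=> -[t x] _].
Qed.

End bounded_multipliers.

Section flat_weight_multipliers.
Context {R : realType}.
Variables (T eps s M : R) (psi : R -> R).
Hypotheses (T0 : 0 < T) (eps0 : 0 < eps) (s_ge0 : 0 <= s) (M0 : 0 <= M)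
  (psiM : forall x, 0 < x -> x <= 1 -> `|psi x| <= M)
  (mpsi : measurable_fun (`]0, 1[%classic : set (measurableTypeR R)) psi).

Lemma flat_weighted (f : R -> R -> R) : L2_Q T f ->
  flat T (fun t x => weight T eps s psi t x * f t x).
Proof.
move=> Lf n g [mg [B gB]].
have := weight_L2 eps0 s_ge0 M0 psiM mpsi n mg gB Lf.
by apply: eq_L2 => -[t x] _ /=; ring.
Qed.

End flat_weight_multipliers.

Section solution_on_lines.
Context {R : realType} (k : degeneracy).
Variables (T : R) (a : R -> R) (tc : R -> R -> R) (u0 : R -> R) (f u ut ux Mu : R -> R -> R).
Hypotheses (T0 : 0 < T) (Lu0 : L2_01 u0)
  (sol : is_solution k T a tc u0 f u ut ux Mu).
Notation mu := (@lebesgue_measure R).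
Notation mu2 := (mu \x mu)%E.
Local Notation DT := (`]0, T[%classic : set (measurableTypeR R)).
Local Notation I01 := (`]0, 1[%classic : set (measurableTypeR R)).
Local Notation Q := (plane R).
Local Notation U := (primitive u0 ut).

Lemma primitive_ae_time t : 0 < t < T -> {ae mu, forall x, 0 < x < 1 -> U t x = u t x}.
Proof.
move=> /andP[t0 tT].
have H := sol_ut sol (lexx 0) (ltW t0) (ltW tT).
apply: ae_mono (ae_and H (sol_initial sol)) => x [h1 h2] x01.
have {}h1 := h1 x01; have {}h2 := h2 x01; rewrite h2 in h1.
rewrite /primitive.
have -> : \int[mu]_(z in `]0, t[) ut z x = \int[mu]_(z in `[0, t]) ut z x.
  have mi : measurable_fun (`]0, t[%classic : set (measurableTypeR R)) (EFin \o ut^~ x).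
    apply/measurable_EFinP.
    apply: measurable_funS (measurable_itv _) _ (measurable_xsec (L2_measurable (sol_ut_L2 sol)) x01).
    by move=> z /=; rewrite !in_itv /= => /andP[-> /lt_trans ->].
  by rewrite /Rintegral; congr fine; apply/esym/integral_itv_bndoo.
by rewrite -h1; ring.
Qed.

(** At each time the two functions agree for almost every position; measurability
    of the primitive gives agreement almost everywhere in [Q]. *)
Lemma primitive_ae : {ae mu2, forall z, QT T z -> U z.1 z.2 = u z.1 z.2}.
Proof.
have mQ := measurable_QT T.
pose E := (~` QT T) `|` (QT T `&` [set z : Q | (U z.1 z.2)%:E = (u z.1 z.2)%:E]).
have mE : measurable E.
  apply: measurableU; first exact: measurableC.
  apply: measurable_eqe => //; apply/measurable_EFinP.
    exact: primitive_measurable Lu0 (sol_ut_L2 sol).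
  exact: L2_measurable (sol_u_L2 sol).
have : {ae mu2, forall z, E z}.
  apply: (@ae_of_xsection _ _ _ _ R mu mu E mE); apply: aeW => t.
  have [tT|nT] := boolP (0 < t < T); last first.
    by apply: aeW => x; left => -[/= tT]; rewrite tT in nT.
  apply: ae_mono (primitive_ae_time tT) => x H.
  have [x01|nx] := boolP (0 < x < 1); last by left => -[_ /= x01]; rewrite x01 in nx.
  by right; split => //=; rewrite H.
by apply: ae_mono => z [//|[_ /= [->]]].
Qed.

Lemma primitive_L2 : L2_Q T U.
Proof.
split; first exact: primitive_measurable Lu0 (sol_ut_L2 sol).
have [mu_ iu] := sol_u_L2 sol; apply: le_lt_trans iu; rewrite le_eqVlt; apply/orP; left; apply/eqP.
apply: ae_eq_integral.
- exact: measurable_QT.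
- apply/measurable_EFinP; apply: measurable_funX; exact: primitive_measurable Lu0 (sol_ut_L2 sol).
- by apply/measurable_EFinP; apply: measurable_funX.
by apply: ae_mono primitive_ae => z H Qz; rewrite H.
Qed.

(** The boundary flux expressed by integrals over [(1/2, 1)], which makes it
    measurable in time. *)
Definition boundary_flux (t : R) : R :=
  \int[mu]_(x in I01) (\1_(`]2^-1, 1[%classic : set R) x *
    (2 * (Num.sqrt (a x) * (Num.sqrt (a x) * ux t x)) + (2 * x - 1) * Mu t x)).

(** Times at which the solution has a flux representative and the measurable
    functions [ux], [Mu] and [primitive] agree with it. *)
Definition good_time (t : R) : Prop :=
  (exists p, [/\ space_admissible k a (u t) p (Mop a (u t)),
    forall x, 0 < x -> x < 1 -> p x = a x * (derive1 (u t) x),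
    left_derivative (u t) 1 = p 1 / a 1 & p 1 = boundary_flux t])
  /\ {ae mu, forall x, 0 < x < 1 ->
       [/\ ux t x = derive1 (u t) x, Mu t x = Mop a (u t) x & U t x = u t x]}.

Lemma good_time_ae (a' : R -> R) (K : R) : degenerate_coefficient a a' K ->
  {ae mu, forall t, 0 < t < T -> good_time t}.
Proof.
move=> dc.
have H := ae_and (ae_and (ae_xsection (sol_ux sol)) (ae_xsection (sol_Mu sol)))
   (ae_and (sol_H2a sol) (sol_boundary sol)).
apply: ae_mono H => t [[h1 h2] [h3 h4]] tT.
have [p [ap pE ld]] := flux_representative dc (h3 tT) (h4 tT).
have ae1 : {ae mu, forall x, 0 < x < 1 ->
       [/\ ux t x = derive1 (u t) x, Mu t x = Mop a (u t) x & U t x = u t x]}.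
  apply: ae_mono (ae_and (ae_and h1 h2) (primitive_ae_time tT)) => x [[e1 e2] e3] x01.
  by split; [apply: e1|apply: e2|apply: e3].
split=> //; exists p; split=> //.
rewrite (flux_at1 ap) /boundary_flux /Rintegral.
have mI : measurable I01 by exact: measurable_itv.
pose A := (`]2^-1, 1[%classic : set (measurableTypeR R)).
have mA : measurable A by exact: measurable_itv.
have AI : A = I01 `&` A.
  rewrite setIidr // => x /=; rewrite !in_itv /= => /andP[hx1 hx2].
  apply/andP; split; last exact: hx2.
  by apply: (@lt_trans _ _ 2^-1); [rewrite invr_gt0|exact: hx1].
rewrite [X in fine X = _](_ : _ = \int[mu]_(x in I01) (\1_A x * (2 * p x + (2 * x - 1) * Mop a (u t) x))%:E)%E; last first.
  rewrite -[LHS]/(\int[mu]_(x in A) _)%E {1}AI integral_mkcondr.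
  by apply: eq_integral => x _; rewrite patchE indicE; case: ifP; rewrite ?mul1r ?mul0r.
have m1 : measurable_fun I01 (\1_A : measurableTypeR R -> R) by apply: measurable_indic.
have m2 : measurable_fun I01 (fun x : R => 2 * x - 1).
  by apply: measurable_funB => //; apply: measurable_funM => //; exact: measurable_id.
congr fine; apply: ae_eq_integral => //.
- apply/measurable_EFinP; apply: measurable_funM => //; apply: measurable_funD.
    apply: measurable_funM => //; apply: (eq_measurable_fun (fun x => Num.sqrt (a x) * (p x / Num.sqrt (a x)))).
      move=> x /set_mem /in01[x0 x1]; rewrite mulrC mulfVK // gt_eqF //.
      exact: (sqrt_coef_gt0 dc x0 (ltW x1)).
    by apply: measurable_funM (sqrt_coef_measurable dc) (L2_measurable (sa_p ap)).
  by apply: measurable_funM => //; exact: L2_measurable (sa_m ap).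
- apply/measurable_EFinP; apply: measurable_funM => //; apply: measurable_funD.
    apply: measurable_funM => //; apply: measurable_funM (sqrt_coef_measurable dc) _.
    exact: measurable_tsec (L2_measurable (sol_ux_L2 sol)) tT.
  apply: measurable_funM => //.
  exact: measurable_tsec (L2_measurable (sol_Mu_L2 sol)) tT.
apply: ae_mono ae1 => x H /in01[x0 x1]; have [|e1 e2 _] := H; first by rewrite x0.
by rewrite pE // e1 e2 (mulrA (Num.sqrt (a x))) -expr2 (sqrt_coefK dc x0 (ltW x1)).
Qed.

End solution_on_lines.

(** * The conjugated solution *)

Lemma ae_Rintegral_ge0 (R : realType) (D : set (measurableTypeR R)) (f : R -> R) :
  measurable D -> (leb R).-integrable D (EFin \o f) ->
  {ae leb R, forall x, D x -> 0 <= f x} -> 0 <= \int[leb R]_(x in D) f x.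
Proof.
move=> mD fi f0; rewrite -[leLHS](_ : \int[leb R]_(x in D) (0 : R) = 0); last first.
  by rewrite /Rintegral integral0.
by apply: ae_le_Rintegral => //; exact: integrable0.
Qed.

Section carleman_for_solution.
Context {R : realType} (k : degeneracy).
Variables (T : R) (a a' : R -> R) (K c lam : R) (tc : R -> R -> R) (u0 : R -> R)
  (f u ut ux Mu : R -> R -> R).
Hypotheses (T0 : 0 < T) (dc : degenerate_coefficient a a' K) (lam_gt0 : 0 < lam)
  (Lu0 : L2_01 u0) (Lf : L2_Q T f)
  (sol : is_solution k T a tc u0 f u ut ux Mu).
Variables (s eps M : R).
Hypotheses (s1 : 1 <= s) (eps0 : 0 < eps) (M0 : 0 <= M)
  (psiM : forall x, 0 < x -> x <= 1 -> `|psi a c lam x| <= M).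
Notation mu := (@lebesgue_measure R).
Notation mu2 := (mu \x mu)%E.
Local Notation DT := (`]0, T[%classic : set (measurableTypeR R)).
Local Notation I01 := (`]0, 1[%classic : set (measurableTypeR R)).
Local Notation Q := (plane R).
Local Notation psi := (psi a c lam).
Local Notation U := (primitive u0 ut).
Local Notation z := (weight T eps s psi).
Local Notation tau := (tau T).
Local Notation rho x := (x / Num.sqrt (a x)).

Let s0 : 0 <= s. Proof. exact: le_trans ler01 s1. Qed.
Let mD : measurable DT. Proof. exact: measurable_itv. Qed.
Let mI : measurable I01. Proof. exact: measurable_itv. Qed.
Let mQ := measurable_QT T.

(** Conjugated solution, its time derivative, flux divided by [sqrt a], and
    conjugated operator. *)
Definition conj_sol t x := z t x * U t x.
Definition conj_dt t x := z t x * (ut t x + weight_rate T eps s psi t x * U t x).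
Definition conj_flux t x := z t x *
  (Num.sqrt (a x) * ux t x + s * tau t ^+ 4 * lam * (rho x * U t x)).
Definition conj_op t x := z t x *
  (Mu t x + 2 * (s * tau t ^+ 4 * lam) * (rho x * (Num.sqrt (a x) * ux t x))
   + s * tau t ^+ 4 * lam * U t x + (s * tau t ^+ 4 * lam) ^+ 2 * (rho x ^+ 2 * U t x)).

Let LU : L2_Q T U := primitive_L2 Lu0 sol.

Lemma multiplier_psi : multiplier T (fun y => psi y.2).
Proof.
split; first exact: measurable_space (psi_measurable dc c lam).
by exists M => -[t x] [_ /= /andP[x0 x1]]; rewrite psiM // ltW.
Qed.

Lemma multiplier_rho : multiplier T (fun y => rho y.2).
Proof.
split; first exact: (@measurable_space _ _ (fun x => rho x)) (root_ratio_measurable dc).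
exists (1 + (a 1)^-1) => -[t x] [_ /= /andP[x0 x1]].
exact: (root_ratio_bound dc x0 (ltW x1)).
Qed.

Let mcst := @multiplier_cst R T.
Let mcl := @multiplier_clock R T.
Let fz g : L2_Q T g -> flat T (fun t x => z t x * g t x).
Proof. by apply: flat_weighted eps0 s0 M0 psiM (psi_measurable dc c lam) g. Qed.

Lemma flat_conj_sol : flat T conj_sol. Proof. exact: fz. Qed.

Lemma flat_conj_dt : flat T conj_dt.
Proof.
have f1 := flatM 6 (multiplierM (mcst (5 * eps)) mcl) flat_conj_sol.
have f2 := flatM 5 (multiplierM (multiplierM (mcst (- 4 * s)) mcl) multiplier_psi) flat_conj_sol.
apply: (eq_flat _ (flatD (fz (sol_ut_L2 sol)) (flatD f1 f2))) => t x _ _.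
by rewrite /conj_dt /conj_sol /weight_rate /=; ring.
Qed.

Lemma flat_conj_flux : flat T conj_flux.
Proof.
have f1 := flatM 4 (multiplierM (mcst (s * lam)) multiplier_rho) flat_conj_sol.
apply: (eq_flat _ (flatD (fz (sol_ux_L2 sol)) f1)) => t x _ _.
by rewrite /conj_flux /conj_sol /=; ring.
Qed.

Lemma flat_conj_op : flat T conj_op.
Proof.
have f1 := flatM 4 (multiplierM (mcst (2 * s * lam)) multiplier_rho) (fz (sol_ux_L2 sol)).
have f2 := flatM 4 (mcst (s * lam)) flat_conj_sol.
have f3 := flatM 8 (multiplierM (mcst ((s * lam) ^+ 2)) (multiplierX 2 multiplier_rho)) flat_conj_sol.
apply: (eq_flat _ (flatD (fz (sol_Mu_L2 sol)) (flatD f1 (flatD f2 f3)))) => t x _ _.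
by rewrite /conj_op /conj_sol /=; ring.
Qed.

Lemma rho2E x : 0 < x -> x <= 1 -> rho x ^+ 2 = x ^+ 2 / a x.
Proof. by move=> x0 x1; rewrite expr_div_n (sqrt_coefK dc). Qed.

(** The conjugated triple of [conjugate_admissible] at a given time, written
    with the functions above. *)
Lemma conjugate_time : {ae mu, forall t, 0 < t < T -> exists w p m,
  [/\ space_admissible k a w p m,
      {ae mu, forall x, 0 < x < 1 -> [/\ w x = conj_sol t x, p x ^+ 2 / a x = conj_flux t x ^+ 2,
         x * p x / a x = rho x * conj_flux t x & m x = conj_op t x]},
      p 1 = z t 1 * boundary_flux a ux Mu t &
      left_derivative (u t) 1 = boundary_flux a ux Mu t / a 1]}.
Proof.
apply: ae_mono (good_time_ae sol dc) => t H tT; have [[p [ap pE ld p1]] aet] := H tT.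
have := conjugate_admissible dc c lam_gt0 (expR (- eps * tau t ^+ 5)) (s * tau t ^+ 4) ap.
rewrite -/psi => adm; do 3 eexists; split; [exact: adm| | |by rewrite ld p1].
  apply: ae_mono aet => x H1 x01; have [e1 e2 e3] := H1 x01; have /andP[x0 x1] := x01.
  have sa0 := sqrt_coef_gt0 dc x0 (ltW x1); have saK := sqrt_coefK dc x0 (ltW x1).
  have a0 : a x != 0 by rewrite gt_eqF // (dc_gt0 dc x0 (ltW x1)).
  have sn : Num.sqrt (a x) != 0 by rewrite gt_eqF.
  rewrite -/(weight T eps s psi t x) pE // -e1 -e2 -e3 /conj_sol /conj_flux /conj_op.
  move: (Num.sqrt (a x)) saK sn => r rE rn; rewrite -rE.
  by split=> //; field.
by rewrite /= (sa_w1 ap) mulr0 mulr0 addr0 p1.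
Qed.

Let ft (t : R) : R := (- 4 * s * (T - 2 * t) * tau t ^+ 5).

(** [- (flux)' - potential w] and [w_t + 2 mu lam x w_x + mu lam w] are the two
    parts of the conjugated equation; [multiplier_defect] is what remains of their
    space product once the coercive terms are taken away. *)
Definition potential t x := ft t * psi x + (s * tau t ^+ 4) ^+ 2 * lam ^+ 2 * rho x ^+ 2.
Definition potential_dt t x :=
  s * (8 * tau t ^+ 5 + 20 * (T - 2 * t) ^+ 2 * tau t ^+ 6) * psi x
  - 8 * s ^+ 2 * lam ^+ 2 * (T - 2 * t) * tau t ^+ 9 * rho x ^+ 2.
Definition sym_part t x := - conj_op t x - potential t x * conj_sol t x.
Definition anti_part t x :=
  2 * (s * tau t ^+ 4) * lam * (rho x * conj_flux t x) + (s * tau t ^+ 4) * lam * conj_sol t x.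
Definition multiplier_defect t x := sym_part t x * anti_part t x
  - s * tau t ^+ 4 * lam * ((2 - K) * conj_flux t x ^+ 2)
  - s * tau t ^+ 4 * lam * ((ft t * lam + (s * tau t ^+ 4) ^+ 2 * lam ^+ 2 * (2 - K))
      * (rho x ^+ 2 * conj_sol t x ^+ 2)).
Definition potential_density t x := potential_dt t x * conj_sol t x ^+ 2 + 2 * potential t x * (conj_sol t x * conj_dt t x).
Definition hardy_density del t x := s * tau t ^+ 6 * (- conj_sol t x ^+ 2 +
     (del / tau t ^+ 2 * conj_flux t x ^+ 2 + (del / tau t ^+ 2)^-1 * (rho x ^+ 2 * conj_sol t x ^+ 2))).

Lemma flat_potential : flat T (fun t x => potential t x * conj_sol t x).
Proof.
have f1 := flatM 5 (multiplierM (multiplierM (mcst (- 4 * s)) mcl) multiplier_psi) flat_conj_sol.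
have f2 := flatM 8 (multiplierM (mcst (s ^+ 2 * lam ^+ 2)) (multiplierX 2 multiplier_rho)) flat_conj_sol.
apply: (eq_flat _ (flatD f1 f2)) => t x _ _.
by rewrite /potential /ft /=; ring.
Qed.

Lemma flat_potential_dt : flat T (fun t x => potential_dt t x * conj_sol t x).
Proof.
have f1 := flatM 5 (multiplierM (mcst (8 * s)) multiplier_psi) flat_conj_sol.
have f2 := flatM 6 (multiplierM (multiplierM (mcst (20 * s)) (multiplierX 2 mcl)) multiplier_psi) flat_conj_sol.
have f3 := flatM 9 (multiplierM (multiplierM (mcst (- 8 * s ^+ 2 * lam ^+ 2)) mcl)
  (multiplierX 2 multiplier_rho)) flat_conj_sol.
apply: (eq_flat _ (flatD f1 (flatD f2 f3))) => t x _ _.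
by rewrite /potential_dt /=; ring.
Qed.

Lemma flat_sym_part : flat T sym_part.
Proof.
apply: (eq_flat _ (flatD (flatN flat_conj_op) (flatN flat_potential))) => t x _ _.
by rewrite /sym_part.
Qed.

Lemma flat_anti_part : flat T anti_part.
Proof.
have f1 := flatM 4 (multiplierM (mcst (2 * s * lam)) multiplier_rho) flat_conj_flux.
have f2 := flatM 4 (mcst (s * lam)) flat_conj_sol.
by apply: (eq_flat _ (flatD f1 f2)) => t x _ _; rewrite /anti_part /=; ring.
Qed.

Let fint n g Y Z := @flat_integrable R T n g Y Z.

Lemma integrable_multiplier_defect : mu2.-integrable (QT T) (EFin \o (fun y => multiplier_defect y.1 y.2)).
Proof.
have i1 := fint 0 (mcst 1) flat_sym_part flat_anti_part.
have i2 := fint 4 (mcst (- s * lam * (2 - K))) flat_conj_flux flat_conj_flux.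
have i3 := fint 9 (multiplierM (multiplierM (mcst (4 * s ^+ 2 * lam ^+ 2)) mcl)
   (multiplierX 2 multiplier_rho)) flat_conj_sol flat_conj_sol.
have i4 := fint 12 (multiplierM (mcst (- s ^+ 3 * lam ^+ 3 * (2 - K)))
   (multiplierX 2 multiplier_rho)) flat_conj_sol flat_conj_sol.
have := L1D mQ (L1D mQ i1 i2) (L1D mQ i3 i4).
apply: eq_integrable; first exact: mQ.
by move=> -[t x] _ /=; congr EFin; rewrite /multiplier_defect /ft; ring.
Qed.

Lemma integrable_potential_density : mu2.-integrable (QT T) (EFin \o (fun y => potential_density y.1 y.2)).
Proof.
have i1 := fint 0 (mcst 1) flat_potential_dt flat_conj_sol.
have i2 := fint 0 (mcst 2) flat_potential flat_conj_dt.
have := L1D mQ i1 i2.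
apply: eq_integrable; first exact: mQ.
by move=> -[t x] _ /=; congr EFin; rewrite /potential_density; ring.
Qed.

Lemma integrable_hardy_density del : mu2.-integrable (QT T) (EFin \o (fun y => hardy_density del y.1 y.2)).
Proof.
have i1 := fint 6 (mcst (- s)) flat_conj_sol flat_conj_sol.
have i2 := fint 4 (mcst (s * del)) flat_conj_flux flat_conj_flux.
have i3 := fint 8 (multiplierM (mcst (s * del^-1)) (multiplierX 2 multiplier_rho)) flat_conj_sol flat_conj_sol.
have := L1D mQ i1 (L1D mQ i2 i3).
apply: eq_integrable; first exact: mQ.
move=> -[t x] /set_mem[/= tT x01] /=; congr EFin; rewrite /hardy_density.
move: (tau t) (tau_gt0 tT) => y y0; rewrite invf_div -exprVn.
have e : y * y^-1 = 1 by rewrite mulfV // gt_eqF.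
transitivity (- s * y ^+ 6 * conj_sol t x ^+ 2 + s * del * (y * y^-1) ^+ 2 * y ^+ 4 * conj_flux t x ^+ 2
   + s * del^-1 * y ^+ 8 * (x / Num.sqrt (a x)) ^+ 2 * conj_sol t x ^+ 2); [rewrite e|]; ring.
Qed.

Lemma eq_ae_Rintegral (f1 f2 : R -> R) : measurable_fun I01 f1 -> measurable_fun I01 f2 ->
  {ae mu, forall x, 0 < x < 1 -> f1 x = f2 x} ->
  \int[mu]_(x in I01) f1 x = \int[mu]_(x in I01) f2 x.
Proof.
move=> m1 m2 e; rewrite /Rintegral; congr fine; apply: ae_eq_integral => //.
- exact/measurable_EFinP.
- exact/measurable_EFinP.
by apply: ae_mono e => x H; rewrite /= in_itv /= => x01; rewrite H.
Qed.

Lemma admissible_measurable w p m : space_admissible k a w p m ->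
  [/\ measurable_fun I01 w, measurable_fun I01 p & measurable_fun I01 m].
Proof.
move=> ap; split; [exact: L2_measurable (sa_w ap)| |exact: L2_measurable (sa_m ap)].
apply: (eq_measurable_fun (fun x => Num.sqrt (a x) * (p x / Num.sqrt (a x)))).
  move=> x /set_mem /in01[x0 x1]; rewrite mulrC mulfVK // gt_eqF //.
  exact: (sqrt_coef_gt0 dc x0 (ltW x1)).
by apply: measurable_funM (sqrt_coef_measurable dc) (L2_measurable (sa_p ap)).
Qed.

(** [hardy_poincare] at each time, with parameter [del / tau^2]. *)
Lemma hardy_density_ge0 del : 0 < del -> 0 <= \int[mu2]_(y in QT T) hardy_density del y.1 y.2.
Proof.
move=> del0; have iH := integrable_hardy_density del; rewrite QT_rectangle in iH *.
have [aet it ->] := fubini_rectangle1 mD mI iH.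
apply: (ae_Rintegral_ge0 mD it).
apply: ae_mono (ae_and aet conjugate_time) => t [H1 H2]; rewrite /= in_itv /= => tT.
have [w [p [m [adm aex _ _]]]] := H2 tT.
have [mw mp mm] := admissible_measurable adm.
have t0 := tau_gt0 tT.
have d0 : 0 < del / tau t ^+ 2 by rewrite divr_gt0 // exprn_gt0.
have mia := inv_coef_measurable dc.
have h := hardy_poincare dc d0 adm.
have mr : measurable_fun I01 (fun x : R => x ^+ 2 / a x).
  by apply: measurable_funM => //; apply: measurable_funX; exact: measurable_id.
have st : 0 < s * tau t ^+ 6 by rewrite mulr_gt0 ?exprn_gt0 // (lt_le_trans ltr01 s1).
have iHt : mu.-integrable I01 (EFin \o hardy_density del t).
  by have := H1 _; rewrite /= in_itv /= => /(_ tT).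
rewrite -(pmulr_rge0 _ (_ : 0 < (s * tau t ^+ 6)^-1)) ?invr_gt0 // -RintegralZl //.
apply: (le_trans h); apply: le_of_eq; apply: eq_ae_Rintegral.
- apply: measurable_funD.
    by apply: measurable_funN; apply: measurable_funX.
  apply: measurable_funD; apply: measurable_funM => //; apply: measurable_funM => //.
    exact: measurable_funX.
  exact: measurable_funX.
- by apply: measurable_funM => //; exact: L1_measurable iHt.
apply: ae_mono aex => x H x01; have [e1 e2 e3 e4] := H x01; have /andP[x0 x1] := x01.
by rewrite /hardy_density e1 e2 (rho2E x0 (ltW x1)) mulKf // gt_eqF.
Qed.

Lemma weight_sqr t x : z t x ^+ 2 =
  expR (- (2 * eps) * tau t ^+ 5) * expR (2 * s * (tau t ^+ 4 * psi x)).
Proof.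
rewrite exprMn -!expRM_natl; congr (expR _ * expR _); ring.
Qed.

(** [potential_density] is the time derivative of [potential * conj_sol^2]. *)
Lemma potential_density_eq0 : \int[mu2]_(y in QT T) potential_density y.1 y.2 = 0.
Proof.
have iT := integrable_potential_density; rewrite QT_rectangle in iT *.
have [aex ix ->] := fubini_rectangle2 mD mI iT.
rewrite (@eq_ae_Rintegral _ (fun=> 0)); first by rewrite /Rintegral integral0.
- exact: L1_measurable ix.
- exact: measurable_cst.
apply: ae_mono (ae_and aex (L2_Q_xsec (sol_ut_L2 sol))) => x [H1 H2] x01.
have /andP[x0 x1] := x01; have Lx := H2 x01.
have i1 : mu.-integrable DT (EFin \o potential_density^~ x) by have := H1 _; rewrite /= in_itv /=; exact.
have [B B0 UB] := primitive_bounded (u0 x) Lx.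
have h := conjugate_square (U := U^~ x) T0 eps0 s0 M0 psiM x0 x1 (fun d e => primitive_ac (u0 x) Lx (e := e))
  (primitive_derive (u0 x) Lx) UB (b := s ^+ 2 * lam ^+ 2) (r := rho x ^+ 2).
rewrite -[RHS]h.
  by apply: eq_Rintegral => t _; rewrite /potential_density /potential /potential_dt /conj_sol /conj_dt /ft /=; ring.
apply: eq_integrable i1 => // t _; congr EFin.
by rewrite /potential_density /potential /potential_dt /conj_sol /conj_dt /ft /=; ring.
Qed.

(** [carleman_multiplier] at each time. The boundary term is bounded with the
    weight at [eps = 0], which does not depend on the regularisation. *)
Lemma multiplier_defect_ge (iB : mu.-integrable DT (EFin \o (fun t => tau t ^+ 4 *
      expR (2 * s * (tau t ^+ 4 * psi 1)) * (boundary_flux a ux Mu t / a 1) ^+ 2))) :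
  - (s * lam * a 1 * \int[mu]_(t in DT) (tau t ^+ 4 *
      expR (2 * s * (tau t ^+ 4 * psi 1)) * (boundary_flux a ux Mu t / a 1) ^+ 2))
  <= \int[mu2]_(y in QT T) multiplier_defect y.1 y.2.
Proof.
have iS := integrable_multiplier_defect; rewrite QT_rectangle in iS *.
have [aet it ->] := fubini_rectangle1 mD mI iS.
rewrite -mulNr -RintegralZl //; apply: ae_le_Rintegral => //; first exact: (L1Z mD _ iB).
apply: ae_mono (ae_and aet conjugate_time) => t [H1 H2]; rewrite /= in_itv /= => tT.
have [w [p [m [adm aex p1 _]]]] := H2 tT.
have [mw mp mm] := admissible_measurable adm.
have t0 := tau_gt0 tT; have a1 := dc_gt0 dc ltr01 (lexx 1).
have st : 0 <= s * tau t ^+ 4 by rewrite mulr_ge0 ?exprn_ge0 // ltW.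
have iSt : mu.-integrable I01 (EFin \o multiplier_defect t).
  by have := H1 _; rewrite /= in_itv /= => /(_ tT).
have mia := inv_coef_measurable dc.
have mpsi := psi_measurable dc c lam.
have mid : measurable_fun I01 (fun x : R => x) by exact: measurable_id.
have mr : measurable_fun I01 (fun x : R => x ^+ 2 / a x).
  by apply: measurable_funM => //; exact: measurable_funX.
have h := carleman_multiplier dc c lam_gt0 (ft t) st adm.
apply: le_trans (_ : - (s * tau t ^+ 4 * lam * (p 1 ^+ 2 / a 1)) <= _).
  rewrite mulNr lerN2 p1 exprMn.
  have -> : s * tau t ^+ 4 * lam * (z t 1 ^+ 2 * boundary_flux a ux Mu t ^+ 2 / a 1) =
    s * lam * a 1 * tau t ^+ 4 * (boundary_flux a ux Mu t / a 1) ^+ 2 * z t 1 ^+ 2.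
    by field; rewrite gt_eqF.
  have -> : s * lam * a 1 * (tau t ^+ 4 * expR (2 * s * (tau t ^+ 4 * psi 1)) *
      (boundary_flux a ux Mu t / a 1) ^+ 2) =
    s * lam * a 1 * tau t ^+ 4 * (boundary_flux a ux Mu t / a 1) ^+ 2 *
      expR (2 * s * (tau t ^+ 4 * psi 1)) by ring.
  apply: ler_wpM2l.
    by rewrite mulr_ge0 ?sqr_ge0 // mulr_ge0 ?exprn_ge0 ?(ltW t0) // mulr_ge0 ?(ltW a1) // mulr_ge0 // ltW.
  rewrite weight_sqr ler_piMl ?expR_ge0 // -expR0 ler_expR mulNr oppr_le0.
  by rewrite mulr_ge0 ?exprn_ge0 ?(ltW t0) // mulr_ge0 // ltW.
apply: (le_trans h); apply: le_of_eq; apply: eq_ae_Rintegral.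
- apply: measurable_funB.
    apply: measurable_funM.
      apply: measurable_funB; first exact: measurable_funN.
      apply: measurable_funM => //; apply: measurable_funD; exact: measurable_funM.
    apply: measurable_funD; last exact: measurable_funM.
    apply: measurable_funM => //; apply: measurable_funM => //.
    exact: measurable_funM.
  apply: measurable_funM => //; apply: measurable_funD.
    by apply: measurable_funM => //; apply: measurable_funM => //; exact: measurable_funX.
  by apply: measurable_funM => //; apply: measurable_funM => //; exact: measurable_funX.
- exact: L1_measurable iSt.
apply: ae_mono aex => x H x01; have [e1 e2 e3 e4] := H x01; have /andP[x0 x1] := x01.
rewrite /multiplier_defect /sym_part /anti_part /potential e1 e2 e3 e4 -(rho2E x0 (ltW x1)); ring.
Qed.

Lemma conjugate_time_L2 : {ae mu, forall t, 0 < t < T ->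
  [/\ L2_01 (conj_sol t), L2_01 (conj_flux t) & L2_01 (conj_op t)]}.
Proof.
apply: ae_mono (ae_and (L2_Q_tsec (flat_L2 flat_conj_sol)) (ae_and (L2_Q_tsec (flat_L2 flat_conj_flux))
  (L2_Q_tsec (flat_L2 flat_conj_op)))) => t [h1 [h2 h3]] tT.
by split; [exact: h1|exact: h2|exact: h3].
Qed.

Lemma zero_admissible : space_admissible k a (fun=> 0) (fun=> 0) (fun=> 0).
Proof.
have L0 : L2_01 (fun=> 0 : R).
  split; first exact: measurable_cst.
  by under eq_integral do rewrite expr0n; rewrite integral0.
split=> //.
- by move=> d _ _; exact: abs_continuous_cst.
- by move=> d _ _; exact: abs_continuous_cst.
- by move=> x _ _; rewrite mul0r; exact: is_derive1_cst.
- by apply: aeW => x _; exact: is_derive1_cst.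
- by apply: eq_L2 L0 => x _; rewrite mul0r.
rewrite /vanishing_at0; case: (k).
  split; last by exists 0 => x _ _; rewrite normr0.
  by move=> e e0; exists 1 => // x _ _ _; rewrite normr0 ltW.
by exists 0 => x _ _; rewrite expr0n mul0r.
Qed.

(** The conjugated elliptic operator pairs with the time derivative as the
    derivative of the energy, which vanishes at both ends. *)
Lemma time_pairing_ge0 : 0 <= \int[mu2]_(y in QT T) (- conj_op y.1 y.2 * conj_dt y.1 y.2).
Proof.
pose W t x := if 0 < t < T then conj_sol t x else 0.
pose E t := if 0 < t < T then 2^-1 * \int[mu]_(x in I01) conj_flux t x ^+ 2 else 0.
have iG := fint 0 (mcst 1) flat_conj_flux flat_conj_flux; rewrite QT_rectangle in iG.
have [_ itG _] := fubini_rectangle1 mD mI iG.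
apply: (energy_pairing (W := W) (E := E) (Z := fun t x => - conj_op t x)).
- apply: (eq_measurable_fun (fun y : Q => conj_sol y.1 y.2)).
    by move=> [t x] /set_mem [/= tT _]; rewrite /W tT.
  exact: L2_measurable (flat_L2 flat_conj_sol).
- exact: flat_L2 flat_conj_dt.
- exact: flat_L2 (flatN flat_conj_op).
- by move=> t x; rewrite /W; case: ifP.
- apply: ae_mono (ae_and (L2_Q_xsec (flat_L2 flat_conj_dt)) (L2_Q_xsec (sol_ut_L2 sol))) => x [h1 h2] x01.
  have /andP[x0 x1] := x01; have Lx := h2 x01.
  have [B B0 UB] := primitive_bounded (u0 x) Lx.
  move=> t tT; rewrite /W tT.
  exact: (conjugate_primitive (U := U^~ x) T0 eps0 s0 M0 psiM x0 x1 (fun d e => primitive_ac (u0 x) Lx (e := e))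
    (primitive_derive (u0 x) Lx) UB (L2_L1_itv (h1 x01)) tT).
- have := L1Z mD 2^-1 itG; apply: eq_integrable => // t /set_mem; rewrite /= in_itv /= => tT.
  rewrite /E tT; congr EFin; congr (_ * _); apply: eq_Rintegral => x _.
  by rewrite expr0 !mul1r expr2.
- move=> t; rewrite /E; case: ifP => // _; rewrite mulr_ge0 ?invr_ge0 //.
  by apply: Rintegral_ge0 => x _; exact: sqr_ge0.
- by move=> t; rewrite /E; case: ifP.
move=> h h0.
have good := ae_and conjugate_time conjugate_time_L2.
apply: ae_mono (ae_and good (ae_shift h good)) => t [[g1 g2] [g3 g4]] tT.
have [w [p [m [adm aex _ _]]]] := g1 tT; have [LW LG LM] := g2 tT.
have [q [r [n [adq aeq Lq Lr]]]] : exists q r n,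
  [/\ space_admissible k a q r n,
    {ae mu, forall x, 0 < x < 1 -> q x = W (t - h) x /\ r x ^+ 2 / a x =
      (if 0 < t - h < T then conj_flux (t - h) x else 0) ^+ 2},
    L2_01 (W (t - h)) & L2_01 (fun x => if 0 < t - h < T then conj_flux (t - h) x else 0)].
  rewrite /W; have [th|nth] := boolP (0 < t - h < T).
    have [q [r [n [adq aeq _ _]]]] := g3 th; have [Lq Lr _] := g4 th.
    exists q, r, n; split=> //.
    by apply: ae_mono aeq => x H x01; have [-> -> _ _] := H x01.
  have [_ _ _ _ L0 _ _ _ _] := zero_admissible.
  exists (fun=> 0), (fun=> 0), (fun=> 0); split=> //; first exact: zero_admissible.
  by apply: aeW => x _; rewrite expr0n mul0r.
have [mw mp mm] := admissible_measurable adm.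
have [mq mr mn] := admissible_measurable adq.
have mia := inv_coef_measurable dc.
set G' := (fun x => if 0 < t - h < T then conj_flux (t - h) x else 0) in aeq Lr.
have EtE : E (t - h) = 2^-1 * \int[mu]_(x in I01) G' x ^+ 2.
  rewrite /E /G'; case: ifP => // _.
  by rewrite (_ : \int[mu]_(x in I01) _ = 0) ?mulr0 // /Rintegral integral0_eq // => x _; rewrite expr0n.
have i1 := L2M mI LM (L2B mI LW Lq).
have i2 := L2_sqr LG; have i3 := L2_sqr Lr.
have WtE : W t = conj_sol t by apply/funext => x; rewrite /W tT.
have h' := energy_subgradient dc adm adq.
rewrite EtE {1}/E tT -subr_ge0.
have e0 : \int[mu]_(x in I01) (- conj_op t x * (W t x - W (t - h) x)) =
  - \int[mu]_(x in I01) (conj_op t x * (conj_sol t x - W (t - h) x)).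
  rewrite -[RHS]mulN1r -RintegralZl //; apply: eq_Rintegral => x _.
  by rewrite WtE; ring.
suff : 0 <= - (\int[mu]_(x in I01) (conj_op t x * (conj_sol t x - W (t - h) x))) +
  2^-1 * (\int[mu]_(x in I01) G' x ^+ 2 - \int[mu]_(x in I01) conj_flux t x ^+ 2).
  by rewrite e0; move: (Rintegral _ _ _) (Rintegral _ _ _) (Rintegral _ _ _) => *; lra.
have -> : - (\int[mu]_(x in I01) (conj_op t x * (conj_sol t x - W (t - h) x))) +
  2^-1 * (\int[mu]_(x in I01) G' x ^+ 2 - \int[mu]_(x in I01) conj_flux t x ^+ 2) =
  \int[mu]_(x in I01) (- 1 * (conj_op t x * (conj_sol t x - W (t - h) x)) + 2^-1 * (G' x ^+ 2 - conj_flux t x ^+ 2)).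
  rewrite RintegralD //; [|exact: L1Z|exact: (L1Z mI _ (L1B mI i3 i2))].
  rewrite !RintegralZl //; last exact: (L1B mI i3 i2).
  by rewrite RintegralB // mulN1r.
apply: (le_trans h'); apply: le_of_eq; apply: eq_ae_Rintegral.
- apply: measurable_funD; first by apply: measurable_funM => //; exact: measurable_funB.
  by apply: measurable_funM => //; apply: measurable_funB; apply: measurable_funM => //; exact: measurable_funX.
- by have := L1D mI (L1Z mI (- 1) i1) (L1Z mI 2^-1 (L1B mI i3 i2)); exact: L1_measurable.
apply: ae_mono (ae_and aex aeq) => x [H1 H2] x01.
have [e1 e2 _ e4] := H1 x01; have [e5 e6] := H2 x01.
by rewrite e1 e2 e4 e5 e6 /G'; ring.
Qed.

End carleman_for_solution.

(** * The regularised estimate *)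

Section integrated_estimate.
Context {R : realType} (k : degeneracy).
Variables (T : R) (a a' : R -> R) (K c lam : R) (tc : R -> R -> R).
Hypotheses (T0 : 0 < T) (dc : degenerate_coefficient a a' K) (lam_gt0 : 0 < lam) (c1 : 1 < c)
  (tcL : Linfty_Q T tc).
Notation mu := (@lebesgue_measure R).
Notation mu2 := (mu \x mu)%E.
Local Notation DT := (`]0, T[%classic : set (measurableTypeR R)).
Local Notation I01 := (`]0, 1[%classic : set (measurableTypeR R)).
Local Notation Q := (plane R).
Local Notation psi := (psi a c lam).
Local Notation tau := (tau T).
Local Notation rho x := (x / Num.sqrt (a x)).

(** Where [psi <= - lam] the weight itself absorbs the powers of [tau];
    elsewhere [x^2 / a] is bounded below. *)
Lemma weight_absorbs s eps t x : 1 <= s -> 0 < eps -> 0 < t < T -> 0 < x -> x < 1 ->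
  forall v, ((T - 2 * t) * tau t ^+ 6 * (weight T eps s psi t x * v)) ^+ 2 <=
  T ^+ 2 / ((2 - K) * (c - 1)) *
    (tau t ^+ 12 * rho x ^+ 2 * (weight T eps s psi t x * v) ^+ 2)
  + T ^+ 2 * (3 / (2 * s * lam)) ^+ 3 * v ^+ 2.
Proof.
move=> s1 e0 tT x0 x1 v; set z := weight T eps s psi t x.
have t0 := tau_gt0 tT; have s0 : 0 < s := lt_le_trans ltr01 s1.
have l2 : (T - 2 * t) ^+ 2 <= T ^+ 2.
  rewrite -[(T - 2 * t) ^+ 2]real_normK ?num_real // lerXn2r ?nnegrE ?(ltW T0) //.
  by move: tT => /andP[? ?]; rewrite ler_norml; apply/andP; split; lra.
have -> : ((T - 2 * t) * tau t ^+ 6 * (z * v)) ^+ 2 =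
  (T - 2 * t) ^+ 2 * (tau t ^+ 12 * (z * v) ^+ 2) by ring.
apply: (@le_trans _ _ (T ^+ 2 * (tau t ^+ 12 * (z * v) ^+ 2))).
  by apply: ler_wpM2r l2; rewrite mulr_ge0 ?sqr_ge0 // exprn_ge0 // ltW.
have K2 := K2_gt0 dc.
have kc : 0 < (2 - K) * (c - 1) by rewrite mulr_gt0 // subr_gt0.
have [neg|rlow] := psi_dichotomy dc c lam_gt0 x0 (ltW x1).
  rewrite -[leLHS]add0r; apply: lerD.
    rewrite mulr_ge0 ?divr_ge0 ?sqr_ge0 ?(ltW kc) //.
    by rewrite mulr_ge0 ?sqr_ge0 // mulr_ge0 ?sqr_ge0 // exprn_ge0 // ltW.
  rewrite -[leRHS]mulrA; apply: ler_wpM2l; first exact: sqr_ge0.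
  rewrite exprMn mulrA; apply: ler_wpM2r; first exact: sqr_ge0.
  pose y := 2 * s * lam * tau t ^+ 4.
  have sl : 0 < 2 * s * lam by rewrite !mulr_gt0.
  have y0 : 0 < y by rewrite mulr_gt0 // exprn_gt0.
  have zy : z ^+ 2 <= expR (- y).
    rewrite /z weight_sqr -[leRHS]mul1r; apply: ler_pM; rewrite ?expR_ge0 //.
      rewrite -expR0 ler_expR mulNr oppr_le0.
      by apply: mulr_ge0; [apply: mulr_ge0 => //; exact: ltW|apply: exprn_ge0; exact: ltW].
    rewrite ler_expR (_ : - y = 2 * s * (tau t ^+ 4 * - lam)); last by rewrite /y; ring.
    apply: ler_wpM2l; first by rewrite mulr_ge0 // ltW.
    by apply: ler_wpM2l => //; rewrite exprn_ge0 // ltW.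
  have ey : (y / 3) ^+ 3 <= expR y.
    have -> : expR y = expR (y / 3) ^+ 3 by rewrite -expRM_natl; congr expR; field.
    rewrite lerXn2r ?nnegrE ?expR_ge0 ?divr_ge0 ?(ltW y0) //.
    by apply: le_trans (expR_ge1Dx _); rewrite lerDr.
  have -> : tau t ^+ 12 = (3 / (2 * s * lam)) ^+ 3 * (y / 3) ^+ 3.
    by rewrite /y; field; rewrite !gt_eqF.
  rewrite -(mulrA ((3 / (2 * s * lam)) ^+ 3)); apply: ler_piMr.
    by apply: exprn_ge0; rewrite divr_ge0 // ltW.
  apply: (@le_trans _ _ (expR y * expR (- y))); last by rewrite -expRD subrr expR0.
  apply: ler_pM => //; [|exact: sqr_ge0].
  by rewrite exprn_ge0 // divr_ge0 // ltW.
rewrite -[leLHS]addr0; apply: lerD; last first.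
  by rewrite mulr_ge0 ?sqr_ge0 // mulr_ge0 ?sqr_ge0 // exprn_ge0 // divr_ge0 // !mulr_ge0 // ltW.
rewrite (rho2E dc x0 (ltW x1)).
have -> : T ^+ 2 / ((2 - K) * (c - 1)) * (tau t ^+ 12 * (x ^+ 2 / a x) * (z * v) ^+ 2) =
  (x ^+ 2 / a x) / ((2 - K) * (c - 1)) * (T ^+ 2 * (tau t ^+ 12 * (z * v) ^+ 2)) by ring.
apply: ler_peMl.
  by rewrite mulr_ge0 ?sqr_ge0 // mulr_ge0 ?sqr_ge0 // exprn_ge0 // ltW.
by rewrite ler_pdivlMr // mul1r.
Qed.

(** The integrands of the final estimate at [eps = 0], with the trace of the
    derivative replaced by the measurable boundary flux. *)
Definition boundary_density (ux Mu : R -> R -> R) s t : R :=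
  tau t ^+ 4 * expR (2 * s * (tau t ^+ 4 * psi 1)) * (boundary_flux a ux Mu t / a 1) ^+ 2.

Definition carleman_density (v ut ux Mu : R -> R -> R) s (y : Q) : R :=
  ((s * tau y.1 ^+ 4)^-1 * (ut y.1 y.2 ^+ 2 + Mu y.1 y.2 ^+ 2)
   + s * tau y.1 ^+ 4 * (Num.sqrt (a y.2) * ux y.1 y.2) ^+ 2
   + s ^+ 3 * tau y.1 ^+ 12 * rho y.2 ^+ 2 * v y.1 y.2 ^+ 2)
  * expR (2 * s * (tau y.1 ^+ 4 * psi y.2)).

Let mQ := measurable_QT T.
Let mD : measurable DT. Proof. exact: measurable_itv. Qed.

Lemma multiplier_inv_tau : multiplier T (fun y => y.1 * (T - y.1)).
Proof.
split.
  apply: measurable_funM; last apply: measurable_funB => //;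
  by apply: measurable_funS measurableT (@subsetT _ _) _; exact: measurable_fst.
exists (T * T) => -[t x] [/= /andP[t0' tT] _]; apply: ler_normM.
  by rewrite ger0_norm ltW.
by rewrite ger0_norm ?subr_ge0 ?(ltW tT) // gerBl ltW.
Qed.

(** Integration of [carleman_pointwise] over [Q]. The factor
    [exp (- 2 eps tau^5)] is all that separates the left-hand side from the
    unregularised one, and the error is of order [eps^2]. *)
Lemma carleman_regularized : exists C sm : R, [/\ 0 < C, 1 <= sm &
  forall (u0 : R -> R) (f u ut ux Mu : R -> R -> R), L2_01 u0 -> L2_Q T f ->
  is_solution k T a tc u0 f u ut ux Mu -> forall s, sm <= s ->
  mu.-integrable DT (EFin \o boundary_density ux Mu s) ->
  mu2.-integrable (QT T) (EFin \o (fun y =>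
    f y.1 y.2 ^+ 2 * expR (2 * s * (tau y.1 ^+ 4 * psi y.2)))) ->
  exists D : R, forall eps, 0 < eps -> eps <= 1 ->
  (\int[mu2]_(y in QT T)
     (expR (- (2 * eps) * tau y.1 ^+ 5) * carleman_density (primitive u0 ut) ut ux Mu s y)%:E <=
   (C * (\int[mu2]_(y in QT T) (f y.1 y.2 ^+ 2 * expR (2 * s * (tau y.1 ^+ 4 * psi y.2)))
         + s * a 1 * \int[mu]_(t in DT) boundary_density ux Mu s t) + eps ^+ 2 * D)%:E)%E].
Proof.
have [M M0 psiM] := psi_bounded dc c lam_gt0.
have K2 := K2_gt0 dc.
have a1 := dc_gt0 dc ltr01 (lexx 1).
have [mtc [Mc0 tcb]] := tcL.
pose C1 := T ^+ 2 / ((2 - K) * (c - 1)).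
have C10 : 0 <= C1.
  by apply: divr_ge0; [exact: sqr_ge0|apply: mulr_ge0; [exact: ltW|rewrite subr_ge0 ltW]].
have a1V : 0 <= (a 1)^-1 by rewrite invr_ge0 ltW.
have tau00 : 0 < 4 / T ^+ 2 by rewrite divr_gt0 ?exprn_gt0.
have [A [C [kap [del [sm [[A0 C0 kap0 del0 sm1] main]]]]]] :=
  @carleman_pointwise R T lam (2 - K) M (a 1)^-1 `|Mc0| C1 (4 / T ^+ 2) T0 lam_gt0 K2 (ltW M0) a1V C10 tau00.
exists (C + 2 * A * lam), sm; split => //.
  by rewrite ltr_wpDr // mulr_ge0 ?mulr_ge0 // ltW.
move=> u0 f u ut ux Mu Lu0 Lf sol s sms iB iF.
have s1 := le_trans sm1 sms; have s0 : 0 < s := lt_le_trans ltr01 s1.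
have LU := primitive_L2 Lu0 sol.
pose Cs := T ^+ 2 * (3 / (2 * s * lam)) ^+ 3.
have Cs0 : 0 <= Cs by rewrite mulr_ge0 ?sqr_ge0 // exprn_ge0 // divr_ge0 // !mulr_ge0 // ltW.
pose Eu (y : Q) := Cs * primitive u0 ut y.1 y.2 ^+ 2.
have iEu : mu2.-integrable (QT T) (EFin \o Eu) by exact: (L1Z mQ Cs (L2_sqr LU)).
exists (C * \int[mu2]_(y in QT T) Eu y) => eps eps0 eps1.
have psiM' x (x0 : 0 < x) (x1 : x <= 1) := psiM x x0 x1.
have fz g : L2_Q T g -> flat T (fun t x => weight T eps s psi t x * g t x).
  by apply: flat_weighted eps0 (ltW s0) (ltW M0) psiM (psi_measurable dc c lam) g.
pose W := conj_sol T a c lam u0 ut s eps.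
pose V := conj_dt T a c lam u0 ut s eps.
pose G := conj_flux T a c lam u0 ut ux s eps.
pose MM := conj_op T a c lam u0 ut ux Mu s eps.
have fV : flat T V := flat_conj_dt dc Lu0 sol s1 eps0 (ltW M0) psiM.
have fMM : flat T MM := flat_conj_op dc Lu0 sol s1 eps0 (ltW M0) psiM.
have fW : flat T W := flat_conj_sol dc Lu0 sol s1 eps0 (ltW M0) psiM.
have T1 := time_pairing_ge0 T0 dc lam_gt0 Lu0 sol s1 eps0 (ltW M0) psiM.
have T2 := potential_density_eq0 T0 dc Lu0 sol s1 eps0 (ltW M0) psiM.
have S1 := multiplier_defect_ge dc lam_gt0 Lu0 sol s1 eps0 (ltW M0) psiM iB.
have H1 := hardy_density_ge0 dc lam_gt0 Lu0 sol s1 eps0 (ltW M0) psiM del0.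
have iT := integrable_potential_density dc Lu0 sol s1 eps0 (ltW M0) psiM.
have iS := integrable_multiplier_defect dc Lu0 sol s1 eps0 (ltW M0) psiM.
have iH := integrable_hardy_density dc Lu0 sol s1 eps0 (ltW M0) psiM del.
have i1 : mu2.-integrable (QT T) (EFin \o (fun y => - MM y.1 y.2 * V y.1 y.2)).
  by have := L2M mQ (flat_L2 (flatN fMM)) (flat_L2 fV).
pose zf (y : Q) := (weight T eps s psi y.1 y.2 * f y.1 y.2) ^+ 2.
have izf : mu2.-integrable (QT T) (EFin \o zf) by exact: L2_sqr (flat_L2 (fz _ Lf)).
pose N (y : Q) := expR (- (2 * eps) * tau y.1 ^+ 5) * carleman_density (primitive u0 ut) ut ux Mu s y.
have iN : mu2.-integrable (QT T) (EFin \o N).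
  have j1 := flat_integrable 0 (multiplierX 4 multiplier_inv_tau) (fz _ (sol_ut_L2 sol)) (fz _ (sol_ut_L2 sol)).
  have j2 := flat_integrable 0 (multiplierX 4 multiplier_inv_tau) (fz _ (sol_Mu_L2 sol)) (fz _ (sol_Mu_L2 sol)).
  have j3 := flat_integrable 4 (multiplier_cst T s) (fz _ (sol_ux_L2 sol)) (fz _ (sol_ux_L2 sol)).
  have j4 := flat_integrable 12 (multiplierM (multiplier_cst T (s ^+ 3)) (multiplierX 2 (multiplier_rho T dc))) fW fW.
  have := L1D mQ (L1D mQ (L1Z mQ s^-1 (L1D mQ j1 j2)) j3) j4.
  apply: eq_integrable => // -[t x] /set_mem[/= tT x01] /=; congr EFin.
  rewrite /N /carleman_density /= /W /conj_sol.
  have e : (s * tau t ^+ 4)^-1 = s^-1 * (t * (T - t)) ^+ 4.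
    by rewrite (_ : tau t = (t * (T - t))^-1) // invfM exprVn invrK.
  rewrite e [RHS]mulrC -[RHS]mulrA (mulrC (expR _) (expR _)) -weight_sqr; ring.
pose B := \int[mu]_(t in DT) boundary_density ux Mu s t.
have ae_main : {ae mu2, forall y, QT T y -> N y <=
   C * (zf y + eps ^+ 2 * Eu y) + A * (- 2 * (- MM y.1 y.2 * V y.1 y.2)
     + potential_density T a c lam u0 ut s eps y.1 y.2 - 2 * multiplier_defect T a K c lam u0 ut ux Mu s eps y.1 y.2)
   - kap * hardy_density T a c lam u0 ut ux s eps del y.1 y.2}.
  apply: ae_mono (ae_and (sol_eq sol) (ae_and (primitive_ae Lu0 sol) tcb)) => -[t x] [e1 [e2 e3]] Qz.
  have {}e1 := e1 Qz; have {}e2 := e2 Qz; have {}e3 := e3 Qz.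
  have [/= tT /andP[x0 x1]] := Qz; rewrite /= in e1 e2 e3.
  have t0 := tau_gt0 tT.
  set z := weight T eps s psi t x.
  have v2 : (z * (tc t x * primitive u0 ut t x)) ^+ 2 <= `|Mc0| ^+ 2 * W t x ^+ 2.
    rewrite /W /conj_sol -/z (_ : (z * _) ^+ 2 = tc t x ^+ 2 * (z * primitive u0 ut t x) ^+ 2); last by ring.
    apply: ler_wpM2r; first exact: sqr_ge0.
    rewrite -[tc t x ^+ 2]real_normK ?num_real //.
    by apply: lerXn2r; rewrite ?nnegrE // (le_trans e3) // ler_norm.
  have Eu0 : 0 <= Eu (t, x) by rewrite mulr_ge0 ?sqr_ge0.
  have lT : `|T - 2 * t| <= T.
    by move: tT => /andP[? ?]; rewrite ler_norml; apply/andP; split; lra.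
  have rb : rho x ^+ 2 <= (a 1)^-1 by rewrite (rho2E dc x0 (ltW x1)) (ratio2_bound dc x0 (ltW x1)).
  have eps01 : 0 <= eps <= 1 by rewrite (ltW eps0).
  have absb := weight_absorbs s1 eps0 tT x0 x1 (primitive u0 ut t x).
  have eqF : sym_part T a c lam u0 ut ux Mu s eps t x + (V t x + anti_part T a c lam u0 ut ux s eps t x) =
      z * f t x - z * (tc t x * primitive u0 ut t x) + 5 * eps * ((T - 2 * t) * tau t ^+ 6 * W t x).
    rewrite -e1 -e2 /sym_part /anti_part /potential /V /conj_dt /W /conj_flux /conj_op /conj_sol /weight_rate -/z; ring.
  have key := main s eps (tau t) (T - 2 * t) (psi x) (rho x) (W t x) (G t x) (V t x) (MM t x)
    (z * f t x) (z * (tc t x * primitive u0 ut t x)) (Eu (t, x)) sms eps01 (tau_ge T0 tT) lT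
    (psiM x x0 (ltW x1)) rb v2 Eu0 absb eqF.
  apply: le_trans (le_trans key _); last exact: lexx.
  apply: le_of_eq.
  have -> : V t x - (5 * eps * (T - 2 * t) * tau t ^+ 6 + - 4 * s * (T - 2 * t) * tau t ^+ 5 * psi x) * W t x
    = z * ut t x by rewrite /V /conj_dt /W /conj_sol /weight_rate -/z; ring.
  have -> : MM t x - (2 * (s * tau t ^+ 4) * lam * (rho x * G t x) + s * tau t ^+ 4 * lam * W t x)
    + (s * tau t ^+ 4) ^+ 2 * lam ^+ 2 * rho x ^+ 2 * W t x = z * Mu t x.
    by rewrite /MM /conj_op /G /conj_flux /W /conj_sol -/z; ring.
  have -> : G t x - s * tau t ^+ 4 * lam * rho x * W t x = z * (Num.sqrt (a x) * ux t x).
    by rewrite /G /conj_flux /W /conj_sol -/z; ring.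
  rewrite /N /carleman_density /= [LHS]mulrC -[LHS]mulrA (mulrC (expR _) (expR _)) -weight_sqr -/z /W /conj_sol -/z.
  ring.
have iR : mu2.-integrable (QT T) (EFin \o (fun y => C * (zf y + eps ^+ 2 * Eu y)
   + A * (- 2 * (- MM y.1 y.2 * V y.1 y.2)
     + potential_density T a c lam u0 ut s eps y.1 y.2 - 2 * multiplier_defect T a K c lam u0 ut ux Mu s eps y.1 y.2)
   - kap * hardy_density T a c lam u0 ut ux s eps del y.1 y.2)).
  apply: (L1B mQ _ (L1Z mQ kap iH)).
  apply: (L1D mQ (L1Z mQ C (L1D mQ izf (L1Z mQ (eps ^+ 2) iEu)))).
  exact: (L1Z mQ A (L1B mQ (L1D mQ (L1Z mQ (- 2) i1) iT) (L1Z mQ 2 iS))).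
have le := ae_le_Rintegral mQ iN iR ae_main.
have leF : \int[mu2]_(y in QT T) zf y <=
    \int[mu2]_(y in QT T) (f y.1 y.2 ^+ 2 * expR (2 * s * (tau y.1 ^+ 4 * psi y.2))).
  apply: (le_Rintegral mQ izf iF) => -[t x] [/= tT x01].
  rewrite /zf /= exprMn mulrC ler_wpM2l ?sqr_ge0 // weight_sqr ler_piMl ?expR_ge0 //.
  rewrite -expR0 ler_expR mulNr oppr_le0.
  by rewrite mulr_ge0 ?exprn_ge0 ?(ltW (tau_gt0 tT)) // mulr_ge0 // ltW.
have B0 : 0 <= B.
  apply: Rintegral_ge0 => t _; rewrite mulr_ge0 ?sqr_ge0 // mulr_ge0 ?expR_ge0 //.
  by rewrite -thetaE /theta invr_ge0 mulr_ge0 // -[4%N]/(2 * 2)%N exprM sqr_ge0.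
have F0 : 0 <= \int[mu2]_(y in QT T) (f y.1 y.2 ^+ 2 * expR (2 * s * (tau y.1 ^+ 4 * psi y.2))).
  by apply: Rintegral_ge0 => y _; rewrite mulr_ge0 ?sqr_ge0 // expR_ge0.
have finN : (\int[mu2]_(y in QT T) (N y)%:E)%E = (\int[mu2]_(y in QT T) N y)%:E.
  rewrite /Rintegral fineK //; exact: integrable_fin_num.
rewrite -/B [X in (X <= _)%E]finN lee_fin; apply: (le_trans le).
have j1 := L1D mQ izf (L1Z mQ (eps ^+ 2) iEu).
have j2 := L1D mQ (L1Z mQ (- 2) i1) iT.
have j3 := L1B mQ j2 (L1Z mQ 2 iS).
rewrite (RintegralB mQ (L1D mQ (L1Z mQ C j1) (L1Z mQ A j3)) (L1Z mQ kap iH)).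
rewrite (RintegralD mQ (L1Z mQ C j1) (L1Z mQ A j3)).
rewrite (RintegralZl C mQ j1) (RintegralZl A mQ j3) (RintegralZl kap mQ iH).
rewrite (RintegralD mQ izf (L1Z mQ (eps ^+ 2) iEu)) (RintegralZl (eps ^+ 2) mQ iEu).
rewrite (RintegralB mQ j2 (L1Z mQ 2 iS)) (RintegralD mQ (L1Z mQ (- 2) i1) iT).
rewrite (RintegralZl (- 2) mQ i1) (RintegralZl 2 mQ iS) T2.
move: T1 S1 H1 leF B0 F0; rewrite -/(boundary_density ux Mu s) -/B.
move: (Rintegral _ _ zf) (Rintegral _ _ Eu) => Iz IE.
move: (Rintegral _ _ _) (Rintegral _ _ _) (Rintegral _ _ _) (Rintegral _ _ _) => I1 I2 I3 I4.
move=> T1 S1 H1 leF B0 F0.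
have sa : 0 <= s * a 1 * B by rewrite mulr_ge0 // mulr_ge0 // ltW.
have p1 := ler_wpM2l (ltW C0) leF; have p2 := mulr_ge0 A0 T1; have p3 := ler_wpM2l A0 S1.
have p4 := mulr_ge0 kap0 H1; have p5 := mulr_ge0 (mulr_ge0 A0 (ltW lam_gt0)) F0.
have p6 := mulr_ge0 (ltW C0) sa.
lra.
Qed.

End integrated_estimate.

(** * Removal of the regularisation *)

(** Monotonicity of the integral of nonnegative functions when the larger one
    need not be measurable: the integral is a supremum over the simple
    functions below. *)
Lemma ae_ge0_le_integral_any (R : realType) (X : set (measurableTypeR R))
    (f g : R -> R) : measurable X -> measurable_fun X f ->
  (forall x, X x -> 0 <= f x) -> (forall x, X x -> 0 <= g x) ->
  {ae leb R, forall x, X x -> f x <= g x} ->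
  (\int[leb R]_(x in X) (f x)%:E <= \int[leb R]_(x in X) (g x)%:E)%E.
Proof.
move=> mX mf f0 g0 [N [mN N0 sN]].
have mEf : measurable_fun X (EFin \o f) by exact/measurable_EFinP.
rewrite (ge0_negligible_integral mN mX mEf _ N0); last first.
  by move=> x Xx; rewrite lee_fin f0.
rewrite ge0_integralE; last by move=> x [Xx _]; rewrite lee_fin f0.
rewrite ge0_integralE; last by move=> x Xx; rewrite lee_fin g0.
apply: le_ereal_sup => _ [h hf <-]; exists h => //= x.
apply: le_trans (hf x) _; rewrite !patchE.
case: ifPn => [/set_mem [Xx nNx]|_].
  rewrite mem_set // lee_fin; have [//|nle] := boolP (f x <= g x).
  by exfalso; apply: nNx; apply: sN => /= /(_ Xx) H; rewrite H in nle.
by case: ifPn => // /set_mem Xx; rewrite lee_fin g0.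
Qed.

Section limit.
Context {R : realType} (k : degeneracy).
Variables (T : R) (a a' : R -> R) (K c lam : R) (tc : R -> R -> R) (u0 : R -> R)
  (f u ut ux Mu : R -> R -> R).
Hypotheses (dc : degenerate_coefficient a a' K)
  (sol : is_solution k T a tc u0 f u ut ux Mu).
Notation mu := (@lebesgue_measure R).
Notation mu2 := (mu \x mu)%E.
Local Notation DT := (`]0, T[%classic : set (measurableTypeR R)).
Local Notation I01 := (`]0, 1[%classic : set (measurableTypeR R)).
Local Notation Q := (plane R).
Local Notation psi := (psi a c lam).
Local Notation tau := (tau T).

Let mQ := measurable_QT T.
Let mD : measurable DT. Proof. exact: measurable_itv. Qed.
Let mI : measurable I01. Proof. exact: measurable_itv. Qed.

Lemma L2_Q_integrable (g : R -> R -> R) : L2_Q T g -> mu2.-integrable (QT T) (EFin \o (fun y => g y.1 y.2)).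
Proof.
move=> Lg.
have Qfin : (mu2 (QT T) < +oo)%E.
  rewrite QT_rectangle; have -> := @product_measure1E _ _ _ _ _ mu mu _ _ mD mI.
  by apply: lte_mul_pinfty; rewrite ?ge0_fin_numE ?lebesgue_measure_oo_fin.
exact: (L2_L1 mQ Qfin Lg).
Qed.

Lemma boundary_flux_measurable : measurable_fun DT (boundary_flux a ux Mu).
Proof.
have mA : measurable (`]2^-1, 1[%classic : set (measurableTypeR R)) by exact: measurable_itv.
pose A := (`]2^-1, 1[%classic : set (measurableTypeR R)).
have m1A : measurable_fun I01 (\1_A : measurableTypeR R -> R) by apply: measurable_indic.
have indb x : `|\1_A x : R| <= 1 by rewrite indicE; case: (_ \in _); rewrite ?normr1 ?normr0.
have h2 : 2^-1 < 1 :> R by rewrite invf_lt1 // ltr1n.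
have h0 : 0 < 2^-1 :> R by rewrite invr_gt0.
have [B B0 aB] := abs_continuous_bounded (ltW h2) (dc_ac dc h0 h2).
have m1 : multiplier T (fun y => \1_A y.2 * (2 * Num.sqrt (a y.2))).
  split.
    apply: (@measurable_space R T (fun x => \1_A x * (2 * Num.sqrt (a x)))).
    apply: measurable_funM => //; apply: measurable_funM => //; exact: sqrt_coef_measurable dc.
  exists (2 * (1 + B)) => -[t x] [_ /= /andP[x0 x1]].
  have B1 : 0 <= 2 * (1 + B) by rewrite mulr_ge0 // addr_ge0.
  rewrite indicE; have [/set_mem/=|_] := boolP (x \in A); last by rewrite mul0r normr0.
  rewrite /A /= in_itv /= => /andP[x2 _]; rewrite mul1r normrM ger0_norm // ler_wpM2l //.
  rewrite ger0_norm ?sqrtr_ge0 //.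
  have := aB x; rewrite (ltW x2) (ltW x1) => /(_ isT) /(le_trans (ler_norm _)).
  have := sqrt_coefK dc x0 (ltW x1).
  by have := sqr_ge0 (Num.sqrt (a x) - 2^-1); move: (Num.sqrt (a x)) => y; lra.
have m2 : multiplier T (fun y => \1_A y.2 * (2 * y.2 - 1)).
  split.
    apply: (@measurable_space R T (fun x => \1_A x * (2 * x - 1))).
    have ml : measurable_fun I01 (fun x : R => 2 * x - 1).
      by apply: measurable_funB => //; apply: measurable_funM => //; exact: measurable_id.
    exact: measurable_funM.
  exists (1 * 1) => -[t x] [_ /= /andP[x0 x1]]; apply: ler_normM; first exact: indb.
  by rewrite ler_norml; apply/andP; split; lra.
have [mm1 [B1 b1]] := m1; have [mm2 [B2 b2]] := m2.
have Lh : L2_Q T (fun t x => \1_A x * (2 * Num.sqrt (a x)) * (Num.sqrt (a x) * ux t x)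
    + \1_A x * (2 * x - 1) * Mu t x).
  exact: (L2D mQ (bounded_L2 mQ mm1 b1 (sol_ux_L2 sol)) (bounded_L2 mQ mm2 b2 (sol_Mu_L2 sol))).
have := L2_Q_integrable Lh; rewrite QT_rectangle => /(fubini_rectangle1 mD mI)[_ ih _].
apply: (eq_measurable_fun _ _ (L1_measurable ih)) => t _.
by apply: eq_Rintegral => x _ /=; rewrite -/A; ring.
Qed.

Lemma boundary_density_measurable s : measurable_fun DT (boundary_density T a c lam ux Mu s).
Proof.
have mt := @tau_measurable R T.
apply: measurable_funM; last first.
  by apply: measurable_funX; apply: measurable_funM => //; exact: boundary_flux_measurable.
apply: measurable_funM; first exact: measurable_funX.
apply: measurableT_comp; first exact: measurable_expR.
apply: measurable_funM; first exact: measurable_cst.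
by apply: measurable_funM => //; exact: measurable_funX.
Qed.

Lemma carleman_density_measurable v s : L2_Q T v ->
  measurable_fun (QT T) (carleman_density T a c lam v ut ux Mu s).
Proof.
move=> LU; have mt := measurable_time (@tau_measurable R T).
have mrho := @measurable_space R T _ (root_ratio_measurable dc).
have mpsi := @measurable_space R T _ (psi_measurable dc c lam).
apply: measurable_funM; last first.
  apply: measurableT_comp; first exact: measurable_expR.
  apply: measurable_funM; first exact: measurable_cst.
  by apply: measurable_funM => //; exact: measurable_funX.
apply: measurable_funD.
  apply: measurable_funD.
    apply: measurable_funM.
      apply: (eq_measurable_fun (fun y : Q => s^-1 * (y.1 * (T - y.1)) ^+ 4)).
        by move=> y _; rewrite invfM (_ : tau y.1 = (y.1 * (T - y.1))^-1) // exprVn invrK.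
      apply: measurable_funM => //; apply: measurable_funX.
      exact: (multiplier_inv_tau T).1.
    apply: measurable_funD; apply: measurable_funX.
      exact: L2_measurable (sol_ut_L2 sol).
    exact: L2_measurable (sol_Mu_L2 sol).
  apply: measurable_funM.
    by apply: measurable_funM => //; exact: measurable_funX.
  by apply: measurable_funX; exact: L2_measurable (sol_ux_L2 sol).
apply: measurable_funM; last by apply: measurable_funX; exact: L2_measurable LU.
apply: measurable_funM; last exact: measurable_funX.
by apply: measurable_funM => //; exact: measurable_funX.
Qed.

(** Removal of the regularising factor by Fatou's lemma. *)
Lemma fatou_regularization (g : Q -> R) (B D : R) : measurable_fun (QT T) g ->
  (forall y, QT T y -> 0 <= g y) -> 
  (forall eps, 0 < eps -> eps <= 1 ->
    (\int[mu2]_(y in QT T) (expR (- (2 * eps) * tau y.1 ^+ 5) * g y)%:E <= (B + eps ^+ 2 * D)%:E)%E) ->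
  (\int[mu2]_(y in QT T) (g y)%:E <= B%:E)%E.
Proof.
move=> mg g0 H; pose e (n : nat) : R := n.+1%:R^-1.
have e0 n : 0 < e n by rewrite invr_gt0.
have e1 n : e n <= 1 by rewrite invf_le1 // ler1n.
have ecv : e n @[n --> \oo] --> (0 : R) by exact: cvg_harmonic.
pose F n y := (expR (- (2 * e n) * tau y.1 ^+ 5) * g y)%:E.
have mF n : measurable_fun (QT T) (F n).
  apply/measurable_EFinP; apply: measurable_funM => //.
  apply: measurableT_comp; first exact: measurable_expR.
  apply: measurable_funM; first exact: measurable_cst.
  by apply: measurable_funX; exact: (measurable_time (@tau_measurable R T)).
have F0 n y : QT T y -> (0 <= F n y)%E.
  by move=> Qy; rewrite lee_fin mulr_ge0 ?expR_ge0 // g0.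
have := fatou mu2 mQ mF F0.
have -> : (\int[mu2]_(y in QT T) limn_einf (F^~ y) = \int[mu2]_(y in QT T) (g y)%:E)%E.
  apply: eq_integral => y _.
  suff cvf : F n y @[n --> \oo] --> (g y)%:E.
    by rewrite is_cvg_limn_einfE; [exact/cvg_lim|apply/cvg_ex; eexists; exact: cvf].
  apply: cvg_EFin; first by near=> n.
  rewrite -[X in _ --> X]mul1r /=; apply: cvgM; last exact: cvg_cst.
  rewrite [X in _ --> X](_ : _ = expR 0); last by rewrite expR0.
  have ce : expR r @[r --> (0 : R)] --> expR (0 : R) by exact: continuous_expR.
  have ci : - (2 * e n) * tau y.1 ^+ 5 @[n --> \oo] --> (0 : R).
    rewrite [X in _ --> X](_ : _ = - (2 * 0) * tau y.1 ^+ 5); last by rewrite mulr0 oppr0 mul0r.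
    apply: cvgM; last exact: cvg_cst.
    by apply: cvgN; apply: cvgM => //; exact: cvg_cst.
  exact: cvg_comp ci ce.
move=> h; apply: (le_trans h).
have cvg0 : e n ^+ 2 * D @[n --> \oo] --> (0 : R).
  rewrite -[X in _ --> X](mul0r D); apply: cvgM; last exact: cvg_cst.
  rewrite -[X in _ --> X](mulr0 (0 : R)); apply: cvgM; exact: ecv.
apply/lee_addgt0Pr => d d0; rewrite limn_einf_lim; apply: lime_le; first exact: is_cvg_einfs.
near=> n; apply: (@le_trans _ _ (\int[mu2]_(y in QT T) F n y)%E).
  by apply: ereal_inf_lbound; exists n => //=.
apply: le_trans (H _ (e0 n) (e1 n)) _; rewrite -EFinD lee_fin lerD2l.
by near: n; have := cvgr_le _ cvg0 d d0; apply.
Unshelve. all: by end_near. Qed.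

End limit.

Lemma admissible_parameters_pos (R : realType) (sigma : R -> R) (c rho lam : R) :
  admissible_parameters sigma c rho lam -> 1 < c /\ 0 < lam.
Proof.
case=> c5 _ lam_lo _; have c1 : 1 < c by apply: lt_trans c5; rewrite ltr1n.
by split=> //; apply: lt_trans lam_lo; rewrite divr_gt0 ?expR_gt0 // subr_gt0.
Qed.

Theorem theorem3p2 (R : realType) (k : degeneracy) (T : R) (a : R -> R)
    (tc : R -> R -> R) (omega omega0 : set R) (sigma : R -> R)
    (c rho lam : R)
    (T_gt0 : 0 < T)
    (a_deg : degenerate k a)
    (tc_bounded : Linfty_Q T tc)
    (regions : control_regions omega omega0)
    (sigma_adm : sigma_admissible omega0 sigma)
    (params : admissible_parameters sigma c rho lam) :
  exists C s0 : R, [/\ 0 < C, 0 < s0 &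
    forall (u0 : R -> R) (f u ut ux Mu : R -> R -> R),
      H1a k a u0 -> L2_Q T f ->
      is_solution k T a tc u0 f u ut ux Mu ->
      forall s : R, s0 <= s ->
      (\int[leb2 R]_(z in QT T)
         ((((s * theta T z.1)^-1 * (ut z.1 z.2 ^+ 2 + Mu z.1 z.2 ^+ 2)
            + s * theta T z.1 * a z.2 * ux z.1 z.2 ^+ 2
            + s ^+ 3 * theta T z.1 ^+ 3 * (z.2 ^+ 2 / a z.2) * u z.1 z.2 ^+ 2)
           * expR (2 * s * phi T a c lam z.1 z.2))%R%:E)
       <= C%:E *
          (\int[leb2 R]_(z in QT T)
             ((f z.1 z.2 ^+ 2 * expR (2 * s * phi T a c lam z.1 z.2))%R%:E)
           + (s * a 1)%R%:E *
             \int[leb R]_(t in `]0%R, T[%classic)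
               ((theta T t * left_derivative (u t) 1 ^+ 2
                 * expR (2 * s * phi T a c lam t 1))%R%:E)))%E].
Proof.
have [c1 lam_gt0] := admissible_parameters_pos params.
have [a' [K dc]] := degenerateP a_deg.
have [C [sm [C0 sm1 main]]] := carleman_regularized k T_gt0 dc lam_gt0 c1 tc_bounded.
exists C, sm; split=> //; first exact: lt_le_trans sm1.
move=> u0 f u ut ux Mu [Lu0 _ _ _ _] Lf sol s sms.
have s1 := le_trans sm1 sms; have s0 : 0 < s := lt_le_trans ltr01 s1.
have a1 := dc_gt0 dc ltr01 (lexx 1).
have mQ := measurable_QT T.
pose DT : set (measurableTypeR R) := `]0, T[%classic.
have mD : measurable DT by exact: measurable_itv.
have phiE t x : phi T a c lam t x = tau T t ^+ 4 * psi a c lam x by rewrite /phi thetaE.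
set IF := (\int[leb2 R]_(z in QT T) (f z.1 z.2 ^+ 2 * _)%:E)%E.
set IB := (\int[leb R]_(t in `]0%R, T[%classic) _)%E.
have th0 t : 0 <= theta T t by rewrite /theta invr_ge0 mulr_ge0 // -[4%N]/(2 * 2)%N exprM sqr_ge0.
have IF0 : (0 <= IF)%E by apply: integral_ge0 => z _; rewrite lee_fin mulr_ge0 ?sqr_ge0 // expR_ge0.
have IB0 : (0 <= IB)%E.
  by apply: integral_ge0 => t _; rewrite lee_fin mulr_ge0 ?expR_ge0 // mulr_ge0 ?sqr_ge0.
have sa : 0 < s * a 1 by rewrite mulr_gt0.
(* An infinite integral on the right makes the estimate trivial; finiteness gives
   the integrability that the regularised estimate requires. *)
have [IFoo|] := boolP (IF == +oo%E).
  rewrite (eqP IFoo) addye; last first.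
    by rewrite gt_eqF // (lt_le_trans _ (mule_ge0 _ IB0)) ?ltNy0 // lee_fin ltW.
  by rewrite gt0_muley ?lte_fin // leey.
move=> IFfin; have [IBoo|] := boolP (IB == +oo%E).
  rewrite (eqP IBoo) [((s * a 1)%:E * _)%E]gt0_muley ?lte_fin // addey; last first.
    by rewrite gt_eqF // (lt_le_trans _ IF0) ?ltNy0.
  by rewrite gt0_muley ?lte_fin // leey.
move=> IBfin.
pose bd := boundary_density T a c lam ux Mu s.
have mbd : measurable_fun DT bd := boundary_density_measurable c lam dc sol s.
have bd0 t : 0 <= bd t by rewrite /bd /boundary_density -thetaE mulr_ge0 ?sqr_ge0 // mulr_ge0 ?expR_ge0.
have bdIB : (\int[leb R]_(t in DT) (bd t)%:E <= IB)%E.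
  apply: ae_ge0_le_integral_any => //.
    by move=> t _; rewrite mulr_ge0 ?expR_ge0 // mulr_ge0 ?sqr_ge0.
  apply: ae_mono (good_time_ae sol dc) => t H; rewrite /DT /= in_itv /= => tT.
  have [[p [_ _ ld p1]] _] := H tT.
  by rewrite /bd /boundary_density ld p1 phiE thetaE mulrAC.
have iB : (leb R).-integrable DT (EFin \o bd).
  apply/integrableP; split; first exact/measurable_EFinP.
  under eq_integral do rewrite /= ger0_norm //.
  by apply: (le_lt_trans bdIB); rewrite ltey.
pose F z := f z.1 z.2 ^+ 2 * expR (2 * s * (tau T z.1 ^+ 4 * psi a c lam z.2)).
have FE : IF = (\int[leb2 R]_(z in QT T) (F z)%:E)%E.
  by apply: eq_integral => z _; rewrite phiE.
have F0 z : 0 <= F z by rewrite mulr_ge0 ?sqr_ge0 // expR_ge0.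
have iF : (leb2 R).-integrable (QT T) (EFin \o F).
  apply/integrableP; split.
    apply/measurable_EFinP; apply: measurable_funM.
      by apply: measurable_funX; exact: L2_measurable Lf.
    apply: measurableT_comp; first exact: measurable_expR.
    apply: measurable_funM; first exact: measurable_cst.
    apply: measurable_funM; last exact: measurable_space (psi_measurable dc c lam).
    by apply: measurable_funX; exact: (measurable_time (@tau_measurable R T)).
  under eq_integral do rewrite /= ger0_norm //.
  by rewrite -FE ltey.
have [D HD] := main _ _ _ _ _ _ Lu0 Lf sol s sms iB iF.
have mN := carleman_density_measurable c lam dc sol s (primitive_L2 Lu0 sol).
have N0 z : QT T z -> 0 <= carleman_density T a c lam (primitive u0 ut) ut ux Mu s z.
  move=> _; rewrite /carleman_density -[12%N]/(4 * 3)%N exprM -thetaE.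
  rewrite mulr_ge0 ?expR_ge0 // addr_ge0 //.
    rewrite addr_ge0 // mulr_ge0 ?sqr_ge0 //; last by rewrite mulr_ge0 // ltW.
      by rewrite invr_ge0 mulr_ge0 // ltW.
    by rewrite addr_ge0 ?sqr_ge0.
  rewrite mulr_ge0 ?sqr_ge0 // mulr_ge0 ?sqr_ge0 //.
  by rewrite mulr_ge0 ?exprn_ge0 // ltW.
have fin := fatou_regularization mN N0 HD.
have LHSE z : QT T z -> ((s * theta T z.1)^-1 * (ut z.1 z.2 ^+ 2 + Mu z.1 z.2 ^+ 2)
    + s * theta T z.1 * a z.2 * ux z.1 z.2 ^+ 2
    + s ^+ 3 * theta T z.1 ^+ 3 * (z.2 ^+ 2 / a z.2) * u z.1 z.2 ^+ 2)
    * expR (2 * s * phi T a c lam z.1 z.2) = carleman_density T a c lam u ut ux Mu s z.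
  case: z => t x [/= tT /andP[x0 x1]]; rewrite /carleman_density /= phiE !thetaE -exprM.
  rewrite (rho2E dc x0 (ltW x1)) (exprMn _ _ (ux t x)) (sqrt_coefK dc x0 (ltW x1)).
  by rewrite -(mulrA (s * tau T t ^+ 4)).
(* [fatou_regularization] speaks of the representative [primitive u0 ut] of [u]. *)
rewrite [leLHS](_ : _ = (\int[leb2 R]_(z in QT T) (carleman_density T a c lam (primitive u0 ut) ut ux Mu s z)%:E)%E); last first.
  apply: ae_eq_integral => //.
  - apply/measurable_EFinP; apply: (eq_measurable_fun (carleman_density T a c lam u ut ux Mu s)).
      by move=> z /set_mem Qz; rewrite LHSE.
    by have := carleman_density_measurable c lam dc sol s (sol_u_L2 sol).
  - exact/measurable_EFinP.
  apply: ae_mono (primitive_ae Lu0 sol) => z H Qz.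
  by rewrite LHSE // /carleman_density (H Qz).
apply: (le_trans fin).
rewrite EFinM EFinD lee_pmul2l // leeD //.
  by rewrite FE /Rintegral fineK //; have := integrable_fin_num mQ iF.
rewrite EFinM lee_pmul2l //; apply: le_trans bdIB.
by rewrite /Rintegral fineK //; have := integrable_fin_num mD iB.
Qed.
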